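(* Let $K=\mathbb{C}(t)$. If $L$ and $M$ are finite extensions of $K$ such that $L\otimes_K M$ is a field of genus zero, then at least one of $L$ and $M$ is ramified over no more than $4$ valuations of $K$.
   Context: Valuations of $K=\mathbb{C}(t)$ are the discrete valuations trivial on $\mathbb{C}$, i.e. the points of $\mathbb{P}^1(\mathbb{C})$. A finite extension of $K$ that is a field has genus zero if it is isomorphic to $\mathbb{C}(t)$ as a $\mathbb{C}$-algebra (equivalently, it is the function field of a smooth projective curve of genus $0$ over $\mathbb{C}$). A finite extension $L/K$ is ramified over a valuation $x$ of $K$ if some valuation of $L$ lying over $x$ has ramification index greater than $1$. *)

(* Defs.v *)
From HB Require Import structures.
From mathcomp Require Import all_boot all_order all_algebra all_field.
From mathcomp Require Import sesquilinear.
From mathcomp Require Import complex.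
From mathcomp Require Import classical_sets cardinality reals.

Set Implicit Arguments.
Unset Strict Implicit.
Unset Printing Implicit Defensive.

Import Order.TTheory GRing.Theory Num.Theory.

Local Open Scope ring_scope.
Local Open Scope classical_set_scope.

Section TensorProduct.
Variables (K : fieldType) (L M T : fieldExtType K).
Variables (iL : {lrmorphism L -> T}) (iM : {lrmorphism M -> T}).

(* The pure tensor x (x) y is iL x * iM y; as iL and iM are morphisms of
   K-algebras, the universal property of the K-module determines T, iL and iM
   as the K-algebra L (x)_K M with its two canonical maps. *)
Definition is_tensor_product : Prop :=
  forall (V : lmodType K) (b : {bilinear L -> M -> V}),
    (exists h : {linear T -> V}, forall x y, h (iL x * iM y) = b x y) /\
    (forall h1 h2 : {linear T -> V},
       (forall x y, h1 (iL x * iM y) = b x y) ->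
       (forall x y, h2 (iL x * iM y) = b x y) -> h1 =1 h2).

End TensorProduct.

(* Normalized discrete valuations F^* -> Z. The value +oo at 0 is replaced by
   the fixed junk value 0, so that a valuation is determined by its
   restriction to F^*. *)
Definition discrete_valuation (F : fieldType) (v : F -> int) : Prop :=
  [/\ v 0 = 0,
      forall x y, x != 0 -> y != 0 -> v (x * y) = v x + v y,
      forall x y, x != 0 -> y != 0 -> x + y != 0 ->
        Num.min (v x) (v y) <= v (x + y) &
      exists x, x != 0 /\ v x = 1].

Section Ramification.
Variables (K : fieldType) (L : fieldExtType K).

(* Both valuations have value group Z, so e is the index of the value group
   of v in that of w. *)
Definition lies_over_with_index (v : K -> int) (w : L -> int) (e : nat) :
    Prop :=
  (0 < e)%N /\ forall a : K, w a%:A = e%:Z * v a.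

Definition ramified_over (v : K -> int) : Prop :=
  exists (w : L -> int) (e : nat),
    [/\ discrete_valuation w, lies_over_with_index v w e & (1 < e)%N].

End Ramification.

Arguments ramified_over {K} L v.

Notation ratfun R := {fraction {poly R[i]}}.

Section RationalFunctions.
Variable R : realType.

Definition ratfunC (c : R[i]) : ratfun R := tofrac c%:P.

(* The valuations of C(t) that are trivial on C; valuations of a finite
   extension lying over one of these are automatically trivial on C. *)
Definition valuation_ratfun (v : ratfun R -> int) : Prop :=
  discrete_valuation v /\ forall c : R[i], c != 0 -> v (ratfunC c) = 0.

Definition ramification_locus (L : fieldExtType (ratfun R)) :
    set (ratfun R -> int) :=
  [set v | valuation_ratfun v /\ ramified_over L v].

Definition genus_zero (T : fieldExtType (ratfun R)) : Prop :=
  exists f : {rmorphism ratfun R -> T},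
    bijective f /\ forall c : R[i], f (ratfunC c) = (ratfunC c)%:A.

End RationalFunctions.

(* Main.v *)
Require Import Defs.
From HB Require Import structures.
From mathcomp Require Import all_boot all_order all_algebra all_field.
From mathcomp Require Import perm polyXY sesquilinear complex.
From mathcomp Require Import boolp classical_sets cardinality reals.
From mathcomp Require Import zify ring.

(** Let C be the constant field and T = L (x)_K M = C(z).  By Lueroth L = C(x)
    and M = C(y), and one coordinate tau of K = C(tau) may be chosen so that
    infinity is unramified everywhere and all coordinates take the value
    infinity at a common point.  Then tau = A1(x)/B1(x) = A2(y)/B2(y) with
    numerators monic of degree m = [L:K] and n = [M:K] and denominators one
    degree lower; a pair of this shape is called a cover.  Valuations of K
    ramified in L correspond to branch values of A1/B1, the c such that
    A1 - c B1 has a multiple root.  By symmetry suppose m <= n.  The claim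
    proved is that A1/B1 has at most four branch values
    ([branch_values_le4]).

    Suppose there are five.  For each c let the e_i and f_j be the root
    multiplicities of A1 - c B1 and A2 - c B2.  Riemann-Hurwitz, read off the
    Wronskians of the two covers and of the cover z -> y, gives three
    inequalities ([cover_RH], [cover_RH_le], [fibcost_le]).  The third uses
    that at most gcd(e_i, f_j) points of the z-line lie over a pair of points,
    and bounds the sum of e_i - gcd(e_i, f_j).  An elementary argument
    ([fibre_numerics]) leaves three cases, each on two or three fibres: a
    prime l divides all e_i and f_j of two fibres (Kummer), or the f_j are
    divisible by 2, 3, 4 (octahedral) or by 2, 3, 5 (icosahedral) with the
    e_i divisible likewise up to at most two odd ones over the first value.

    Linear disjointness of L and M rules out each case.  If w in M and
    tau = P(w)/Q(w) has degree d, then w has degree d over K, hence over L,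
    so it satisfies no equation of degree less than d over C(x)
    ([degree_ge], [linearly_disjoint]).
    - Kummer: (tau - a)/(tau - b) is an l-th power in L and in M; the two
      roots differ by a constant, so a root w lies in both ([no_kummer]).
    - Octahedral: tau has degree 6 in a cube root w of
      (1 + k eta)/(1 - k eta), where eta^2 = (tau - a)/(tau - c).  This w lies
      in M; it also lies in a quadratic extension C(u) of C(x), because there
      the same factorisation into coprime cubes takes place
      ([no_octahedral]).
    - Icosahedral: with p(t) = t^3 (t^2 + 5 t + 40), whose critical values are
      0 and 1728, p(w) is a Moebius transform of tau.  It has a root in M and
      a root in L, so the root in M has degree at most 4 over L
      ([no_icosahedral]).

    The root exists by [quintic_root]: if X^3 - 1728 Z^5 = Y^2 h with
    X and Z coprime, deg h <= 2 and X^3, Z^5 and Y^2 h of equal degrees, then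
    p(t) = X^3/Z^5 is solvable in C(u).  Without a root the quintic has at most two irreducible
    factors.  Linear algebra gives a three-dimensional space of elements of
    C(u)[t], of degree at most 4 in t, that are integral over C[u] and over
    C[1/u] modulo each factor ([lattice_sections]), so constant modulo each.
    Some nonzero combination then vanishes modulo both factors, hence modulo
    the quintic, which is impossible for its degree. *)

Set Implicit Arguments.
Unset Strict Implicit.
Unset Printing Implicit Defensive.

(** * Numerical constraints on two families of ramified fibres *)

(** The ramification of a fibre with multiplicities e: the sum of the e_i - 1. *)
Definition ram (e : seq nat) := \sum_(i <- e) i.-1.
(** The sum of e_i - gcd(e_i, f): a lower bound for the ramification of the
    compositum over a point of multiplicity f of the other cover. *)
Definition relram (e : seq nat) (f : nat) := \sum_(i <- e) (i - gcdn i f).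
(** [relram] summed over the points, of multiplicities fs, of a fibre of the
    second cover. *)
Definition fibcost (e fs : seq nat) := \sum_(f <- fs) relram e f.

Lemma sum_ram e : all (leq 1) e -> ram e + size e = \sum_(i <- e) i.
Proof.
rewrite /ram; elim: e => [|i e IH] /=; first by rewrite !big_nil.
by case/andP=> hi /IH; rewrite !big_cons; lia.
Qed.

Lemma relram1 e : relram e 1 = ram e.
Proof. by apply: eq_bigr => i _; rewrite gcdn1 subn1. Qed.

Lemma relram_eq0 e f : all (leq 1) e ->
  (relram e f == 0) = all (fun i => i %| f) e.
Proof.
rewrite /relram; elim: e => [|i e IH] /=; first by rewrite big_nil.
case/andP=> hi /IH {}IH; rewrite big_cons addn_eq0 IH; congr (_ && _).
rewrite subn_eq0; apply/idP/idP => [h|/gcdn_idPl ->//].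
by apply/gcdn_idPl/eqP; rewrite eqn_leq h dvdn_leq ?dvdn_gcdl.
Qed.

Lemma leq_ram_mem i e : i \in e -> i.-1 <= ram e.
Proof. by move=> he; rewrite /ram (big_rem i he) leq_addr. Qed.

Lemma ram_gt0 e : has (leq 2) e -> 0 < ram e.
Proof. by case/hasP=> i /leq_ram_mem; lia. Qed.

(** The next four inequalities are the arithmetic of [fibre_nondiv], where
    d.+1 stands for the largest gcd(e_i, f0). *)
Lemma fibre_nondiv_dividing q d : 2 <= q -> q * d.+1 * d + 2 * d.+1 <= d.+1 * (q * d.+1).
Proof. by case: q => [|[|q]] // _; nia. Qed.

Lemma fibre_nondiv_large d r f : d < f -> 0 < r -> f * d + 2 * d.+1 <= d.+1 * (r + f).
Proof. by case: r => // r h _; nia. Qed.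

Lemma fibre_nondiv_index d i g : g <= d.+1 -> g <= i -> 0 < g ->
  d.+1 * i.-1 <= d.+1 * (i - g) + i * d.
Proof.
move=> h1 h2 h3; have -> : i - g = i.-1 - g.-1 by lia.
rewrite -{1}(subnK (_ : g.-1 <= i.-1)) ?mulnDr; last by lia.
rewrite leq_add2l; have : d.+1 * g.-1 <= g * d by nia.
by move=> h; apply: leq_trans h _; rewrite leq_mul.
Qed.

Lemma fibre_nondiv_sum d N K S s r Re m f :
  N * d + 2 * d.+1 * s <= d.+1 * (K + N) -> d.+1 * Re <= d.+1 * r + m * d ->
  S + s = N -> d.+1 <= f -> m <= f + N ->
  Re + (f + N) <= r + K + 2 * (f.-1 + S) + 1.
Proof.
move=> h1 h2 h3 h4 h5; rewrite -(leq_pmul2l (ltn0Sn d)).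
have h6 : m * d <= (f + N) * d by rewrite leq_mul.
have -> : 2 * (f.-1 + S) = 2 * f + 2 * S - 2 by lia.
nia.
Qed.

(** A fibre in which some e_i does not divide some f_j is expensive.  The f_j
    are compared with the smallest f0 that some e_i does not divide. *)
Lemma fibre_nondiv (e fs : seq nat) (i0 j0 : nat) :
  all (leq 1) e -> all (leq 1) fs ->
  \sum_(i <- e) i <= \sum_(f <- fs) f ->
  i0 \in e -> j0 \in fs -> ~~ (i0 %| j0) ->
  ram e + \sum_(f <- fs) f <= fibcost e fs + 2 * ram fs + 1.
Proof.
move=> he hf hmn i0e j0f ndv.
pose bad f := (f \in fs) && has (fun i => ~~ (i %| f)) e.
have exb : exists f, bad f by exists j0; rewrite /bad j0f; apply/hasP; exists i0.
(* f0 is the smallest f_j that some e_i does not divide *)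
case: (ex_minnP exb) => f0 /andP[f0f /hasP[i1 i1e ndv1]] minf0.
have f0gt0 : 0 < f0 by move/allP: hf => /(_ _ f0f).
(* an f_j below f0 is divisible by all e_i, so it is a proper multiple of D *)
pose D := \max_(i <- e) gcdn i f0.
have leD i : i \in e -> gcdn i f0 <= D by move=> ie; apply: leq_bigmax_seq.
have D_gt0 : 0 < D by apply: leq_trans (leD _ i1e); rewrite gcdn_gt0 f0gt0 orbT.
have [k [ke Dk]] : exists k, k \in e /\ D = gcdn k f0.
  rewrite /D; have: e != [::] by case: (e) i1e.
  elim: (e) => // a l IH _; rewrite big_cons.
  have [->|/IH[k [kl ->]]] := eqVneq l [::].
    by exists a; rewrite big_nil maxn0 inE eqxx.
  rewrite /maxn; case: ifP => _; first by exists k; rewrite inE kl orbT.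
  by exists a; rewrite inE eqxx.
have Df0 : D <= f0 by rewrite Dk dvdn_leq ?dvdn_gcdr.
have Dle f : f \in fs -> f * D.-1 + 2 * D <= D * (relram e f + f).
  move=> ff; have [h0|h0] := eqVneq (relram e f) 0.
    have dv : {in e, forall i, i %| f}.
      by apply/allP; rewrite -relram_eq0 // h0.
    have Df : D %| f by rewrite Dk (dvdn_trans (dvdn_gcdl _ _)) ?dv.
    have fgt0 : 0 < f by move/allP: hf => /(_ _ ff).
    have: f != D.
      apply: contra ndv1 => /eqP fD.
      by rewrite (dvdn_trans (dv _ i1e)) // fD Dk dvdn_gcdr.
    case/dvdnP: Df => q Eq; rewrite h0 {}Eq in fgt0 * => ne.
    have q2 : 2 <= q by case: q ne fgt0 => [|[|q]]; rewrite ?mul1n ?eqxx.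
    by rewrite add0n; case: (D) D_gt0 => // d _; apply: fibre_nondiv_dividing.
  have f0lef : f0 <= f.
    apply: minf0; rewrite /bad ff /= has_predC.
    by rewrite -(relram_eq0 _ he).
  have : 0 < relram e f by rewrite lt0n.
  case: (D) D_gt0 Df0 => // d _ h h'; apply: fibre_nondiv_large => //; exact: leq_trans f0lef.
have Gl l : all (leq 1) l -> {subset l <= e} ->
    D * ram l <= D * relram l f0 + (\sum_(i <- l) i) * D.-1.
  rewrite /ram /relram; elim: l => [|i l IH] /=; first by rewrite !big_nil muln0.
  case/andP => hi hl sub; rewrite !big_cons.
  have {}IH := IH hl (fun j jl => sub j (mem_behead (s := i :: l) jl)).
  have h1 : gcdn i f0 <= D by apply: leD; apply: sub; rewrite inE eqxx.
  have h2 : gcdn i f0 <= i by rewrite dvdn_leq ?dvdn_gcdl.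
  have h3 : 0 < gcdn i f0 by rewrite gcdn_gt0 hi.
  have h4 : D * i.-1 <= D * (i - gcdn i f0) + i * D.-1.
    by case: (D) D_gt0 h1 => // d _ h1; apply: fibre_nondiv_index.
  by move: IH h4; clear; rewrite !mulnDr mulnDl; lia.
have Gle := Gl e he (fun _ => id).
have tot : \sum_(f <- rem f0 fs) (f * D.-1 + 2 * D) <=
           \sum_(f <- rem f0 fs) (D * (relram e f + f)).
  rewrite !big_seq; apply: leq_sum => f /mem_rem; exact: Dle.
have sum2 : forall l, all (leq 1) l ->
    \sum_(f <- l) (f * D.-1 + 2 * D) = (\sum_(f <- l) f) * D.-1 + 2 * D * size l.
  clear; by elim=> [|a l IH] /=; rewrite ?big_nil ?big_cons ?muln0 //= => /andP[_ /IH ->]; rewrite mulnDl mulnS; lia.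
have sum3 : forall l, \sum_(f <- l) (D * (relram e f + f)) =
    D * (fibcost e l + \sum_(f <- l) f).
  clear; rewrite /fibcost; elim=> [|a l IH] /=; rewrite ?big_nil ?big_cons ?muln0 //= IH; rewrite -mulnDr; congr (_ * _); lia.
have hfr : all (leq 1) (rem f0 fs).
  by apply/allP => f /mem_rem; move/allP: hf; apply.
rewrite sum2 // sum3 in tot.
have S1 := sum_ram hfr.
have -> : fibcost e fs = relram e f0 + fibcost e (rem f0 fs).
  exact: big_rem.
have -> : ram fs = f0.-1 + ram (rem f0 fs) by exact: big_rem.
have E1 : \sum_(f <- fs) f = f0 + \sum_(f <- rem f0 fs) f by exact: big_rem.
rewrite E1 in hmn *.
move: hmn; move: tot Gle S1 Df0 f0gt0; clear -D_gt0.
move: (\sum_(f <- rem f0 fs) f) (fibcost e _) (ram (rem _ _)) (size _) (relram e f0)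
  (ram e) (\sum_(i <- e) i) => N K S s r Re m.
move=> tot Gle S1 Df0 f0gt0 hmn.
by case: (D) D_gt0 tot Gle Df0 => // d _ /=; intros; apply: (@fibre_nondiv_sum d _ _ _ s _ _ m).
Qed.

Lemma count1_ram fs : all (leq 1) fs ->
  \sum_(f <- fs) f <= count_mem 1 fs + 2 * ram fs.
Proof.
rewrite /ram; elim: fs => [|f fs IH] /=; first by rewrite !big_nil.
case/andP=> hf /IH {IH}; rewrite !big_cons /=.
by case: (eqVneq f 1) => [->|/eqP ne] /=; lia.
Qed.

(** An unramified point of the second cover makes the fibre more expensive
    still. *)
Lemma fibre_unram (e fs : seq nat) :
  all (leq 1) fs -> has (leq 2) e -> 1 \in fs ->
  ram e + \sum_(f <- fs) f + (count_mem 1 fs).-1 * (ram e).-1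
    <= fibcost e fs + 2 * ram fs + 1.
Proof.
move=> hf /ram_gt0 R0 f1.
have h : count_mem 1 fs * (ram e).-1 + \sum_(f <- fs) f <=
  fibcost e fs + 2 * ram fs.
  rewrite {2}/ram /fibcost; elim: fs hf {f1} => [|f fs IH] /=.
    by rewrite !big_nil.
  case/andP=> hf /IH {IH}; rewrite !big_cons /=.
  case: (eqVneq f 1) => [->|/eqP ne] /=; last by rewrite add0n; lia.
  by rewrite relram1 add1n mulSn; lia.
have : 0 < count_mem 1 fs by rewrite -has_count has_pred1.
move: (count_mem 1 fs) h => [|v] // h _ /=; move: R0 h.
by case: (ram e) => // r _; rewrite /= mulSn; lia.
Qed.

(** Every e_i divides every f_j. *)
Definition divfib (e fs : seq nat) := all (fun f => all (fun i => i %| f) e) fs.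

(** The least common multiple of a sequence. *)
Definition lcm_seq (e : seq nat) := foldr lcmn 1 e.

Lemma divfibP (e fs : seq nat) : has (leq 2) e -> all (leq 1) e ->
  divfib e fs ->
  [/\ 2 <= lcm_seq e, all (fun i => i %| lcm_seq e) e &
      all (fun f => lcm_seq e %| f) fs].
Proof.
move=> /hasP[i ie i2] pe /allP h; rewrite /lcm_seq.
have [E0 dvE] : 0 < foldr lcmn 1 e /\ all (fun i => i %| foldr lcmn 1 e) e.
  elim: (e) pe => //= j l IH /andP[j0 /IH[l0 dl]].
  rewrite lcmn_gt0 j0 l0 dvdn_lcml; split=> //=.
  by apply: sub_all dl => k /dvdn_trans; apply; rewrite dvdn_lcmr.
split=> //.
  by apply: leq_trans i2 (dvdn_leq E0 _); move/allP: dvE; apply.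
apply/allP => f /h; elim: (e) => [|j l IH] /=; first by rewrite dvd1n.
by case/andP=> jf /IH; rewrite dvdn_lcm jf.
Qed.

Lemma size_dvd_ge E (e : seq nat) : 0 < E -> all (fun i => i %| E) e ->
  \sum_(i <- e) i <= E * size e.
Proof.
move=> E0; elim: e => [|i e IH] /=; first by rewrite big_nil.
by case/andP=> /(dvdn_leq E0) h /IH; rewrite big_cons mulnS; lia.
Qed.

Lemma size_dvd_le E (e : seq nat) : all (leq 1) e -> all (fun i => E %| i) e ->
  E * size e <= \sum_(i <- e) i.
Proof.
elim: e => [|i e IH] /=; first by rewrite muln0.
by case/andP=> i0 /IH{}IH /andP[/(dvdn_leq i0) h /IH]; rewrite big_cons mulnS; lia.
Qed.

Lemma sum_dvd E (e : seq nat) : all (fun i => E %| i) e ->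
  E %| \sum_(i <- e) i.
Proof. by move=> h; rewrite big_seq; apply: dvdn_sum => i /(allP h). Qed.

(** The number of multiplicities not divisible by l. *)
Definition ndvd l (e : seq nat) := count (fun i => ~~ (l %| i)) e.

Lemma ndvd0 l e : (ndvd l e == 0) = all (fun i => l %| i) e.
Proof. by rewrite /ndvd -leqn0 leqNgt -has_count has_predC negbK. Qed.

Lemma ndvd2_odd e : odd (ndvd 2 e) = odd (\sum_(i <- e) i).
Proof.
rewrite /ndvd; elim: e => [|i e IH]; rewrite ?big_nil ?big_cons //=.
by rewrite !oddD IH dvdn2 negbK; case: (odd i).
Qed.

Lemma size_dvd_prime l (e : seq nat) : prime l -> all (fun i => i %| l) e ->
  l * size e = \sum_(i <- e) i + l.-1 * ndvd l e.
Proof.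
move=> pl; rewrite /ndvd; elim: e => [|i e IH] /=; rewrite ?big_nil ?muln0 //.
have l0 := prime_gt1 pl.
case/andP=> /(primeP pl).2 /orP[] /eqP -> /IH{}IH; rewrite big_cons mulnS IH.
  by rewrite dvdn1 (gtn_eqF l0) /= add1n mulnS; lia.
by rewrite dvdnn add0n addnA.
Qed.

Lemma size_dvd2 E (e : seq nat) : 0 < E -> all (fun i => i %| E) e -> 2 %| E ->
  2 * (\sum_(i <- e) i) + E * ndvd 2 e <= 2 * (E * size e).
Proof.
move=> E0 + E2; rewrite /ndvd; elim: e => [|i e IH] /=.
  by rewrite !big_nil !muln0.
case/andP=> /dvdnP[k Ek] /IH{IH}; rewrite big_cons mulnS !mulnDr.
suff : 2 * i + E * ~~ (2 %| i) <= 2 * E.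
  by lia.
have [//|ndv] := boolP (2 %| i); rewrite ?muln0 ?muln1 /=.
  by rewrite addn0 leq_pmul2l // dvdn_leq // Ek dvdn_mull.
have : 2 %| k by move: E2; rewrite Ek Euclid_dvdM // (negPf ndv) orbF.
case/dvdnP=> -[|q] kq; first by rewrite Ek kq in E0.
by rewrite Ek kq; clear; nia.
Qed.

(** Type (2, 2, k).  The aa, ab, ac (resp. ba, bb, bc) count the points of the
    three fibres of the first (resp. second) cover, rho is the ramification of
    the first cover elsewhere, and oa, ob count the odd multiplicities over a, b. *)
Lemma dihedral_odd k m n rho (aa ab ac ba bb bc oa ob : nat) :
  odd k -> 2 <= k -> 2 %| n -> m <= n -> 2 <= rho ->
  2 * aa = m + oa -> 2 * ab = m + ob -> m <= k * ac ->
  2 * ba <= n -> 2 * bb <= n -> k * bc <= n ->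
  aa + ab + ac = m + 2 + rho -> 2 * n + 2 * rho <= ba + bb + bc + m + 1 ->
  oa + ob = 0.
Proof.
move=> ok k2 n2 hmn r2 ha hb hc ka kb kc sa sb.
have [//|o0] := eqVneq (oa + ob) 0; exfalso.
have hac : ac <= 1 + rho by lia.
have hbc : n - m + 2 * rho <= bc.+1 by lia.
have h1 : m <= k * (1 + rho) by apply: leq_trans hc _; rewrite leq_mul2l hac orbT.
have h2 : k * (n - m + 2 * rho) <= n + k.
  by apply: leq_trans (_ : k * bc.+1 <= _); rewrite ?leq_mul2l ?hbc ?orbT ?mulnS //; lia.
have [d Ed] : exists d, n = m + d by exists (n - m); lia.
have P2 : 2 * d <= k * d by rewrite leq_mul2r k2 orbT.
have Q2 : k * 2 <= k * rho by rewrite leq_mul2l r2 orbT.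
move: h1 h2; rewrite Ed addKn !mulnDr muln1 muln0 => h1 h2.
have d0 : d = 0 by lia.
have r0 : k * rho = k * 2 by lia.
have : n = 3 * k by lia.
by move=> E; move: n2; rewrite E dvdn2 oddM ok.
Qed.

Lemma dihedral_even k m n rho (aa ab ac ba bb bc oa ob oc : nat) :
  2 <= k -> m <= n -> 2 <= rho ->
  2 * aa = m + oa -> 2 * ab = m + ob -> 2 * m + k * oc <= 2 * (k * ac) ->
  2 * ba <= n -> 2 * bb <= n -> k * bc <= n ->
  aa + ab + ac = m + 2 + rho -> 2 * n + 2 * rho <= ba + bb + bc + m + 1 ->
  3 <= oa + ob + oc -> False.
Proof.
move=> k2 hmn r2 ha hb hc ka kb kc sa sb o3.
have hac : 2 * ac + oa + ob = 4 + 2 * rho by lia.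
have hbc : n - m + 2 * rho <= bc.+1 by lia.
have h1 : 2 * m + k * (oa + ob + oc) <= k * (4 + 2 * rho).
  by rewrite -hac !mulnDr; lia.
have h1' : k * 3 <= k * (oa + ob + oc) by rewrite leq_mul2l o3 orbT.
have h2 : k * (n - m + 2 * rho) <= n + k.
  by apply: leq_trans (_ : k * bc.+1 <= _); rewrite ?leq_mul2l ?hbc ?orbT ?mulnS //; lia.
have [d Ed] : exists d, n = m + d by exists (n - m); lia.
have P2 : 2 * d <= k * d by rewrite leq_mul2r k2 orbT.
have Q2 : k * 2 <= k * rho by rewrite leq_mul2l r2 orbT.
move: h1 h2; rewrite Ed addKn [k * (4 + _)]mulnDr [k * (d + _)]mulnDr mulnCA.
by move=> h1 h2; lia.
Qed.

(** In two fibres l divides all multiplicities e, e' of the first cover and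
    f, f' of the second. *)
Definition kummer l (e f e' f' : seq nat) :=
  [/\ all (dvdn l) e, all (dvdn l) f, all (dvdn l) e' & all (dvdn l) f'].

(** Ramification of type (2, 3, 4), where the first cover has two odd
    multiplicities over the first branch value. *)
Definition octahedral (ea fa eb fb ec fc : seq nat) :=
  ndvd 2 ea = 2 /\ [/\ all (dvdn 2) fa, all (dvdn 3) eb, all (dvdn 3) fb,
                       all (dvdn 2) ec & all (dvdn 2) fc].
(** Ramification of type (2, 3, 5), where the first cover has at most two odd
    multiplicities over the first branch value. *)
Definition icosahedral (ea fa eb fb ec fc : seq nat) :=
  ndvd 2 ea <= 2 /\ [/\ all (dvdn 2) fa, all (dvdn 3) eb, all (dvdn 3) fb,
                       all (dvdn 5) ec & all (dvdn 5) fc].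

Lemma all_dvdn_trans d E (s : seq nat) : d %| E -> all (dvdn E) s -> all (dvdn d) s.
Proof. by move=> dE; apply: sub_all => i; apply: dvdn_trans. Qed.

Lemma size_dvd4 (e : seq nat) : all (fun i => i %| 4) e ->
  \sum_(i <- e) i + 3 * ndvd 2 e <= 4 * size e.
Proof.
rewrite /ndvd; elim: e => [|i e IH] /=; first by rewrite big_nil.
case/andP=> i4 /IH; rewrite big_cons.
by case: i i4 => [|[|[|[|[|i]]]]] //= h; first [lia | have := dvdn_leq isT h; lia].
Qed.

(** Only the platonic types have so few points. *)
Lemma spherical m n rho (ba bb bc Ea Eb Ec : nat) :
  Ea * ba <= n -> Eb * bb <= n -> Ec * bc <= n ->
  2 <= Ea -> Ea <= Eb -> Eb <= Ec -> m <= n -> 2 <= rho ->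
  2 * n + 2 * rho <= ba + bb + bc + m + 1 ->
  Ea = 2 /\ (Eb = 2 \/ Eb = 3 /\ [\/ Ec = 3, Ec = 4 | Ec = 5]).
Proof.
move=> la lb lc Ea2 Eab Ebc hmn r2 sb.
have lowE k E x : k <= E -> E * x <= n -> k * x <= n.
  by move=> kE; apply: leq_trans; rewrite leq_mul2r kE orbT.
have Ea_eq : Ea = 2.
  have [E3|] := leqP 3 Ea; last by lia.
  have := lowE 3 _ _ E3 la; have := lowE 3 _ _ (leq_trans E3 Eab) lb.
  have := lowE 3 _ _ (leq_trans (leq_trans E3 Eab) Ebc) lc; lia.
subst Ea; split=> //.
have [E4|E4] := leqP 4 Eb.
  have := lowE 4 _ _ E4 lb; have := lowE 4 _ _ (leq_trans E4 Ebc) lc; lia.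
have [->|Eb3] : Eb = 2 \/ Eb = 3 by lia.
  by left.
right; split=> //; subst Eb.
have [E6|] := leqP 6 Ec; first by have := lowE 6 _ _ E6 lc; lia.
by case: (Ec) Ebc => [|[|[|[|[|[|]]]]]] // _ _;
  [constructor 1|constructor 2|constructor 3].
Qed.

(** In the next three lemmas oa, ob, oc count the multiplicities not divisible by
    2, 3, 3, by 2, 3, 2 and by 2, 3, 5 respectively. *)
Lemma tetrahedral_num m n rho (aa ab ac ba bb bc oa ob oc : nat) :
  2 * aa = m + oa -> 3 * ab = m + 2 * ob -> 3 * ac = m + 2 * oc ->
  2 * ba <= n -> 3 * bb <= n -> 3 * bc <= n -> m <= n -> 2 <= rho ->
  aa + ab + ac = m + 2 + rho -> 2 * n + 2 * rho <= ba + bb + bc + m + 1 ->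
  ob + oc = 0.
Proof. lia. Qed.

Lemma octahedral_num m n rho (aa ab ac ba bb bc oa ob oc : nat) :
  2 * aa = m + oa -> 3 * ab = m + 2 * ob -> m + 3 * oc <= 4 * ac ->
  2 * ba <= n -> 3 * bb <= n -> 4 * bc <= n -> m <= n -> 2 <= rho ->
  odd oa = odd m -> odd oc = odd m ->
  aa + ab + ac = m + 2 + rho -> 2 * n + 2 * rho <= ba + bb + bc + m + 1 ->
  [\/ oa + oc = 0 | [/\ oa = 2, ob = 0 & oc = 0]].
Proof.
move=> *; have [|?] := eqVneq (oa + oc) 0; [by left|right; split; lia].
Qed.

Lemma icosahedral_num m n rho (aa ab ac ba bb bc oa ob oc : nat) :
  2 * aa = m + oa -> 3 * ab = m + 2 * ob -> 5 * ac = m + 4 * oc ->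
  2 * ba <= n -> 3 * bb <= n -> 5 * bc <= n -> m <= n -> 2 <= rho ->
  2 %| n -> 3 %| n -> 5 %| n ->
  aa + ab + ac = m + 2 + rho -> 2 * n + 2 * rho <= ba + bb + bc + m + 1 ->
  [/\ oa <= 2, ob = 0 & oc = 0].
Proof.
move=> ha hb hc la lb lc hmn r2 /dvdnP[q2 e2] /dvdnP[q3 e3] /dvdnP[q5 e5] sa sb.
have : m = n by lia.
by split; lia.
Qed.

(** The fibres over three values in which all e_i divide all f_j, with Ea, Eb,
    Ec the least common multiples of the e_i. *)
Lemma three_fibres m n rho (ea eb ec fa fb fc : seq nat) Ea Eb Ec :
  all (leq 1) ea -> all (leq 1) eb -> all (leq 1) ec ->
  all (leq 1) fa -> all (leq 1) fb -> all (leq 1) fc ->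
  \sum_(i <- ea) i = m -> \sum_(i <- eb) i = m -> \sum_(i <- ec) i = m ->
  \sum_(i <- fa) i = n -> \sum_(i <- fb) i = n -> \sum_(i <- fc) i = n ->
  all (fun i => i %| Ea) ea -> all (fun i => i %| Eb) eb ->
  all (fun i => i %| Ec) ec ->
  all (dvdn Ea) fa -> all (dvdn Eb) fb -> all (dvdn Ec) fc ->
  2 <= Ea -> Ea <= Eb -> Eb <= Ec -> m <= n -> 2 <= rho ->
  size ea + size eb + size ec = m + 2 + rho ->
  2 * n + 2 * rho <= size fa + size fb + size fc + m + 1 ->
  [\/ (exists2 l, prime l & [\/ kummer l ea fa eb fb, kummer l ea fa ec fc
        | kummer l eb fb ec fc]),
      octahedral ea fa eb fb ec fc
    | icosahedral ea fa eb fb ec fc].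
Proof.
move=> pea peb pec pfa pfb pfc sea seb sec sfa sfb sfc.
move=> dea deb dec dfa dfb dfc Ea2 Eab Ebc hmn r2 sa sb.
have la : Ea * size fa <= n by rewrite -sfa size_dvd_le.
have lb : Eb * size fb <= n by rewrite -sfb size_dvd_le.
have lc : Ec * size fc <= n by rewrite -sfc size_dvd_le.
have na : Ea %| n by rewrite -sfa sum_dvd.
have nb : Eb %| n by rewrite -sfb sum_dvd.
have nc : Ec %| n by rewrite -sfc sum_dvd.
have oa := ndvd2_odd ea; have ob := ndvd2_odd eb; have oc := ndvd2_odd ec.
rewrite sea in oa; rewrite seb in ob; rewrite sec in oc.
have [Ea_eq Ebc_eq] := spherical la lb lc Ea2 Eab Ebc hmn r2 sb; subst Ea.
have xa := size_dvd_prime (isT : prime 2) dea; rewrite sea mul1n in xa.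
case: Ebc_eq => [Eb_eq|[Eb_eq Ec_eq]]; subst Eb.
  have xb := size_dvd_prime (isT : prime 2) deb; rewrite seb mul1n in xb.
  have pos k : 0 < k -> odd k = odd m -> 0 < k by [].
  have [/eqP|nab] := eqVneq (ndvd 2 ea + ndvd 2 eb) 0.
    rewrite addn_eq0 !ndvd0 => /andP[? ?].
    by constructor 1; exists 2 => //; constructor 1; split.
  have [Eodd|Eeven] := boolP (odd Ec).
    have gc : m <= Ec * size ec.
      by rewrite -sec size_dvd_ge // (leq_trans _ Ebc).
    by rewrite (dihedral_odd Eodd Ebc na hmn r2 xa xb gc la lb lc sa sb) in nab.
  have E2 : 2 %| Ec by rewrite dvdn2.
  have xc := size_dvd2 (leq_trans (isT : 0 < 2) Ebc) dec E2; rewrite sec in xc.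
  have dfc2 := all_dvdn_trans E2 dfc.
  have [/eqP|nac] := eqVneq (ndvd 2 ea + ndvd 2 ec) 0.
    rewrite addn_eq0 !ndvd0 => /andP[? ?].
    by constructor 1; exists 2 => //; constructor 2; split.
  have [/eqP|nbc] := eqVneq (ndvd 2 eb + ndvd 2 ec) 0.
    rewrite addn_eq0 !ndvd0 => /andP[? ?].
    by constructor 1; exists 2 => //; constructor 3; split.
  exfalso; apply: (dihedral_even Ebc hmn r2 xa xb xc la lb lc sa sb).
  move: oa ob oc nab nac nbc; clear.
  by move: (ndvd 2 ea) (ndvd 2 eb) (ndvd 2 ec) => *; lia.
have xb := size_dvd_prime (isT : prime 3) deb; rewrite seb /= in xb.
case: Ec_eq => Ec_eq; subst Ec.
- have xc := size_dvd_prime (isT : prime 3) dec; rewrite sec /= in xc.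
  have /eqP := tetrahedral_num xa xb xc la lb lc hmn r2 sa sb.
  rewrite addn_eq0 !ndvd0 => /andP[? ?].
  by constructor 1; exists 3 => //; constructor 3; split.
- have xc := size_dvd4 dec; rewrite sec in xc.
  have dfc2 := all_dvdn_trans (isT : 2 %| 4) dfc.
  case: (octahedral_num xa xb xc la lb lc hmn r2 oa oc sa sb).
    move=> /eqP; rewrite addn_eq0 !ndvd0 => /andP[? ?].
    by constructor 1; exists 2 => //; constructor 2; split.
  move=> [oa2 /eqP + /eqP]; rewrite !ndvd0 => ob0 oc0.
  by constructor 2; do !split.
- have xc := size_dvd_prime (isT : prime 5) dec; rewrite sec /= in xc.
  case: (icosahedral_num xa xb xc la lb lc hmn r2 na nb nc sa sb).
  move=> oa2 /eqP + /eqP; rewrite !ndvd0 => ob0 oc0.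
  by constructor 3; do !split.
Qed.

Lemma size3_of_bounds n k d :
  2 <= n -> 5 <= k + d -> n * d + 4 <= 4 * n ->
  2 * k * n + n * d + 8 <= 8 * n + 2 * k -> k = 2 /\ d = 3.
Proof.
move=> n2 kd h1 h2.
have d3 : d <= 3 by rewrite leqNgt; apply/negP => d4; nia.
have k2 : k <= 2.
  rewrite leqNgt; apply/negP => k3.
  have [k4|k4] := leqP 4 k; nia.
lia.
Qed.

Lemma sum_seq_lb (I : eqType) (s : seq I) (F G : I -> nat) :
  {in s, forall i, F i <= G i} -> \sum_(i <- s) F i <= \sum_(i <- s) G i.
Proof. by move=> h; rewrite !big_seq; apply: leq_sum. Qed.

(** With at least five branch values, exactly three fibres satisfy [divfib],
    exactly two do not, and the least common multiples in those three are of
    platonic type. *)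
Theorem fibre_numerics (I : eqType) (B : seq I) (e f : I -> seq nat) m n :
  uniq B -> 5 <= size B -> m <= n ->
  {in B, forall c, all (leq 1) (e c) /\ \sum_(i <- e c) i = m} ->
  {in B, forall c, all (leq 1) (f c) /\ \sum_(i <- f c) i = n} ->
  {in B, forall c, has (leq 2) (e c)} ->
  \sum_(c <- B) ram (e c) + 2 = 2 * m ->
  \sum_(c <- B) ram (f c) + 2 <= 2 * n ->
  \sum_(c <- B) fibcost (e c) (f c) + 2 <= 2 * m ->
  exists a b c, [/\ {subset [:: a; b; c] <= B}, uniq [:: a; b; c] &
    [\/ (exists2 l, prime l & [\/ kummer l (e a) (f a) (e b) (f b),
                     kummer l (e a) (f a) (e c) (f c)
                   | kummer l (e b) (f b) (e c) (f c)]),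
      octahedral (e a) (f a) (e b) (f b) (e c) (f c)
    | icosahedral (e a) (f a) (e b) (f b) (e c) (f c)]].
Proof.
move=> uB B5 hmn he hf hR sR sS sC.
pose dv c := divfib (e c) (f c).
have n2 : 2 <= n.
  case: (B) B5 he hR => // c l _ he hR.
  have [pe se] := he c (mem_head _ _); rewrite (leq_trans _ hmn) // -se.
  have /hasP[i ie i2] := hR c (mem_head _ _).
  by rewrite (big_rem i ie) /= (leq_trans i2) // leq_addr.
have ndv c : c \in B -> ~~ dv c ->
    ram (e c) + n <= fibcost (e c) (f c) + 2 * ram (f c) + 1.
  move=> cB; rewrite /dv /divfib -has_predC => /hasP[j jf].
  rewrite /= -has_predC => /hasP[i ie /= ij].
  have [pe se] := he c cB; have [pf sf] := hf c cB.
  by have := fibre_nondiv pe pf _ ie jf ij; rewrite se sf; apply.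
pose E c := lcm_seq (e c).
have hdv c : c \in B -> dv c -> [/\ 2 <= E c,
    all (fun i => i %| E c) (e c) & all (dvdn (E c)) (f c)].
  by move=> cB; have [pe se] := he c cB; apply: divfibP => //; exact: hR.
have dvS c : c \in B -> dv c -> n <= 2 * ram (f c) /\ ram (e c) <= ram (f c).
  move=> cB /(hdv c cB); move: (E c) => q [E2 Ee Ef].
  have [pe se] := he c cB; have [pf sf] := hf c cB.
  have := sum_ram pe; have := sum_ram pf; rewrite se sf.
  have E0 : 0 < q by case: (q) E2.
  have := size_dvd_ge E0 Ee; have := size_dvd_le pf Ef; rewrite se sf.
  move: (size (e c)) (size (f c)) (ram (e c)) (ram (f c)) => a b R S.
  move=> h1 h2 h3 h4; split.
    have : 2 * b <= n by apply: leq_trans h1; rewrite leq_mul2r E2 orbT.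
    lia.
  rewrite -(leq_pmul2l E0); have := leq_mul (leqnn q.-1) hmn.
  case: (q) E0 h1 h2 => // k _ h1 h2 /= h5.
  have {h3} : k.+1 * S + k.+1 * b = k.+1 * n by rewrite -mulnDr h3.
  have {h4} : k.+1 * R + k.+1 * a = k.+1 * m by rewrite -mulnDr h4.
  move: h1 h2; rewrite (mulSn k m) (mulSn k n).
  by move: (k.+1 * S) (k.+1 * b) (k.+1 * R) (k.+1 * a) (k * m) (k * n) h5 => *; lia.
pose D := filter dv B; pose N := filter (predC dv) B.
have splitB F : \sum_(c <- B) F c = \sum_(c <- D) F c + \sum_(c <- N) F c :> nat.
  by rewrite (bigID dv) /= !big_filter.
have szDN : size N + size D = size B by rewrite addnC !size_filter count_predC.
have SD : size D * n <= 2 * \sum_(c <- D) ram (f c).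
  rewrite -sum1_size big_distrl big_distrr /=; apply: sum_seq_lb => c.
  by rewrite mem_filter mul1n => /andP[h cB]; have [] := dvS c cB h.
have RD : \sum_(c <- D) ram (e c) <= \sum_(c <- D) ram (f c).
  by apply: sum_seq_lb => c; rewrite mem_filter => /andP[h cB]; have [] := dvS c cB h.
have GN : \sum_(c <- N) ram (e c) + size N * n <=
    \sum_(c <- N) fibcost (e c) (f c) + 2 * \sum_(c <- N) ram (f c) + size N.
  rewrite -sum1_size big_distrl big_distrr -!big_split /=; apply: sum_seq_lb => c.
  by rewrite mem_filter mul1n => /andP[h cB]; apply: ndv.
(* N and D are the fibres without and with the divisibility property *)
have [szN szD] : size N = 2 /\ size D = 3.
  apply: (size3_of_bounds n2); rewrite ?szDN //; move: sR sS sC; rewrite !splitB.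
    by move: SD; clear; rewrite [n * _]mulnC; lia.
  move: SD RD GN; clear; rewrite [n * _]mulnC -mulnA.
  by move: (size D * n) (size N * n) => *; lia.
have NE : exists x1 x2, N = [:: x1; x2].
  by case: (N) szN => [|x1 [|x2 []]] // _; exists x1, x2.
case: NE => x1 [x2 NE].
have [x1N x2N] : x1 \in N /\ x2 \in N by rewrite NE !inE !eqxx orbT.
have memN x : x \in N -> x \in B by rewrite mem_filter => /andP[].
have SN x : x \in N -> 3 * (ram (e x)).-1 + ram (e x) + n <=
    fibcost (e x) (f x) + 2 * ram (f x) + 1.
  move=> xN; have xB := memN _ xN; have [pf sf] := hf x xB.
  have v4 : 4 <= count_mem 1 (f x).
    have := count1_ram pf; rewrite sf.
    move: sS; rewrite splitB (big_rem x xN (F := fun y => ram (f y))) /=.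
    move: SD; rewrite szD; clear.
    by move: (\sum_(y <- rem x N) _) (\sum_(c <- D) _) (ram (f x)) => *; lia.
  have f1 : 1 \in f x by rewrite -has_pred1 has_count; case: count v4.
  have := fibre_unram pf (hR x xB) f1; rewrite sf; apply: leq_trans.
  rewrite -addnA addnC leq_add2l leq_mul2r.
  by move: v4; case: count => //= v; rewrite ltnS => ->; rewrite orbT.
have RN x : x \in N -> 0 < ram (e x) by move=> /memN /hR; exact: ram_gt0.
pose leE x y := E x <= E y.
have := sort_sorted (fun x y => leq_total (E x) (E y)) D; rewrite -/leE.
have := perm_sort leE D; have := size_sort leE D; rewrite szD.
move Ds : (sort leE D) => D'; case: D' Ds => [|a [|b [|c []]]] // _ _ /permPl pD.
rewrite /= andbT => /andP[ab bc].
have memD x : x \in [:: a; b; c] -> x \in B /\ dv x.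
  by rewrite (perm_mem pD) mem_filter => /andP[].
exists a, b, c; split.
- by move=> x /memD[].
- by have := perm_uniq pD; rewrite filter_uniq // => ->.
have sumD F : \sum_(c <- D) F c = F a + F b + F c :> nat.
  by rewrite -(perm_big _ pD) /= !big_cons big_nil addn0 addnA.
have [aB da] : a \in B /\ dv a by apply: memD; rewrite !inE eqxx.
have [bB db] : b \in B /\ dv b by apply: memD; rewrite !inE eqxx orbT.
have [cB dc] : c \in B /\ dv c by apply: memD; rewrite !inE eqxx !orbT.
have [pea sea] := he a aB; have [peb seb] := he b bB; have [pec sec] := he c cB.
have [pfa sfa] := hf a aB; have [pfb sfb] := hf b bB; have [pfc sfc] := hf c cB.
have [Ea2 dea dfa] := hdv a aB da; have [Eb2 deb dfb] := hdv b bB db.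
have [Ec2 dec dfc] := hdv c cB dc.
pose rho := ram (e x1) + ram (e x2).
have sumN F : \sum_(c <- N) F c = F x1 + F x2 :> nat.
  by rewrite NE !big_cons big_nil addn0.
apply: (three_fibres (rho := rho) pea peb pec pfa pfb pfc sea seb sec sfa sfb sfc
  dea deb dec dfa dfb dfc Ea2 ab bc hmn).
- by rewrite /rho -(addn1 1) leq_add ?RN.
- move: sR; rewrite splitB sumD sumN -/rho.
  have := sum_ram pea; have := sum_ram peb; have := sum_ram pec.
  rewrite sea seb sec; clear.
  move: rho (ram (e a)) (ram (e b)) (ram (e c)) (size (e a)) (size (e b)) (size (e c)).
  clear=> *; lia.
- move: sR sS sC; rewrite !splitB !sumD !sumN /rho.
  have := SN _ x1N; have := SN _ x2N; have := RN _ x1N; have := RN _ x2N.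
  have := sum_ram pfa; have := sum_ram pfb; have := sum_ram pfc.
  rewrite sfa sfb sfc; clear.
  move: (ram (e x1)) (ram (e x2)) (ram (f x1)) (ram (f x2)).
  move: (ram (f a)) (ram (f b)) (ram (f c)) (size (f a)) (size (f b)) (size (f c)).
  move: (ram (e a)) (ram (e b)) (ram (e c)).
  move: (fibcost _ _) (fibcost _ _) (fibcost _ _) (fibcost _ _) (fibcost _ _).
  clear=> *; lia.
Qed.

(** * Roots, covers of the projective line and Riemann-Hurwitz *)

Import Order.TTheory GRing.Theory Num.Theory.
Local Open Scope ring_scope.

(** The multiplicities of the distinct elements of a multiset. *)
Definition mults (T : eqType) (s : seq T) := [seq count_mem x s | x <- undup s].

Section Mults.
Variable T : eqType.
Implicit Types s S : seq T.

Lemma sum_count_mem S s : uniq S ->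
  (\sum_(x <- S) count_mem x s = count (mem S) s)%N.
Proof.
move=> uS; elim: s => [|y s IH] /=; first by rewrite big1.
rewrite big_split /= IH; congr (_ + _)%N.
have [yS|yS] := boolP (y \in S).
  rewrite (big_rem y yS) /= eqxx big_seq big1 ?addn0 // => x.
  by rewrite mem_rem_uniq // inE eq_sym => /andP[/negPf ->].
rewrite big_seq big1 // => x xS; case: eqP => // yx.
by rewrite yx xS in yS.
Qed.

Lemma sum_mults s : (\sum_(i <- mults s) i = size s)%N.
Proof.
rewrite big_map sum_count_mem ?undup_uniq // -[RHS]count_predT.
by apply: eq_in_count => x; rewrite inE /= mem_undup => ->.
Qed.

Lemma mults_gt0 s : all (leq 1) (mults s).
Proof.
apply/allP => i /mapP[x]; rewrite mem_undup => xs ->.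
by rewrite -has_count has_pred1.
Qed.

Lemma ram_mults s : ram (mults s) = (size s - size (undup s))%N.
Proof.
have := sum_ram (mults_gt0 s); rewrite sum_mults size_map => <-.
by rewrite addnK.
Qed.

Lemma ram_multsE s :
  ram (mults s) = (\sum_(x <- undup s) (count_mem x s).-1)%N.
Proof. by rewrite /ram big_map. Qed.

End Mults.

Section Roots.
Variable C : numClosedFieldType.
Implicit Types (p q A B : {poly C}) (c r x : C).

(** The multiset of roots. *)
Definition rts p : seq C := sval (closed_field_poly_normal p).

Lemma rtsE p : p = lead_coef p *: \prod_(z <- rts p) ('X - z%:P).
Proof. exact: svalP (closed_field_poly_normal p). Qed.

Lemma rts_monic p : p \is monic -> p = \prod_(z <- rts p) ('X - z%:P).
Proof. by move/monicP=> h; rewrite {1}[p]rtsE h scale1r. Qed.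

Lemma size_rts p : p != 0 -> size p = (size (rts p)).+1.
Proof.
move=> p0; rewrite {1}[p]rtsE size_scale ?lead_coef_eq0 //.
by rewrite size_prod_XsubC.
Qed.

Lemma count_rts p x : p != 0 -> count_mem x (rts p) = mup x p.
Proof.
move=> p0; rewrite {2}[p]rtsE -mul_polyC mupMr ?mu_prod_XsubC //.
by rewrite rootC lead_coef_eq0.
Qed.

Lemma mem_rts p x : p != 0 -> (x \in rts p) = root p x.
Proof.
move=> p0; rewrite -has_pred1 has_count count_rts // -XsubC_dvd //.
by rewrite dvdp_XsubCl.
Qed.

(** The rational function A/B has degree m and a simple pole at infinity. *)
Definition cover A B m :=
  [/\ A \is monic, size A = m.+1, size B = m, (0 < m)%N & coprimep A B].

(** The fibre of A/B over c, with multiplicities.  Infinity is never in it. *)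
Definition fib A B c := rts (A - c *: B).
(** The multiplicities of the points of the fibre over c. *)
Definition fibm A B c := mults (fib A B c).
(** The numerator of the derivative of A/B. *)
Definition wron A B := A^`() * B - A * B^`().

Section Cover.
Variables (A B : {poly C}) (m : nat).
Hypothesis cAB : cover A B m.

Lemma cover_B0 : B != 0.
Proof. by case: cAB => _ _ sB m0 _; rewrite -size_poly_gt0 sB. Qed.

Lemma cover_size c : size (A - c *: B) = m.+1.
Proof.
have [_ sA sB _ _] := cAB; rewrite size_polyDl // sA size_polyN ltnS.
by rewrite (leq_trans (size_scale_leq _ _)) ?sB.
Qed.

Lemma cover_neq0 c : A - c *: B != 0.
Proof. by rewrite -size_poly_gt0 cover_size. Qed.

Lemma cover_monic c : A - c *: B \is monic.
Proof.
have [mA sA sB _ _] := cAB; rewrite monicE lead_coefDl ?(monicP mA) //.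
by rewrite sA size_polyN ltnS (leq_trans (size_scale_leq _ _)) ?sB.
Qed.

Lemma size_fib c : size (fib A B c) = m.
Proof. by have := size_rts (cover_neq0 c); rewrite cover_size => -[]. Qed.

Lemma fibE c : A - c *: B = \prod_(z <- fib A B c) ('X - z%:P).
Proof. exact/rts_monic/cover_monic. Qed.

Lemma mem_fib c x : (x \in fib A B c) = (A.[x] == c * B.[x]).
Proof.
by rewrite mem_rts ?cover_neq0 // rootE !hornerE subr_eq0.
Qed.

Lemma fib_B_neq0 c x : x \in fib A B c -> B.[x] != 0.
Proof.
have [_ _ _ _ cop] := cAB.
rewrite mem_fib => /eqP h; apply/negP => /eqP B0.
have := coprimep_root cop (_ : root A x); rewrite B0 eqxx rootE h B0 mulr0 eqxx.
by move=> /(_ isT).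
Qed.
Lemma mem_fibE c x : (x \in fib A B c) = (B.[x] != 0) && (A.[x] / B.[x] == c).
Proof.
apply/idP/andP => [h|[B0 /eqP <-]].
  by have B0 := fib_B_neq0 h; move: h; rewrite mem_fib => /eqP ->; rewrite mulfK.
by rewrite mem_fib divfK.
Qed.

Lemma wronE c : wron A B = wron (A - c *: B) B.
Proof. by rewrite /wron derivB derivZ -!mul_polyC; ring. Qed.

(** Ramification is measured by the zeros of the Wronskian. *)
Lemma mup_wron c x : x \in fib A B c ->
  mup x (wron A B) = (count_mem x (fib A B c)).-1.
Proof.
move=> xf; have B0 := fib_B_neq0 xf; rewrite (wronE c) count_rts ?cover_neq0 //.
have P0 := cover_neq0 c; move: xf; rewrite mem_rts //.
move: (A - c *: B) P0 => P P0 rP.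
have [e [Q]] := multiplicity_XsubC P x; rewrite P0 /= => rQ PE.
have -> : mup x P = e.
  by rewrite PE mupMr // mup_XsubCX eqxx.
case: e PE => [|e] PE; first by rewrite PE expr0 mulr1 (negPf rQ) in rP.
(* P = Q (X - x)^(e+1) with Q(x) <> 0 *)
pose W := e.+1%:R *: (Q * B) + ('X - x%:P) * (Q^`() * B - Q * B^`()).
have -> : wron P B = W * ('X - x%:P) ^+ e.
  rewrite /wron /W PE derivM deriv_exp derivXsubC mul1r /= exprS.
  by rewrite -mul_polyC polyC_natr; ring.
rewrite mupMr ?mup_XsubCX ?eqxx // rootE !hornerE subrr mul0r addr0.
by rewrite !mulf_neq0 // pnatr_eq0.
Qed.

Lemma size_wron : size (wron A B) = (2 * m).-1.
Proof.
have [mA sA sB m0 _] := cAB.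
have lA : A`_m = 1 by have := monicP mA; rewrite lead_coefE sA.
have dvc (p : {poly C}) i : p^`()`_i = p`_i.+1 *+ i.+1 by rewrite coef_deriv.
have top (p q : {poly C}) i j : (size p <= i.+1)%N -> (size q <= j.+1)%N ->
    (p * q)`_(i + j) = p`_i * q`_j.
  move=> sp sq; rewrite coefM (bigD1 (inord i)) //= inordK ?ltnS ?leq_addr //.
  rewrite addKn big1 ?addr0 // => k; rewrite -val_eqE /= inordK ?ltnS ?leq_addr // => ki.
  have [ik|ki'] := ltnP i k; first by rewrite nth_default ?mul0r // (leq_trans sp).
  rewrite [X in _ * X]nth_default ?mulr0 // (leq_trans sq) //.
  by rewrite ltn_subRL ltn_add2r ltn_neqAle ki ki'.
have sd (p : {poly C}) k : (size p <= k.+1)%N -> (size p^`() <= k)%N.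
  have [->|p0] := eqVneq p 0; first by rewrite deriv0 size_poly0.
  by move=> h; rewrite -ltnS (leq_trans (lt_size_deriv p0)).
case: m m0 lA sA sB => // k _ lA sA sB.
have -> : (2 * k.+1).-1 = (k + k).+1 by lia.
apply/eqP; rewrite eqn_leq; apply/andP; split.
  rewrite (leq_trans (size_polyD _ _)) // size_polyN geq_max; apply/andP; split.
    rewrite (leq_trans (size_polyMleq _ _)) // sB.
    by have := sd A k.+1; rewrite sA => /(_ (leqnn _)); move: (size _) => t; clear; lia.
  have [->|B'0] := eqVneq B^`() 0; first by rewrite mulr0 size_poly0.
  rewrite (leq_trans (size_polyMleq _ _)) // sA.
  by have := sd B k; rewrite sB => /(_ (leqnn _)); move: (size _) => t; clear; lia.
suff : (wron A B)`_(k + k) != 0.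
  by rewrite ltnNge; apply: contraNN => h; rewrite nth_default.
have sA' : (size A^`() <= k.+1)%N by apply: sd; rewrite sA.
rewrite coefB top ?sB //.
rewrite dvc lA.
have -> : (A * B^`())`_(k + k) = B`_k *+ k.
  clear sA'; case: k sA sB lA => [|k] sA sB lA.
    by rewrite (size1_polyC (_ : (size B <= 1)%N)) ?sB // derivC mulr0 coef0 mulr0n.
  have sB' : (size B^`() <= k.+1)%N by apply: sd; rewrite sB.
  have -> : (k.+1 + k.+1 = k.+2 + k)%N by rewrite addSnnS addnC.
  by rewrite top ?sA // dvc lA mul1r.
rewrite mulrnAl mul1r mulrS addrK.
by rewrite -[k]/(k.+1.-1) -sB -lead_coefE lead_coef_eq0 cover_B0.
Qed.

Lemma wron_neq0 : wron A B != 0.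
Proof. by have [_ _ _ m0 _] := cAB; rewrite -size_poly_gt0 size_wron; lia. Qed.

Lemma uniq_flatten_fib (cs : seq C) : uniq cs ->
  uniq (flatten [seq undup (fib A B c) | c <- cs]).
Proof.
elim: cs => //= c cs IH /andP[ccs /IH u]; rewrite cat_uniq undup_uniq u andbT /=.
apply/hasPn => x /flattenP[_ /mapP[d ds ->]]; rewrite /= !mem_undup !mem_fibE.
move=> /andP[_ /eqP hd]; apply: contra ccs => /andP[_ /eqP hc].
by rewrite -hc hd.
Qed.

Lemma sum_ram_fib (cs : seq C) :
  uniq cs ->
  (\sum_(c <- cs) ram (fibm A B c) =
   count (mem (flatten [seq undup (fib A B c) | c <- cs])) (rts (wron A B)))%N.
Proof.
move=> ucs; rewrite -sum_count_mem.
  rewrite big_flatten /= big_map; apply: eq_bigr => c _.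
  rewrite ram_multsE !big_seq; apply: eq_bigr => x; rewrite mem_undup => xf.
  by rewrite -(mup_wron xf) count_rts // wron_neq0.
exact: uniq_flatten_fib.
Qed.

(** The Riemann-Hurwitz inequality for finitely many fibres. *)
Lemma cover_RH_le (cs : seq C) : uniq cs ->
  (\sum_(c <- cs) ram (fibm A B c) + 2 <= 2 * m)%N.
Proof.
move=> ucs; rewrite (sum_ram_fib ucs).
have := count_size (mem (flatten [seq undup (fib A B c) | c <- cs])) (rts (wron A B)).
have := size_rts wron_neq0; rewrite size_wron.
have [_ _ _ m0 _] := cAB.
by move: (size (rts _)) (count _ _) m m0; clear=> *; lia.
Qed.

(** The finite branch values.  Poles are left out by the separability of B
    wherever it matters. *)
Definition branch_values := undup [seq A.[x] / B.[x] | x <- rts (wron A B)].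

Lemma mem_branch c :
  has (leq 2) (fibm A B c) -> c \in branch_values.
Proof.
case/hasP => i /mapP[x]; rewrite mem_undup => xf -> h2.
rewrite mem_undup; apply/mapP; exists x; last first.
  by move: xf; rewrite mem_fibE => /andP[_ /eqP].
by rewrite mem_rts ?wron_neq0 // -dvdp_XsubCl XsubC_dvd ?wron_neq0 // (mup_wron xf); lia.
Qed.

Hypothesis sepB : coprimep B B^`().

Lemma wron_root_B x : root (wron A B) x -> B.[x] != 0.
Proof.
move=> rw; apply/negP => /eqP B0.
have [_ _ _ _ cop] := cAB; move: rw; rewrite rootE !hornerE B0 mulr0 sub0r oppr_eq0.
rewrite mulf_eq0 => /orP[A0|B'0].
  by have := coprimep_root cop A0; rewrite B0 eqxx.
have := @coprimep_root _ B B^`() x sepB; rewrite rootE B0 (eqP B'0) eqxx.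
by move=> /(_ isT).
Qed.

Lemma branch_mem c : c \in branch_values -> has (leq 2) (fibm A B c).
Proof.
rewrite mem_undup => /mapP[x]; rewrite mem_rts ?wron_neq0 // => rx cE.
have B0 := wron_root_B rx.
have xf : x \in fib A B c by rewrite mem_fibE B0 cE eqxx.
apply/hasP; exists (count_mem x (fib A B c)).
  by apply: map_f; rewrite mem_undup.
by move: rx; rewrite -dvdp_XsubCl XsubC_dvd ?wron_neq0 // (mup_wron xf); lia.
Qed.

(** Riemann-Hurwitz, when all poles are simple. *)
Lemma cover_RH : (\sum_(c <- branch_values) ram (fibm A B c) + 2 = 2 * m)%N.
Proof.
rewrite sum_ram_fib ?undup_uniq //.
have /eqP -> : count (mem (flatten [seq undup (fib A B c) | c <- branch_values]))
   (rts (wron A B)) == size (rts (wron A B)).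
  rewrite -all_count; apply/allP => x; rewrite mem_rts ?wron_neq0 // => rx.
  have B0 := wron_root_B rx.
  apply/flattenP; exists (undup (fib A B (A.[x] / B.[x]))); last first.
    by rewrite mem_undup mem_fibE B0 eqxx.
  apply/map_f; rewrite mem_undup; apply/mapP; exists x => //.
  by rewrite mem_rts ?wron_neq0.
have := size_rts wron_neq0; rewrite size_wron.
have [_ _ _ m0 _] := cAB.
by move: (size (rts _)) m m0; clear=> *; lia.
Qed.

Lemma fibm_gt0 c : all (leq 1) (fibm A B c).
Proof. exact: mults_gt0. Qed.

Lemma sum_fibm c : (\sum_(i <- fibm A B c) i = m)%N.
Proof. by rewrite sum_mults size_fib. Qed.

End Cover.
End Roots.

(** * Evaluation of polynomials, transcendence and determinants *)

Section Evaluation.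
Variables (C T : fieldType) (iota : {rmorphism C -> T}).

(** [ev iota u p] is p(u), the coefficients being sent to T by iota. *)
Definition ev (u : T) : {poly C} -> T := horner_eval u \o map_poly iota.
HB.instance Definition _ u := GRing.RMorphism.on (ev u).

Lemma evX u : ev u 'X = u.
Proof. by rewrite /ev /= map_polyX /horner_eval hornerX. Qed.
Lemma evC u c : ev u c%:P = iota c.
Proof. by rewrite /ev /= map_polyC /horner_eval hornerC. Qed.
Lemma evZ u c p : ev u (c *: p) = iota c * ev u p.
Proof. by rewrite -mul_polyC rmorphM /= evC. Qed.

(** [ev2 iota u w H] is H(u, w): the coefficients of H, polynomials over C, are
    evaluated at u and the outer variable at w. *)
Definition ev2 (u w : T) : {poly {poly C}} -> T := horner_eval w \o map_poly (ev u).
HB.instance Definition _ u w := GRing.RMorphism.on (ev2 u w).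

Lemma ev2E u w H : ev2 u w H = (map_poly (ev u) H).[w].
Proof. by []. Qed.

Lemma ev2X u w : ev2 u w 'X = w.
Proof. by rewrite /ev2 /= map_polyX /horner_eval hornerX. Qed.
Lemma ev2C u w p : ev2 u w p%:P = ev u p.
Proof. by rewrite /ev2 /= map_polyC /horner_eval hornerC. Qed.
Lemma ev2P u w (p : {poly C}) : ev2 u w (map_poly polyC p) = ev w p.
Proof.
elim/poly_ind: p => [|p c IH]; first by rewrite !rmorph0.
rewrite !rmorphD !rmorphM /= map_polyX map_polyC /=.
by rewrite ev2X ev2C IH evX !evC.
Qed.

Lemma ev2B u w G H : ev2 u w (G - H) = ev2 u w G - ev2 u w H.
Proof. exact: rmorphB. Qed.

Lemma ev2Z u w p H : ev2 u w (p *: H) = ev u p * ev2 u w H.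
Proof. by rewrite -mul_polyC rmorphM /= ev2C. Qed.

Lemma map_ev_polyC u (p : {poly C}) :
  map_poly (ev u) (map_poly polyC p) = map_poly iota p.
Proof. by apply/polyP => i; rewrite !coef_map /= evC. Qed.

Lemma evE u p : ev u p = (map_poly iota p).[u].
Proof. by []. Qed.

(** The element u is transcendental over the constants. *)
Definition transc (u : T) := forall p, ev u p = 0 -> p = 0.

Lemma transc_neq0 u p : transc u -> p != 0 -> ev u p != 0.
Proof. by move=> tu; apply: contraNneq => /tu ->. Qed.
End Evaluation.

Lemma map_eval_polyC (R : comNzRingType) (a : R) (g : {poly R}) :
  map_poly (horner_eval a) (map_poly polyC g) = g.
Proof. by apply/polyP => i; rewrite !coef_map /= /horner_eval hornerC. Qed.

Lemma map_evalZ (R : comNzRingType) (a : R) (c : {poly R}) (H : {poly {poly R}}) :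
  map_poly (horner_eval a) (c *: H) = c.[a] *: map_poly (horner_eval a) H.
Proof.
by apply/polyP => i; rewrite !(coef_map, coefZ) /= /horner_eval hornerM.
Qed.

Lemma map_evalB (R : comNzRingType) (a : R) (G H : {poly {poly R}}) :
  map_poly (horner_eval a) (G - H) =
  map_poly (horner_eval a) G - map_poly (horner_eval a) H.
Proof. by apply/polyP => i; rewrite !(coef_map, coefB) /= /horner_eval !hornerE. Qed.

Section Companion.
Variables (R : comNzRingType) (n' : nat).
Local Notation n := n'.+1.
Implicit Type p : {poly R}.

(** The companion matrix of p, acting on the column of the powers of a root. *)
Definition comp_mx p : 'M[R]_n := \matrix_(i, j)
  if (i == n' :> nat) then - p`_j else (i.+1 == j :> nat)%:R.

Lemma char_poly_comp p : p \is monic -> size p = n.+1 -> char_poly (comp_mx p) = p.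
Proof.
move=> mp sp; rewrite -[RHS](companionmxK mp) /comp_mx /companionmx.
by rewrite sp.
Qed.

Lemma comp_mx_eigen p z : p \is monic -> size p = n.+1 -> root p z ->
  comp_mx p *m (\col_(i < n) z ^+ i) = z *: \col_(i < n) z ^+ i.
Proof.
move=> mp sp rz; apply/matrixP => i j; rewrite !mxE.
under eq_bigr => k _ do rewrite !mxE.
have [iE|iN] := eqVneq (i : nat) n'.
  move: rz; rewrite rootE horner_coef sp big_ord_recr /= => /eqP.
  have -> : p`_n = 1 by have := monicP mp; rewrite lead_coefE sp.
  rewrite mul1r addrC => /eqP; rewrite addr_eq0 => /eqP h.
  rewrite iE -exprS h -sumrN; apply: eq_bigr => k _; by rewrite mulNr.
have iL : (i.+1 < n)%N by rewrite ltn_neqAle eqSS iN ltn_ord.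
rewrite (bigD1 (Ordinal iL)) //= eqxx mul1r -exprS big1 ?addr0 // => k.
by rewrite -val_eqE /= eq_sym => /negPf ->; rewrite mul0r.
Qed.

Lemma horner_mx_eigen (A : 'M[R]_n) (v : 'cV[R]_n) z g :
  A *m v = z *: v -> horner_mx A g *m v = g.[z] *: v.
Proof.
move=> h; elim/poly_ind: g => [|g c IH]; first by rewrite rmorph0 mul0mx horner0 scale0r.
rewrite rmorphD rmorphM /= horner_mx_X horner_mx_C mulmxDl -mulmxA h.
by rewrite -scalemxAr IH mul_scalar_mx hornerMXaddC scalerA -scalerDl mulrC.
Qed.
End Companion.

Lemma map_comp_mx (R S : comNzRingType) n' (f : {rmorphism R -> S}) (p : {poly R}) :
  map_mx f (comp_mx n' p) = comp_mx n' (map_poly f p).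
Proof.
apply/matrixP => i j; rewrite !mxE; case: ifP => _; last by rewrite rmorph_nat.
by rewrite coef_map rmorphN.
Qed.

(** The polynomial det(Y A - B) in Y. *)
Definition pencil (R : comNzRingType) n (A B : 'M[R]_n) : {poly R} :=
  \det ('X *: map_mx polyC A - map_mx polyC B).

Lemma coef_prod_lin (R : comNzRingType) (I : Type) (s : seq I) (a b : I -> R) :
  (size (\prod_(i <- s) ('X * (a i)%:P - (b i)%:P))%R <= (size s).+1)%N /\
  (\prod_(i <- s) ('X * (a i)%:P - (b i)%:P))`_(size s) = \prod_(i <- s) a i.
Proof.
elim: s => [|i s [IH1 IH2]]; first by rewrite !big_nil size_poly1 coefC.
rewrite !big_cons /=; set P := \prod_(j <- s) _ in IH1 IH2 *; split.
  rewrite mulrBl -mulrA mulrC !mul_polyC.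
  rewrite (leq_trans (size_polyD _ _)) // size_polyN geq_max; apply/andP; split.
    rewrite (leq_trans (size_polyMleq _ _)) // size_polyX addn2 /= ltnS.
    by rewrite (leq_trans (size_scale_leq _ _)).
  by rewrite (leq_trans (size_scale_leq _ _)) // (leq_trans IH1).
rewrite mulrBl -mulrA coefB coefXM /= !mul_polyC !coefZ IH2.
by rewrite [P`_(_.+1)]nth_default // mulr0 subr0.
Qed.

Lemma pencil_size (R : comNzRingType) n (A B : 'M[R]_n) :
  (size (pencil A B) <= n.+1)%N /\ (pencil A B)`_n = \det A.
Proof.
have E (s : 'S_n) : \prod_i ('X *: map_mx polyC A - map_mx polyC B) i (s i) =
    \prod_(i <- index_enum 'I_n) ('X * (A i (s i))%:P - (B i (s i))%:P).
  by apply: eq_bigr => i _; rewrite !mxE.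
have szI : size (index_enum 'I_n) = n by rewrite -[RHS]card_ord cardT enumT.
have h (s : 'S_n) := coef_prod_lin (index_enum 'I_n) (fun i => A i (s i)) (fun i => B i (s i)).
rewrite /pencil /determinant; split.
  apply: (leq_trans (size_sum _ _ _)); apply/bigmax_leqP => s _.
  rewrite E; have [+ _] := h s; rewrite szI.
  by case: (odd_perm s); rewrite ?(expr0, expr1, mulN1r, mul1r, size_polyN).
rewrite coef_sum; apply: eq_bigr => s _; rewrite E.
have [_] := h s; rewrite szI => <-.
by case: (odd_perm s); rewrite ?(expr0, expr1, mulN1r, mul1r, coefN).
Qed.

Lemma map_pencil (R S : comNzRingType) n (f : {rmorphism R -> S}) (A B : 'M[R]_n) :
  map_poly f (pencil A B) = pencil (map_mx f A) (map_mx f B).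
Proof.
rewrite /pencil -det_map_mx; congr (\det _); apply/matrixP => i j.
by rewrite !mxE rmorphB rmorphM /= map_polyX !map_polyC.
Qed.

Lemma horner_pencil (R : comNzRingType) n (A B : 'M[R]_n) y :
  (pencil A B).[y] = \det (y *: A - B).
Proof.
rewrite /pencil -horner_evalE -det_map_mx; congr (\det _); apply/matrixP => i j.
by rewrite !mxE /= /horner_eval !hornerE.
Qed.

(** The determinant of g(A) is the product of the values of g at the
    eigenvalues of A. *)
Lemma det_horner_mx (C : numClosedFieldType) n' (A : 'M[C]_n'.+1) (s : seq C) g :
  char_poly A = \prod_(a <- s) ('X - a%:P) ->
  \det (horner_mx A g) = \prod_(a <- s) g.[a].
Proof.
move=> cA; have ss : size s = n'.+1.
  by have := size_char_poly A; rewrite cA size_prod_XsubC => -[].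
have lin b : \det (horner_mx A ('X - b%:P)) = \prod_(a <- s) (a - b).
  rewrite rmorphB /= horner_mx_X horner_mx_C.
  have h : (char_poly A).[b] = \det (b%:M - A).
    rewrite -horner_evalE -det_map_mx; congr (\det _); apply/matrixP => i j.
    by rewrite !mxE /= /horner_eval !hornerE hornerMn hornerX.
  rewrite -opprB -scaleN1r detZ -h cA horner_prod -ss.
  rewrite -[_ ^+ _](_ : \prod_(a <- s) (-1) = _); last first.
    by rewrite big_const_seq count_predT -Monoid.iteropE.
  by rewrite -big_split; apply: eq_bigr => a _; rewrite /= !hornerE; ring.
rewrite {1}[g]rtsE linearZ /= detZ rmorph_prod /=.
have -> : \det (\prod_(b <- rts g) horner_mx A ('X - b%:P)) =
    \prod_(b <- rts g) \prod_(a <- s) (a - b).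
  elim: (rts g) => [|b l IH]; first by rewrite !big_nil det1.
  by rewrite !big_cons det_mulmx IH lin.
rewrite exchange_big /= -ss.
rewrite -[_ ^+ _](_ : \prod_(a <- s) (lead_coef g) = _); last first.
  by rewrite big_const_seq count_predT -Monoid.iteropE.
rewrite -big_split; apply: eq_bigr => a _ /=.
rewrite [in RHS](rtsE g) hornerZ horner_prod; congr (_ * _).
by apply: eq_bigr => b _; rewrite !hornerE.
Qed.

(** An element algebraic over C belongs to C. *)
Lemma alg_const (C : numClosedFieldType) (T : fieldType) (iota : {rmorphism C -> T})
  u p : p != 0 -> ev iota u p = 0 -> exists c, u = iota c.
Proof.
move=> p0; rewrite (rtsE p) evZ rmorph_prod /=.
move/eqP; rewrite mulf_eq0 fmorph_eq0 lead_coef_eq0 (negPf p0) /=.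
rewrite prodf_seq_eq0 => /hasP[c _] /=.
by rewrite rmorphB /= evX evC subr_eq0 => /eqP ->; exists c.
Qed.

(** * Two covers with a common pullback *)

Lemma poly_eq_fun (R : numDomainType) (p q : {poly R}) :
  (forall a, p.[a] = q.[a]) -> p = q.
Proof.
move=> h; apply/eqP; rewrite -subr_eq0; apply/eqP.
pose s : seq R := [seq i%:R | i <- iota 0 (size (p - q))].
apply: (@roots_geq_poly_eq0 _ _ s).
- by apply/allP => a _; rewrite rootE !hornerE h subrr.
- by rewrite map_inj_uniq ?iota_uniq // => i j /eqP; rewrite eqr_nat => /eqP.
- by rewrite size_map size_iota.
Qed.

Lemma size_scaleP (R : idomainType) (a : R) (P : {poly R}) k :
  (size P <= k)%N -> (size (a *: P)%R <= k)%N.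
Proof. exact: leq_trans (size_scale_leq _ _). Qed.

Lemma size_subP (R : idomainType) (P Q : {poly R}) k :
  (size P <= k)%N -> (size Q <= k)%N -> (size (P - Q)%R <= k)%N.
Proof.
by move=> ? ?; rewrite (leq_trans (size_polyD _ _)) // size_polyN geq_max; apply/andP.
Qed.

Section Pullback.
Variables (C : numClosedFieldType) (T : fieldType) (iota : {rmorphism C -> T}).
Local Notation ev := (ev iota).

(** A numerator of A/B - c composed with U/V. *)
Definition pnum (A B U V : {poly C}) c := \prod_(p <- fib A B c) (U - p *: V).
(** A denominator of A/B - c composed with U/V; the factor V accounts for the
    degree of B being one less than that of A. *)
Definition pden (B U V : {poly C}) :=
  V * (lead_coef B *: \prod_(b <- rts B) (U - b *: V)).

Lemma ev_prod_pull z x (U V : {poly C}) s : ev z U = x * ev z V ->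
  ev z (\prod_(p <- s) (U - p *: V)) =
    ev z V ^+ size s * ev x (\prod_(p <- s) ('X - p%:P)).
Proof.
move=> h; elim: s => [|p s IH]; first by rewrite !big_nil !rmorph1 mulr1.
rewrite !big_cons !rmorphM /= IH rmorphB /= evZ h rmorphB /= evX evC exprS.
by ring.
Qed.

Lemma ev_pnum z x tau (A B U V : {poly C}) m c : cover A B m ->
  ev z U = x * ev z V -> ev x A = tau * ev x B ->
  ev z (pnum A B U V c) = ev z V ^+ m * ((tau - iota c) * ev x B).
Proof.
move=> cAB hx ht; rewrite /pnum (ev_prod_pull _ hx) (size_fib cAB) -(fibE cAB).
by rewrite rmorphB /= evZ ht mulrBl.
Qed.

Lemma ev_pden z x (A B U V : {poly C}) m : cover A B m ->
  ev z U = x * ev z V -> ev z (pden B U V) = ev z V ^+ m * ev x B.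
Proof.
move=> cAB hx; rewrite /pden rmorphM /= evZ (ev_prod_pull _ hx).
have [_ _ sB m0 _] := cAB; have := size_rts (cover_B0 cAB); rewrite sB => sB'.
rewrite [in RHS](rtsE B) evZ sB' exprS; ring.
Qed.

Lemma pden_neq0 (A B U V : {poly C}) m a p : cover A B m ->
  V.[a] != 0 -> U.[a] = p * V.[a] -> B.[p] != 0 -> (pden B U V).[a] != 0.
Proof.
move=> cAB V0 hU B0; rewrite /pden hornerM hornerZ mulf_neq0 //.
rewrite mulf_neq0 ?lead_coef_eq0 ?(cover_B0 cAB) //.
rewrite horner_prod prodf_seq_neq0; apply/allP => b br /=.
rewrite !hornerE hU -mulrBl mulf_neq0 // subr_eq0; apply: contraNneq B0 => ->.
by move: br; rewrite mem_rts ?(cover_B0 cAB).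
Qed.

End Pullback.

(** The covers A1/B1 and A2/B2 of the tau-line by the x-line and the y-line,
    dominated by the z-line, where y has degree n over C(x). *)
Section Pair.
Variables (C : numClosedFieldType) (T : fieldType) (iota : {rmorphism C -> T}).
Local Notation ev := (ev iota).
Local Notation ev2 := (ev2 iota).
Variables (z x y tau : T) (m n : nat) (A1 B1 A2 B2 Ux Vx Uy Vy : {poly C}).
Hypotheses (tz : transc iota z).
Hypotheses (c1 : cover A1 B1 m) (c2 : cover A2 B2 n).
Hypotheses (cx : cover Ux Vx n) (cy : cover Uy Vy m).
Hypotheses (hx : ev z Ux = x * ev z Vx) (hy : ev z Uy = y * ev z Vy).
Hypotheses (h1 : ev x A1 = tau * ev x B1) (h2 : ev y A2 = tau * ev y B2).
Hypothesis hD : forall H : {poly {poly C}},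
  (size H <= n)%N -> ev2 x y H = 0 -> H = 0.

Lemma pull_eq c : pnum A1 B1 Ux Vx c * pden B2 Uy Vy =
  pnum A2 B2 Uy Vy c * pden B1 Ux Vx.
Proof.
apply/eqP; rewrite -subr_eq0; apply/eqP/tz; rewrite rmorphB /=.
rewrite ![ev z (pnum _ _ _ _ _ * _)]rmorphM /=.
rewrite (ev_pnum _ c1 hx h1) (ev_pnum _ c2 hy h2) (ev_pden c1 hx) (ev_pden c2 hy).
by ring.
Qed.

(** The x-coordinate of a finite point of the z-line. *)
Definition xval a := Ux.[a] / Vx.[a].
(** The y-coordinate of a finite point of the z-line. *)
Definition yval a := Uy.[a] / Vy.[a].

Lemma pnum_root1 c a : root (pnum A1 B1 Ux Vx c) a ->
  [/\ Vx.[a] != 0, xval a \in fib A1 B1 c & (pden B1 Ux Vx).[a] != 0].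
Proof.
rewrite /root horner_prod prodf_seq_eq0 => /hasP[p pf] /= hp0.
have hp : Ux.[a] == p * Vx.[a] by move: hp0; rewrite !hornerE subr_eq0.
have pa : a \in fib Ux Vx p by rewrite (mem_fib cx).
have V0 := fib_B_neq0 cx pa; split=> //.
  by rewrite /xval (eqP hp) mulfK.
by apply: (pden_neq0 c1 V0 (eqP hp)); apply: (fib_B_neq0 c1 pf).
Qed.

Lemma pnum_root2 c a : root (pnum A2 B2 Uy Vy c) a ->
  [/\ Vy.[a] != 0, yval a \in fib A2 B2 c & (pden B2 Uy Vy).[a] != 0].
Proof.
rewrite /root horner_prod prodf_seq_eq0 => /hasP[p pf] /= hp0.
have hp : Uy.[a] == p * Vy.[a] by move: hp0; rewrite !hornerE subr_eq0.
have pa : a \in fib Uy Vy p by rewrite (mem_fib cy).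
have V0 := fib_B_neq0 cy pa; split=> //.
  by rewrite /yval (eqP hp) mulfK.
by apply: (pden_neq0 c2 V0 (eqP hp)); apply: (fib_B_neq0 c2 pf).
Qed.

Lemma root_pnum1 c a p : a \in fib Ux Vx p -> p \in fib A1 B1 c ->
  root (pnum A1 B1 Ux Vx c) a.
Proof.
rewrite (mem_fib cx) => ha pf; rewrite /root horner_prod prodf_seq_eq0.
by apply/hasP; exists p; rewrite //= !hornerE (eqP ha) subrr.
Qed.

Lemma root_pnum2 c a p : a \in fib Uy Vy p -> p \in fib A2 B2 c ->
  root (pnum A2 B2 Uy Vy c) a.
Proof.
rewrite (mem_fib cy) => ha pf; rewrite /root horner_prod prodf_seq_eq0.
by apply/hasP; exists p; rewrite //= !hornerE (eqP ha) subrr.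
Qed.

Lemma cy_V_neq0 a p c : a \in fib Ux Vx p -> p \in fib A1 B1 c -> Vy.[a] != 0.
Proof.
move=> ap pf; have r1 := root_pnum1 ap pf.
have [_ _ d1] := pnum_root1 r1.
apply/negP => /eqP Vy0.
have : (pnum A2 B2 Uy Vy c * pden B1 Ux Vx).[a] = 0.
  by rewrite -pull_eq hornerM (eqP r1) mul0r.
rewrite hornerM => /eqP; rewrite mulf_eq0 (negPf d1) orbF => r2.
by have [] := pnum_root2 r2; rewrite Vy0 eqxx.
Qed.

Lemma pnum_roots c a : root (pnum A1 B1 Ux Vx c) a = root (pnum A2 B2 Uy Vy c) a.
Proof.
apply/idP/idP => r.
  have [_ _ /negP d1] := pnum_root1 r.
  have : root (pnum A2 B2 Uy Vy c * pden B1 Ux Vx) a.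
    by rewrite -pull_eq (rootM (pnum _ _ _ _ _)) r.
  by rewrite (rootM (pnum _ _ _ _ _)) => /orP[].
have [_ _ /negP d2] := pnum_root2 r.
have : root (pnum A1 B1 Ux Vx c * pden B2 Uy Vy) a.
  by rewrite pull_eq (rootM (pnum _ _ _ _ _)) r.
by rewrite (rootM (pnum _ _ _ _ _)) => /orP[].
Qed.

(** Ramification indices multiply in towers. *)
Lemma mup_pnum A B U V k l c a p : cover A B k -> cover U V l ->
  a \in fib U V p ->
  mup a (pnum A B U V c : {poly C}) =
    (count_mem p (fib A B c) * count_mem a (fib U V p))%N.
Proof.
move=> cA cU ap; rewrite /pnum; elim: (fib A B c) => [|q s IH].
  by rewrite big_nil mupNroot ?root1.
rewrite big_cons mupM ?(cover_neq0 cU) //; last first.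
  by rewrite prodf_seq_neq0; apply/allP => r _; apply: cover_neq0 cU _.
rewrite IH /= mulnDl; congr (_ + _)%N.
have [->|qp] := eqVneq q p; first by rewrite mul1n count_rts ?(cover_neq0 cU).
rewrite mul0n mupNroot // -mem_rts ?(cover_neq0 cU) //.
apply: contra qp; rewrite -[rts _]/(fib U V q) (mem_fibE cU) => /andP[_ /eqP <-].
by move: ap; rewrite (mem_fibE cU) => /andP[_ /eqP ->].
Qed.

Lemma mult_relation c a p q : p \in fib A1 B1 c -> q \in fib A2 B2 c ->
  a \in fib Ux Vx p -> a \in fib Uy Vy q ->
  (count_mem p (fib A1 B1 c) * count_mem a (fib Ux Vx p) =
   count_mem q (fib A2 B2 c) * count_mem a (fib Uy Vy q))%N.
Proof.
move=> pf qf ap aq; rewrite -(mup_pnum c c1 cx ap) -(mup_pnum c c2 cy aq).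
have [_ _ d1] := pnum_root1 (root_pnum1 ap pf).
have [_ _ d2] := pnum_root2 (root_pnum2 aq qf).
by rewrite -(mupMl _ d2) pull_eq (mupMl _ d1).
Qed.

(** The values of y at the points of the z-line above a point p of the x-line
    over c form the whole fibre of the y-line over c, with multiplicities.  Both
    sides are roots of the specialisation at x = p of the characteristic
    polynomial of y over C(x), which is A2 - tau B2 up to a factor. *)
Lemma yval_fibre c p : p \in fib A1 B1 c ->
  perm_eq [seq yval a | a <- fib Ux Vx p] (fib A2 B2 c).
Proof.
move=> pf.
have [_ _ _ n0 _] := c2.
case: n n0 hD c2 cx => // n' _ hD' c2' cx'.
have [mU sU sV _ _] := cx'; have [mA2 sA2 sB2 _ _] := c2'.
(* the monic polynomial of z over C[x]; y is an eigenvalue of its pencil UM - Y VM *)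
pose mu : {poly {poly C}} := map_poly polyC Ux - 'X *: map_poly polyC Vx.
have smu : size mu = n'.+2.
  rewrite /mu size_polyDl ?size_map_polyC // size_polyN sU ltnS.
  by rewrite (leq_trans (size_scale_leq _ _)) // size_map_polyC sV.
have mmu : mu \is monic.
  rewrite monicE /mu lead_coefDl; first by rewrite -monicE monic_map.
  rewrite size_polyN size_map_polyC sU ltnS.
  by rewrite (leq_trans (size_scale_leq _ _)) // size_map_polyC sV.
pose M := comp_mx n' mu.
pose VM := horner_mx M (map_poly polyC Vy).
pose UM := horner_mx M (map_poly polyC Uy).
pose E := pencil VM UM.
pose H : {poly {poly C}} := B1 *: E - (\det VM) *:
   (B1 *: map_poly polyC A2 - A1 *: map_poly polyC B2).
have [sE lE] : (size E <= n'.+2)%N /\ E`_n'.+1 = \det VM := pencil_size VM UM.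
have cA2 : A2`_n'.+1 = 1 by have := monicP mA2; rewrite lead_coefE sA2.
(* the terms of degree n cancel, so that H vanishes by hD *)
have sH : (size H <= n'.+1)%N.
  have sH' : (size H <= n'.+2)%N.
    by apply: size_subP; apply: size_scaleP => //; apply: size_subP; apply: size_scaleP; rewrite size_map_polyC ?sA2 ?sB2.
  apply/leq_sizeP => j; rewrite leq_eqVlt => /predU1P[<-|jn]; last first.
    by rewrite nth_default // (leq_trans sH').
  rewrite /H coefB !coefZ lE coefB !coefZ !coef_map /= cA2.
  by rewrite [B2`__]nth_default ?sB2 // polyC0 mulr0 subr0 mulr1 mulrC subrr.
have rmu : root (map_poly (ev x) mu) z.
  have h0 : ev2 x z mu = 0 by rewrite /mu ev2B ev2P ev2Z evX ev2P hx subrr.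
  by rewrite rootE -h0; exact: eqxx.
have eig (g : {poly C}) : map_mx (ev x) (horner_mx M (map_poly polyC g)) *m
    (\col_(i < n'.+1) z ^+ i) = ev z g *: \col_(i < n'.+1) z ^+ i.
  rewrite map_horner_mx map_comp_mx map_ev_polyC.
  apply: horner_mx_eigen; apply: comp_mx_eigen => //; first by rewrite monic_map.
  by rewrite size_map_poly_id0 // (monicP mmu) rmorph1 oner_eq0.
have E0 : ev2 x y E = 0.
  rewrite ev2E map_pencil horner_pencil.
  set W := y *: _ - _.
  have W0 : W *m (\col_(i < n'.+1) z ^+ i) = 0.
    by rewrite mulmxBl -scalemxAl !eig hy scalerA subrr.
  have : \det W *: (\col_(i < n'.+1) z ^+ i) = 0.
    by rewrite -mul_scalar_mx -mul_adj_mx -mulmxA W0 mulmx0.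
  by move/colP/(_ 0); rewrite !mxE expr0 mulr1.
have H0 : H = 0.
  apply: hD' => //; rewrite /H ev2B !ev2Z ev2B !ev2Z !ev2P E0 h1 h2.
  by ring.
pose Mp := comp_mx n' (Ux - p *: Vx).
have cMp : char_poly Mp = \prod_(a <- fib Ux Vx p) ('X - a%:P).
  by rewrite char_poly_comp ?(cover_monic cx') ?(cover_size cx') // -(fibE cx').
have mapM : map_mx (horner_eval p) M = Mp.
  by rewrite map_comp_mx map_evalB map_evalZ hornerX !map_eval_polyC.
have mapG (g : {poly C}) : map_mx (horner_eval p) (horner_mx M (map_poly polyC g)) =
   horner_mx Mp g.
  by rewrite map_horner_mx mapM map_eval_polyC.
have B1p := fib_B_neq0 c1 pf.
have Vy0 a : a \in fib Ux Vx p -> Vy.[a] != 0 by move=> ap; apply: cy_V_neq0 pf.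
have key y0 : \prod_(a <- fib Ux Vx p) (y0 * Vy.[a] - Uy.[a]) =
   (\prod_(a <- fib Ux Vx p) Vy.[a]) * (A2 - c *: B2).[y0].
  have := congr1 (fun P => (map_poly (horner_eval p) P).[y0]) H0.
  rewrite /H map_evalB !map_evalZ map_evalB !map_evalZ !map_eval_polyC map_pencil.
  rewrite /VM /UM !mapG map_poly0 horner0 !hornerE horner_pencil.
  have -> : (\det (horner_mx M Vy^:P)).[p] = \det (horner_mx Mp Vy).
    by rewrite -mapG -horner_evalE -det_map_mx.
  rewrite -linearZ -rmorphB /= !(det_horner_mx _ cMp).
  have -> : A1.[p] = c * B1.[p] by apply/eqP; rewrite -(mem_fib c1).
  under eq_bigr => a _ do rewrite !hornerE.
  move=> h; apply: (mulfI B1p); apply/eqP; rewrite -subr_eq0 -h; apply/eqP.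
  by ring.
apply: prod_XsubC_eq; rewrite -(fibE c2) big_map.
apply: poly_eq_fun => y0; have VV : \prod_(a <- fib Ux Vx p) Vy.[a] != 0.
    by rewrite prodf_seq_neq0; apply/allP => a /Vy0.
  apply: (mulfI VV); rewrite -key horner_prod -big_split /= !big_seq.
  apply: eq_bigr => a /Vy0 V0; rewrite /yval !hornerE mulrBr [_ * y0]mulrC.
  by rewrite mulrCA divff ?mulr1.
Qed.

(** Above a pair (p, q) there are at most gcd(e_p, f_q) points. *)
Lemma card_points_le c p q : p \in fib A1 B1 c -> q \in fib A2 B2 c ->
  (count (fun a => xval a == p) (undup (fib Uy Vy q)) <=
   gcdn (count_mem p (fib A1 B1 c)) (count_mem q (fib A2 B2 c)))%N.
Proof.
move=> pf qf; set e := count_mem p _; set f := count_mem q _.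
have f0 : (0 < f)%N by rewrite -has_count has_pred1.
have g0 : (0 < gcdn e f)%N by rewrite gcdn_gt0 f0 orbT.
pose S := [seq a <- undup (fib Uy Vy q) | xval a == p].
have memS a : a \in S -> a \in fib Uy Vy q /\ a \in fib Ux Vx p.
  rewrite mem_filter mem_undup => /andP[/eqP xa aq]; split=> //.
  have r2 := root_pnum2 aq qf; rewrite -pnum_roots in r2.
  by have [V0 _ _] := pnum_root1 r2; rewrite (mem_fibE cx) V0 -xa eqxx.
rewrite -size_filter -/S.
have lb a : a \in S -> (f %/ gcdn e f <= count_mem a (fib Ux Vx p))%N.
  move=> /memS[aq ap]; have rel := mult_relation pf qf ap aq.
  apply: dvdn_leq; first by rewrite -has_count has_pred1.
  rewrite -(Gauss_dvdr _ (_ : coprime _ (e %/ gcdn e f))).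
    rewrite -(dvdn_pmul2r g0) divnK ?dvdn_gcdr // mulnAC divnK ?dvdn_gcdl //.
    by rewrite rel dvdn_mulr.
  rewrite coprime_sym /coprime -(eqn_pmul2r g0) muln_gcdl.
  by rewrite !divnK ?dvdn_gcdl ?dvdn_gcdr // mul1n.
have ub : (\sum_(a <- S) count_mem a (fib Ux Vx p) <= f)%N.
  rewrite sum_count_mem ?filter_uniq ?undup_uniq // /f.
  rewrite -(seq.permP (yval_fibre pf) (pred1 q)) count_map.
  apply: sub_count => a /= /memS[aq _].
  by move: aq; rewrite (mem_fibE cy) => /andP[_].
have : (size S * (f %/ gcdn e f) <= f)%N.
  apply: leq_trans ub; rewrite -sum1_size big_distrl /= !big_seq.
  by apply: leq_sum => a aS; rewrite mul1n lb.
have k0 : (0 < f %/ gcdn e f)%N by rewrite divn_gt0 // dvdn_leq ?dvdn_gcdr.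
by move=> h; rewrite -(leq_pmul2r k0) [leqRHS]mulnC divnK ?dvdn_gcdr.
Qed.

(** The ramification of the z-line over a point q of the y-line. *)
Lemma relram_le c q : q \in fib A2 B2 c ->
  (relram (fibm A1 B1 c) (count_mem q (fib A2 B2 c)) <= ram (fibm Uy Vy q))%N.
Proof.
move=> qf; rewrite ram_mults (size_fib cy).
have : (size (undup (fib Uy Vy q)) <= \sum_(p <- undup (fib A1 B1 c))
    gcdn (count_mem p (fib A1 B1 c)) (count_mem q (fib A2 B2 c)))%N.
  have -> : size (undup (fib Uy Vy q)) = (\sum_(p <- undup (fib A1 B1 c))
     count (fun a => xval a == p) (undup (fib Uy Vy q)))%N.
    have := sum_count_mem (map xval (undup (fib Uy Vy q))) (undup_uniq (fib A1 B1 c)).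
    have /eqP -> : count (mem (undup (fib A1 B1 c))) (map xval (undup (fib Uy Vy q)))
       == size (map xval (undup (fib Uy Vy q))).
      rewrite -all_count; apply/allP => _ /mapP[a + ->]; rewrite mem_undup => aq.
      have := root_pnum2 aq qf; rewrite -pnum_roots => /pnum_root1[_ + _].
      by rewrite /= mem_undup.
    by rewrite size_map => <-; apply: eq_bigr => p _; rewrite count_map.
  rewrite !big_seq; apply: leq_sum => p; rewrite mem_undup => pf.
  exact: card_points_le.
have := sum_fibm c1 c; rewrite /relram /fibm /mults !big_map => <-.
set s := undup (fib A1 B1 c) => h.
have hs : (\sum_(p <- s) (count_mem p (fib A1 B1 c) - gcdn (count_mem p (fib A1 B1 c))
    (count_mem q (fib A2 B2 c))) + \sum_(p <- s) gcdn (count_mem p (fib A1 B1 c))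
    (count_mem q (fib A2 B2 c)) = \sum_(p <- s) count_mem p (fib A1 B1 c))%N.
  rewrite -big_split !big_seq; apply: eq_bigr => p; rewrite mem_undup => pf /=.
  by rewrite subnK // dvdn_leq ?dvdn_gcdl // -has_count has_pred1.
by rewrite -hs -addnBA // leq_addr.
Qed.

(** Riemann-Hurwitz for the cover of the y-line by the z-line. *)
Lemma fibcost_le cs : uniq cs ->
  (\sum_(c <- cs) fibcost (fibm A1 B1 c) (fibm A2 B2 c) + 2 <= 2 * m)%N.
Proof.
move=> ucs; pose Q := flatten [seq undup (fib A2 B2 c) | c <- cs].
have uQ : uniq Q by exact: uniq_flatten_fib c2 _ ucs.
apply: leq_trans (cover_RH_le cy uQ); rewrite leq_add2r big_flatten big_map /=.
apply: leq_sum => c _; rewrite /fibcost big_map !big_seq; apply: leq_sum => q.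
by rewrite mem_undup; apply: relram_le.
Qed.
End Pair.

(** * Perfect powers and the Kummer case *)

Lemma coprimep_closed (C : closedFieldType) (p q : {poly C}) :
  p != 0 -> (forall a, root p a -> ~~ root q a) -> coprimep p q.
Proof.
move=> p0 h; rewrite coprimep_def; apply/negPn/negP => /closed_rootP[a].
by rewrite root_gcd => /andP[/h /negPf ->].
Qed.

Section Powers.
Variable C : numClosedFieldType.
Implicit Types p q : {poly C}.

Lemma prod_count (s : seq C) (F : C -> {poly C}) :
  \prod_(z <- s) F z = \prod_(z <- undup s) F z ^+ count_mem z s.
Proof. by rewrite -big_undup_iterop_count; apply: eq_bigr => z _; rewrite /GRing.exp Monoid.iteropE. Qed.

(** A monic polynomial is an l-th power up to the roots whose multiplicity is
    not divisible by l. *)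
Lemma monic_divn l p : p \is monic ->
  exists q s, [/\ q \is monic, uniq s, size s = ndvd l (mults (rts p)),
    all (fun z => ~~ (l %| count_mem z (rts p))%N) s &
    p = q ^+ l * \prod_(z <- s) ('X - z%:P) ^+ (count_mem z (rts p) %% l)].
Proof.
move=> mp; set S := rts p.
pose q := \prod_(z <- undup S) ('X - z%:P) ^+ (count_mem z S %/ l).
exists q, [seq z <- undup S | ~~ (l %| count_mem z S)%N]; split.
- by apply: monic_prod => z _; apply/monic_exp/monicXsubC.
- by rewrite filter_uniq ?undup_uniq.
- by rewrite size_filter /ndvd /mults count_map; apply: eq_count.
- exact: filter_all.
rewrite {1}(rts_monic mp) prod_count -/S big_filter -[RHS]mulrC.
rewrite -prodrXl [in RHS]big_mkcond -big_split /=; apply: eq_bigr => z _.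
rewrite {1}(divn_eq (count_mem z S) l) addnC exprD exprM; case: ifP => // /negbFE.
by move/eqP => ->; rewrite expr0 mul1r.
Qed.

Lemma monic_power l p : p \is monic -> all (dvdn l) (mults (rts p)) ->
  exists2 q, q \is monic & p = q ^+ l.
Proof.
move=> mp; rewrite -ndvd0 => /eqP nd; have [q [s [mq _ ss _ ->]]] := monic_divn l mp.
exists q => //; move: ss; rewrite nd => /size0nil ->.
by rewrite big_nil mulr1.
Qed.

Lemma root_exists (c : C) l : (0 < l)%N -> exists a, a ^+ l = c.
Proof. by move=> l0; exists (l.-root c); rewrite rootCK. Qed.

Lemma mupZ x c p : c != 0 -> mup x (c *: p) = mup x p.
Proof. by move=> c0; rewrite -mul_polyC mupMr // rootC. Qed.

Lemma power_of_mup l p : (0 < l)%N -> p != 0 -> (forall x, (l %| mup x p)%N) ->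
  exists q, p = q ^+ l.
Proof.
move=> l0 p0 hp; have c0 : lead_coef p != 0 by rewrite lead_coef_eq0.
pose p1 := (lead_coef p)^-1 *: p.
have ci0 : (lead_coef p)^-1 != 0 by rewrite invr_eq0.
have mp1 : p1 \is monic by rewrite monicE lead_coefZ mulVf.
have p10 : p1 != 0 by rewrite monic_neq0.
have [|q mq qE] := @monic_power l _ mp1.
  by apply/allP => _ /mapP[x _ ->]; rewrite count_rts // mupZ.
have [a aE] := root_exists (lead_coef p) l0.
by exists (a *: q); rewrite exprZn -qE aE /p1 scalerA mulfV // scale1r.
Qed.

(** In C[X] the coprime factors of an l-th power are l-th powers; constants are
    absorbed, as C is algebraically closed. *)
Lemma coprime_mul_power l p q r c : (0 < l)%N -> c != 0 -> r != 0 ->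
  coprimep p q -> p * q = c *: r ^+ l -> exists s, p = s ^+ l.
Proof.
move=> l0 c0 r0 cop pq; have pq0 : p * q != 0.
  by rewrite pq scaler_eq0 negb_or c0 expf_neq0.
move: (pq0); rewrite mulf_eq0 negb_or => /andP[p0 q0].
apply: power_of_mup => // x; have [rp|nrp] := boolP (root p x); last by rewrite mupNroot.
have nq : ~~ root q x by have := coprimep_root cop rp; rewrite rootE.
rewrite -(mupMl _ nq) pq mupZ //; clear -r0.
have E k : mup x (r ^+ k) = (k * mup x r)%N.
  elim: k => [|k IH]; first by rewrite expr0 mupNroot // root1.
  by rewrite exprS mupM ?expf_neq0 // IH mulSn.
by rewrite E dvdn_mulr.
Qed.
End Powers.

Lemma coprimep_comb (F : fieldType) (P Q u v : {poly F}) c :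
  c != 0 -> u * P + v * Q = c%:P -> coprimep P Q.
Proof.
move=> c0 E; apply/Bezout_coprimepP; exists (u, v) => /=.
by rewrite E polyC_eqp1.
Qed.

(** The point x of the x-line over the point tau, both generic. *)
Section Point.
Variables (C : numClosedFieldType) (T : fieldType) (iota : {rmorphism C -> T}).
Local Notation ev := (ev iota).
Variables (x tau : T) (A B : {poly C}) (m : nat).
Hypotheses (tx : transc iota x) (cAB : cover A B m) (hA : ev x A = tau * ev x B).

Lemma point_B_neq0 : ev x B != 0.
Proof. exact: transc_neq0 tx (cover_B0 cAB). Qed.

Lemma point_fibre c : ev x (A - c *: B) = (tau - iota c) * ev x B.
Proof. by rewrite rmorphB /= evZ hA mulrBl. Qed.

Lemma point_neq c : tau - iota c != 0.
Proof.
have := transc_neq0 tx (cover_neq0 cAB c); rewrite point_fibre.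
by rewrite mulf_eq0 negb_or => /andP[].
Qed.

(** A pair of fibres divisible by l makes (tau - a)/(tau - b) an l-th power. *)
Lemma point_power a b l : all (dvdn l) (fibm A B a) -> all (dvdn l) (fibm A B b) ->
  exists Y Z, [/\ Y \is monic, Z \is monic, A - a *: B = Y ^+ l, A - b *: B = Z ^+ l &
    (ev x Y / ev x Z) ^+ l = (tau - iota a) / (tau - iota b)].
Proof.
move=> da db; have [Y mY EY] := monic_power (cover_monic cAB a) da.
have [Z mZ EZ] := monic_power (cover_monic cAB b) db.
exists Y, Z; split=> //; rewrite expr_div_n -!rmorphXn -EY -EZ /= !point_fibre.
by rewrite -mulf_div mulfV ?mulr1 // point_B_neq0.
Qed.
End Point.

(** The hypothesis hdeg is what linear disjointness provides: an element w of
    C(y) over which tau has degree d satisfies no equation of degree less than d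
    over C(x). *)
Section Exclusion.
Variables (C : numClosedFieldType) (T : fieldType) (iota : {rmorphism C -> T}).
Local Notation ev := (ev iota).
Local Notation ev2 := (ev2 iota).
Variables (x y tau : T) (A1 B1 A2 B2 : {poly C}) (m n : nat).
Hypotheses (tx : transc iota x) (ty : transc iota y).
Hypotheses (c1 : cover A1 B1 m) (c2 : cover A2 B2 n).
Hypotheses (h1 : ev x A1 = tau * ev x B1) (h2 : ev y A2 = tau * ev y B2).
Hypothesis hdeg : forall d (P Q : {poly C}) w (p q : {poly C}) (H : {poly {poly C}}),
  coprimep P Q -> maxn (size P) (size Q) = d.+1 ->
  ev y q != 0 -> w = ev y p / ev y q -> ev w P = tau * ev w Q ->
  (size H <= d)%N -> ev2 x w H = 0 -> H = 0.

Lemma no_kummer l a b : (1 < l)%N -> a != b ->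
  ~ kummer l (fibm A1 B1 a) (fibm A2 B2 a) (fibm A1 B1 b) (fibm A2 B2 b).
Proof.
move=> l1 ab [d1a d2a d1b d2b]; have l0 := ltnW l1.
have [Y1 [Z1 [mY1 mZ1 _ _ E1]]] := point_power tx c1 h1 d1a d1b.
have [Y2 [Z2 [mY2 mZ2 _ _ E2]]] := point_power ty c2 h2 d2a d2b.
have nz u Z : transc iota u -> Z \is monic -> ev u Z != 0.
  by move=> tu mZ; apply: transc_neq0 tu _; exact: monic_neq0.
have tb0 : tau - iota b != 0 by exact: point_neq tx c1 h1 b.
have ta0 : tau - iota a != 0 by exact: point_neq tx c1 h1 a.
set w := ev y Y2 / ev y Z2 in E2; set w' := ev x Y1 / ev x Z1 in E1.
have w'0 : w' != 0 by rewrite mulf_neq0 ?invr_eq0 ?nz.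
have [|zeta zE] := @alg_const _ _ iota (w / w') ('X^l - 1%:P) (monic_neq0 (monicXnsubC _ l0)).
  rewrite rmorphB /= rmorphXn /= evX evC expr_div_n E1 E2 mulfV ?subrr ?rmorph1 ?subrr //.
  by rewrite mulf_neq0 ?invr_eq0.
have wE : w = iota zeta * w' by rewrite -zE divfK.
(* w is a root of a linear equation over C(x) *)
pose H : {poly {poly C}} := Z1 *: 'X - (zeta *: Y1)%:P.
have H0 : H != 0.
  apply: contraTneq isT => H0; have := congr1 (fun p : {poly {poly C}} => p`_1) H0.
  rewrite coefB coefZ coefX coefC /= mulr1 subr0 coef0 => /eqP.
  by rewrite (negPf (monic_neq0 mZ1)).
move/eqP: H0; apply.
apply: (hdeg (d := l) (P := b *: 'X^l - a%:P) (Q := 'X^l - 1%:P) (w := w) (p := Y2) (q := Z2)).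
- apply: (@coprimep_comb _ _ _ 1 (- b%:P) (b - a)); first by rewrite subr_eq0 eq_sym.
  by rewrite -mul_polyC polyCB; ring.
- rewrite size_XnsubC //; apply/maxn_idPr.
  by apply: size_subP; rewrite ?(leq_trans (size_scale_leq _ _)) ?size_polyXn ?(leq_trans (size_polyC_leq1 _)).
- exact: nz.
- by [].
- rewrite !rmorphB /= evZ !rmorphXn /= evX !evC rmorph1 E2.
  by field.
- rewrite (leq_trans _ l1) //; apply: size_subP.
    by rewrite (leq_trans (size_scale_leq _ _)) ?size_polyX.
  by rewrite (leq_trans (size_polyC_leq1 _)).
- rewrite ev2B ev2Z ev2X ev2C evZ wE /w'.
  by field; exact: nz.
Qed.
End Exclusion.

(** * The octahedral case *)

Section OctaPoly.
Variable C : numClosedFieldType.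

Lemma monic_odd (p : {poly C}) : p \is monic -> exists q s,
  [/\ q \is monic, uniq s, size s = ndvd 2 (mults (rts p)) &
    p = q ^+ 2 * \prod_(z <- s) ('X - z%:P)].
Proof.
move=> mp; have [q [s [mq us ss os E]]] := monic_divn 2 mp.
exists q, s; split=> //; rewrite {1}E; congr (_ * _); apply: eq_big_seq => z zs.
by move/(allP os): zs => /=; rewrite dvdn2 negbK modn2 => ->; rewrite expr1.
Qed.

Lemma sum_diff_cubes (P Q R : {poly C}) c : c != 0 -> R != 0 -> coprimep Q P ->
  (Q + P) * (Q - P) = c *: R ^+ 3 -> exists S1 S2, Q + P = S1 ^+ 3 /\ Q - P = S2 ^+ 3.
Proof.
(* the sum and the difference of the two factors generate 2 *)
move=> c0 R0 cop E; have cop' : coprimep (Q + P) (Q - P).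
  have [[u v] /= uv] := Bezout_eq1_coprimepP _ _ cop.
  apply: (@coprimep_comb _ _ _ (u + v) (u - v) 2%:R); first by rewrite pnatr_eq0.
  transitivity (2%:R * (u * Q + v * P)); first by ring.
  by rewrite uv mulr1 polyC_natr.
have [S1 E1] := coprime_mul_power (isT : 0 < 3)%N c0 R0 cop' E.
rewrite mulrC in E; rewrite coprimep_sym in cop'.
have [S2 E2] := coprime_mul_power (isT : 0 < 3)%N c0 R0 cop' E.
by exists S1, S2.
Qed.

Lemma fib_disjoint (A B : {poly C}) m a c p : cover A B m -> a != c ->
  root (A - a *: B) p -> root (A - c *: B) p -> False.
Proof.
move=> cAB /eqP ac ra rc.
have pa : p \in fib A B a by rewrite /fib mem_rts ?(cover_neq0 cAB).
have pc : p \in fib A B c by rewrite /fib mem_rts ?(cover_neq0 cAB).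
have B0 := fib_B_neq0 cAB pa; apply: ac.
move: pa pc; rewrite !(mem_fib cAB) => /eqP -> /eqP; exact: mulIf.
Qed.

(** tau = octa_num/octa_den at w when k (tau - a)/(tau - c) is the square of
    (w^3 - 1)/(w^3 + 1). *)
Definition octa_num (a c k : C) : {poly C} :=
  (a * k) *: ('X^3 + 1) ^+ 2 - c *: ('X^3 - 1) ^+ 2.
(** The denominator going with [octa_num]. *)
Definition octa_den (k : C) : {poly C} := k *: ('X^3 + 1) ^+ 2 - ('X^3 - 1) ^+ 2.

Lemma octa_coprime a c k : a != c -> k != 0 -> coprimep (octa_num a c k) (octa_den k).
Proof.
(* (f - g)^3 = 8 is f^2 (f - 3 g) + g^2 (3 f - g), and f^2, g^2 are combinations of P and Q *)
move=> ac k0; pose f : {poly C} := 'X^3 + 1; pose g : {poly C} := 'X^3 - 1.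
apply: (@coprimep_comb _ _ _ ((f - 3%:R * g) + k%:P * (3%:R * f - g))
  (- (c%:P * (f - 3%:R * g) + (a * k)%:P * (3%:R * f - g))) (8%:R * (k * (a - c)))).
  by rewrite !mulf_neq0 ?pnatr_eq0 // subr_eq0.
rewrite /octa_num /octa_den -!mul_polyC !polyCM polyC_natr polyCB /f /g.
by ring.
Qed.

Lemma octa_size a c k : a != c ->
  maxn (size (octa_num a c k)) (size (octa_den k)) = 7%N.
Proof.
move=> ac.
have nE : octa_num a c k = (a * k - c) *: 'X^6 + (2%:R * (a * k + c) *: 'X^3 + (a * k - c)%:P).
  by rewrite /octa_num -!mul_polyC !(polyCB, polyCD, polyCM) ?polyC1; ring.
have dE : octa_den k = (k - 1) *: 'X^6 + (2%:R * (k + 1) *: 'X^3 + (k - 1)%:P).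
  by rewrite /octa_den -!mul_polyC !(polyCB, polyCD, polyCM) ?polyC1; ring.
have sz (p q r : C) : (size (p *: 'X^6 + (q *: 'X^3 + r%:P))%R <= 7)%N.
  rewrite !(leq_trans (size_polyD _ _)) // !geq_max.
  rewrite !(leq_trans (size_scale_leq _ _)) ?size_polyXn //=.
  rewrite (leq_trans (size_polyD _ _)) // geq_max (leq_trans (size_scale_leq _ _)) ?size_polyXn //=.
  by rewrite (leq_trans (size_polyC_leq1 _)).
have c6 (p q r : C) : (p *: 'X^6 + (q *: 'X^3 + r%:P))`_6 = p.
  by rewrite !coefD !coefZ !coefXn coefC /= mulr1 mulr0 !addr0.
apply/eqP; rewrite eqn_leq geq_max {1}nE {1}dE !sz /= leqNgt ltnS geq_max.
apply/negP => /andP[/leq_sizeP/(_ 6%N isT) n6 /leq_sizeP/(_ 6%N isT) d6].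
move: n6 d6; rewrite nE dE !c6 => /eqP; rewrite subr_eq0 => /eqP ak /eqP.
by rewrite subr_eq0 => /eqP k1; move: ac; rewrite -ak k1 mulr1 eqxx.
Qed.
End OctaPoly.

(** The conic u^2 = (x - al)/(x - be), a double cover of the x-line. *)
Section TwoPoints.
Variables (C : numClosedFieldType) (T : fieldType) (iota : {rmorphism C -> T}).
Local Notation ev := (ev iota).
Local Notation ev2 := (ev2 iota).
Variables (x u : T) (al be : C).
Hypotheses (tx : transc iota x) (ab : al != be).
Hypothesis hu : u ^+ 2 * (x - iota be) = x - iota al.

Lemma linear_neq0 c : x - iota c != 0.
Proof.
have := transc_neq0 tx (monic_neq0 (monicXsubC c)).
by rewrite rmorphB /= evX evC.
Qed.

Lemma transc_sqrt : transc iota u.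
Proof.
move=> p pu; apply/eqP; apply: contraT => p0.
have [e uE] := alg_const p0 pu.
have := tx (p := (e ^+ 2) *: ('X - be%:P) - ('X - al%:P)).
rewrite rmorphB /= evZ !rmorphB /= evX !evC rmorphXn -uE hu subrr => /(_ erefl) H.
have := congr1 (fun p : {poly C} => p.[be]) H.
rewrite !(hornerD, hornerN, hornerZ, hornerX, hornerC) subrr mulr0 add0r => /eqP.
by rewrite oppr_eq0 subr_eq0 eq_sym (negPf ab).
Qed.

(** C(u) is C(x) + u C(x), and u -> -u is its conjugation. *)
Lemma sqrt_split (S : {poly C}) : exists E O D : {poly C},
  [/\ D != 0, ev u S * ev x D = ev x E + u * ev x O &
      ev (- u) S * ev x D = ev x E - u * ev x O].
Proof.
elim/poly_ind: S => [|S c [E [O [D [D0 h1 h2]]]]].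
  by exists 0, 0, 1; rewrite oner_neq0 !rmorph0 !mul0r mulr0 addr0 subr0.
exists (('X - al%:P) * O + c *: (D * ('X - be%:P))), (('X - be%:P) * E), (D * ('X - be%:P)).
have mE v (p q : {poly C}) : ev v (p * q) = ev v p * ev v q by exact: rmorphM.
have dE v (p q : {poly C}) : ev v (p + q) = ev v p + ev v q by exact: rmorphD.
have bE v (p q : {poly C}) : ev v (p - q) = ev v p - ev v q by exact: rmorphB.
split; first by rewrite mulf_neq0 ?polyXsubC_eq0.
  rewrite !(mE, bE, dE, evX, evC, evZ) -hu.
  transitivity ((ev u S * ev x D) * u * (x - iota be) + iota c * (ev x D * (x - iota be))).
    by ring.
  by rewrite h1; ring.
rewrite !(mE, bE, dE, evX, evC, evZ) -hu.
transitivity (- (ev (- u) S * ev x D) * u * (x - iota be) + iota c * (ev x D * (x - iota be))).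
  by ring.
by rewrite h2; ring.
Qed.
End TwoPoints.

Lemma transc_sqrtN (C : numClosedFieldType) (T : fieldType) (iota : {rmorphism C -> T})
  (x u : T) (al be : C) : transc iota x -> al != be ->
  u ^+ 2 * (x - iota be) = x - iota al -> transc iota (- u).
Proof. by move=> tx ab hu; apply: (transc_sqrt tx ab); rewrite sqrrN. Qed.

Section Quadratic.
Variables (C : numClosedFieldType) (T : fieldType) (iota : {rmorphism C -> T}).
Local Notation ev := (ev iota).
Local Notation ev2 := (ev2 iota).
Variables (x u : T) (al be : C).
Hypotheses (tx : transc iota x) (ab : al != be).
Hypothesis hu : u ^+ 2 * (x - iota be) = x - iota al.

(** Every element of C(u) is at most quadratic over C(x). *)
Lemma sqrt_quadratic (S1 S2 : {poly C}) w : S2 != 0 -> w * ev u S2 = ev u S1 ->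
  exists H : {poly {poly C}}, [/\ H != 0, (size H <= 3)%N & ev2 x w H = 0].
Proof.
move=> S20 hw.
have [E1 [O1 [D1 [D10 p1 m1]]]] := sqrt_split hu S1.
have [E2 [O2 [D2 [D20 p2 m2]]]] := sqrt_split hu S2.
pose lin (a b : {poly C}) : {poly {poly C}} := a *: 'X - b%:P.
pose Ha := lin (D1 * E2) (D2 * E1); pose Hb := lin (D1 * O2) (D2 * O1).
have linE a b : lin a b ^+ 2 = a ^+ 2 *: 'X^2 + ((- (2%:R * a * b)) *: 'X + (b ^+ 2)%:P).
  by rewrite /lin -!mul_polyC !(polyCN, polyCM) polyC_natr; ring.
have slin a b : (size (lin a b ^+ 2) <= 3)%N.
  rewrite linE !(leq_trans (size_polyD _ _)) // !geq_max.
  rewrite !(leq_trans (size_scale_leq _ _)) ?size_polyXn //=.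
  rewrite (leq_trans (size_polyD _ _)) // geq_max (leq_trans (size_scale_leq _ _)) ?size_polyX //=.
  by rewrite (leq_trans (size_polyC_leq1 _)).
have c2 a b : (lin a b ^+ 2)`_2 = a ^+ 2.
  by rewrite linE !coefD !coefZ coefXn coefX coefC /= mulr1 mulr0 !addr0.
have evl a b : ev2 x w (lin a b) = ev x a * w - ev x b.
  by rewrite /lin ev2B ev2Z ev2X ev2C.
have mE v (p q : {poly C}) : ev v (p * q) = ev v p * ev v q by exact: rmorphM.
have bE v (p q : {poly C}) : ev v (p - q) = ev v p - ev v q by exact: rmorphB.
have mE2 v (p q : {poly C}) : ev v (p * q ^+ 2) = ev v p * ev v q ^+ 2.
  by rewrite mE rmorphXn.
have xE c : ev x ('X - c%:P) = x - iota c by rewrite bE evX evC.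
exists (('X - be%:P) *: Ha ^+ 2 - ('X - al%:P) *: Hb ^+ 2); split.
- apply: contraTneq isT => H0; have := congr1 (fun p : {poly {poly C}} => p`_2) H0.
  rewrite coefB !coefZ !c2 coef0 => /(congr1 (ev x)).
  rewrite rmorph0 bE !mE2 !mE !xE -hu => /eqP.
  have -> : (x - iota be) * (ev x D1 * ev x E2) ^+ 2 - u ^+ 2 * (x - iota be) * (ev x D1 * ev x O2) ^+ 2 =
    (x - iota be) * ev x D1 ^+ 2 * ((ev x E2 + u * ev x O2) * (ev x E2 - u * ev x O2)) by ring.
  have tu := transc_sqrt tx ab hu; have tn := transc_sqrtN tx ab hu.
  rewrite -p2 -m2; apply: contraLR => _; rewrite !mulf_neq0 ?expf_neq0 ?(linear_neq0 tx) //;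
  exact: transc_neq0.
- by apply: size_subP; apply: size_scaleP; apply: slin.
- rewrite ev2B !ev2Z !xE !rmorphXn /= !evl !mE -hu.
  have E : ev x D1 * ev x E2 * w - ev x D2 * ev x E1 =
    - (u * (ev x D1 * ev x O2 * w - ev x D2 * ev x O1)).
    apply/eqP; rewrite -subr_eq0; apply/eqP.
    transitivity (ev x D1 * w * (ev x E2 + u * ev x O2) - ev x D2 * (ev x E1 + u * ev x O1)).
      by ring.
    by rewrite -p1 -p2 -hw; ring.
  by rewrite E; ring.
Qed.
End Quadratic.

Lemma fibre_relation_poly (C : comNzRingType) (a b c : C) (A B : {poly C}) :
  (c - b) *: (A - a *: B) + (b - a) *: (A - c *: B) = (c - a) *: (A - b *: B).
Proof. by rewrite -!mul_polyC !polyCB; ring. Qed.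

(** Here k^2 = (b - c)/(b - a), so that 1 - k^2 (tau - a)/(tau - c) is a constant
    times (tau - b)/(tau - c). *)
Section Octahedral.
Variables (C : numClosedFieldType) (T : fieldType) (iota : {rmorphism C -> T}).
Local Notation ev := (ev iota).
Variables (x tau : T) (A B : {poly C}) (m : nat) (a b c k : C).
Hypotheses (tx : transc iota x) (cAB : cover A B m) (hA : ev x A = tau * ev x B).
Hypotheses (ab : a != b) (ac : a != c) (bc : b != c).
Hypothesis kE : k ^+ 2 = (b - c) / (b - a).
Let ba0 : b - a != 0. Proof. by rewrite subr_eq0 eq_sym. Qed.
Let bc0 : b - c != 0. Proof. by rewrite subr_eq0. Qed.
Let ca0 : c - a != 0. Proof. by rewrite subr_eq0 eq_sym. Qed.

(** When the fibres over a, b and c are divisible by 2, 3 and 2, the quotient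
    (1 + k e)/(1 - k e) is a cube in C(x). *)
Lemma octa_divisible : all (dvdn 2) (fibm A B a) -> all (dvdn 3) (fibm A B b) ->
  all (dvdn 2) (fibm A B c) ->
  exists (e : T) (S1 S2 : {poly C}), [/\ S1 != 0, S2 != 0,
    e ^+ 2 = (tau - iota a) / (tau - iota c) &
    ev x S1 ^+ 3 * (1 - iota k * e) = ev x S2 ^+ 3 * (1 + iota k * e)].
Proof.
move=> da db dc.
have [Y [X2 [mY mX2 EY EX2 hE]]] := point_power tx cAB hA da dc.
have [Z mZ EZ] := monic_power (cover_monic cAB b) db.
have k0 : k != 0.
  by apply/negP => /eqP k0; move: kE; rewrite k0 expr0n /= => /esym/eqP; rewrite mulf_eq0 invr_eq0 (negPf ba0) (negPf bc0).
have cop : coprimep X2 (k *: Y).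
  rewrite coprimepZr //; apply: coprimep_closed => [|r rX]; first exact: monic_neq0.
  apply/negP => rY; apply: (fib_disjoint cAB ac (p := r)).
    by rewrite EY rootE horner_exp (eqP rY) expr0n.
  by rewrite EX2 rootE horner_exp (eqP rX) expr0n.
have R : (X2 + k *: Y) * (X2 - k *: Y) = ((c - a) / (b - a)) *: Z ^+ 3.
  have := fibre_relation_poly a b c A B; rewrite EY EX2 EZ => H.
  apply: (@scalerI _ _ (b - a)) => //; rewrite scalerA mulrCA mulfV // mulr1 -H.
  have -> : (c - b) = - (b - a) * k ^+ 2 by rewrite kE; field.
  by rewrite -!mul_polyC !polyCM !polyCN; ring.
have [|S1 [S2 [E1 E2]]] := sum_diff_cubes _ (monic_neq0 mZ) cop R.
  by rewrite mulf_neq0 ?invr_eq0.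
have X0 : ev x X2 != 0 by exact: transc_neq0 tx (monic_neq0 mX2).
have [S10 S20] : S1 != 0 /\ S2 != 0.
  have : (X2 + k *: Y) * (X2 - k *: Y) != 0.
    by rewrite R scaler_eq0 negb_or !mulf_neq0 ?invr_eq0 ?expf_neq0 ?monic_neq0.
  by rewrite E1 E2 mulf_eq0 !expf_eq0 negb_or /= => /andP[].
exists (ev x Y / ev x X2), S1, S2; split=> //.
have evD (p q : {poly C}) : ev x (p + q) = ev x p + ev x q by exact: rmorphD.
have evB (p q : {poly C}) : ev x (p - q) = ev x p - ev x q by exact: rmorphB.
rewrite -!rmorphXn /= -E1 -E2 evD evB evZ.
by field.
Qed.

(** When the fibre over a has exactly two odd multiplicities, at the points al
    and be, the same quotient is a cube in C(u), u^2 = (x - al)/(x - be). *)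
Lemma octa_defect (e : T) : e ^+ 2 = (tau - iota a) / (tau - iota c) ->
  ndvd 2 (fibm A B a) = 2%N -> all (dvdn 3) (fibm A B b) ->
  all (dvdn 2) (fibm A B c) ->
  exists (u : T) (al be : C) (S1 S2 : {poly C}), [/\ al != be,
    u ^+ 2 * (x - iota be) = x - iota al, S1 != 0, S2 != 0 &
    ev u S1 ^+ 3 * (1 - iota k * e) = ev u S2 ^+ 3 * (1 + iota k * e)].
Proof.
move=> eE da db dc.
have [X1 [s [mX1 us ss EA]]] := monic_odd (cover_monic cAB a).
rewrite -/(fib A B a) -/(fibm A B a) da in ss.
case: s us ss EA => [|al [|be []]] //= /andP[]; rewrite inE => alb _ _.
rewrite !big_cons big_nil mulr1 => EA.
have [X2 mX2 EX2] := monic_power (cover_monic cAB c) dc.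
have [W mW EW] := monic_power (cover_monic cAB b) db.
have tc0 := point_neq tx cAB hA c; have ta0 := point_neq tx cAB hA a.
have B0 := point_B_neq0 tx cAB.
have P10 : ev x X1 != 0 by exact: transc_neq0 tx (monic_neq0 mX1).
have P20 : ev x X2 != 0 by exact: transc_neq0 tx (monic_neq0 mX2).
have xb0 := linear_neq0 tx be; have xa0 := linear_neq0 tx al.
have xE z : ev x ('X - z%:P) = x - iota z by rewrite rmorphB /= evX evC.
have evM v (p q : {poly C}) : ev v (p * q) = ev v p * ev v q by exact: rmorphM.
have evD v (p q : {poly C}) : ev v (p + q) = ev v p + ev v q by exact: rmorphD.
have evB v (p q : {poly C}) : ev v (p - q) = ev v p - ev v q by exact: rmorphB.
have evXn v (p : {poly C}) i : ev v (p ^+ i) = ev v p ^+ i by exact: rmorphXn.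
have FA : ev x X1 ^+ 2 * ((x - iota al) * (x - iota be)) = (tau - iota a) * ev x B.
  by rewrite -(point_fibre hA) EA evM evXn evM !xE.
have FC : ev x X2 ^+ 2 = (tau - iota c) * ev x B by rewrite -(point_fibre hA) EX2 evXn.
have FB : ev x W ^+ 3 = (tau - iota b) * ev x B by rewrite -(point_fibre hA) EW evXn.
(* so that u^2 = (x - al)/(x - be) *)
pose u := e * ev x X2 / (ev x X1 * (x - iota be)).
have hu : u ^+ 2 * (x - iota be) = x - iota al.
  rewrite /u expr_div_n exprMn eE FC exprMn.
  have -> : (tau - iota a) / (tau - iota c) * ((tau - iota c) * ev x B) = (tau - iota a) * ev x B.
    by field.
  by rewrite -FA; field; rewrite P10 xb0.
have tu := transc_sqrt tx alb hu.
(* x = N(u)/D(u) *)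
pose N : {poly C} := al%:P - be *: 'X^2; pose D : {poly C} := 1 - 'X^2.
have evN : ev u N = x * ev u D.
  rewrite /N /D !evB evZ evXn evX evC rmorph1.
  have := hu; rewrite mulrBr => /eqP; rewrite subr_eq => /eqP H.
  transitivity (iota al - u ^+ 2 * iota be); first by ring.
  rewrite mulrBr mulr1 [x * _]mulrC H; ring.
pose pull s := \prod_(p <- s) (N - p *: D).
have D0 : ev u D != 0.
  apply: transc_neq0 tu _; rewrite -oppr_eq0 opprB.
  by apply: monic_neq0; exact: monicXnsubC 1 (isT : 0 < 2)%N.
have pullE (q : {poly C}) : q \is monic -> ev u (pull (rts q)) = ev u D ^+ size (rts q) * ev x q.
  by move=> mq; rewrite (ev_prod_pull _ evN) -(rts_monic mq).
have szr (q : {poly C}) : q \is monic -> (size q).-1 = size (rts q).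
  by move=> mq; rewrite size_rts ?monic_neq0.
have m2 : m = (2 * size (rts X2))%N.
  have := size_exp X2 2; rewrite -EX2 (cover_size cAB) /= => ->.
  by rewrite szr // mulnC.
have m3 : m = (3 * size (rts W))%N.
  have := size_exp W 3; rewrite -EW (cover_size cAB) /= => ->.
  by rewrite szr // mulnC.
have m1 : m = (2 * size (rts X1) + 2)%N.
  have s2 : size (('X - al%:P) * ('X - be%:P)) = 3%N.
    by rewrite size_mul ?polyXsubC_eq0 // !size_XsubC.
  have := cover_size cAB a.
  rewrite EA size_mul ?s2 ?expf_neq0 ?(monic_neq0 mX1) ?mulf_neq0 ?polyXsubC_eq0 //.
  have -> : size (X1 ^+ 2) = (2 * size (rts X1)).+1.
    rewrite -(prednK (_ : 0 < size (X1 ^+ 2))%N) ?size_poly_gt0 ?expf_neq0 ?monic_neq0 //.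
    by rewrite size_exp szr // mulnC.
  by clear=> /=; lia.
have k21 : size (rts X2) = (size (rts X1)).+1 by move: m1 m2; clear=> *; lia.
have kw2 : (3 * size (rts W) = 2 * size (rts X1) + 2)%N by rewrite -m3.
have dE : (x - iota be) * ev u D = iota (al - be).
  by rewrite /D evB rmorph1 evXn evX rmorphB mulrBr mulr1 [_ * u ^+ 2]mulrC hu; ring.
have k0 : k != 0.
  by apply/negP => /eqP k0; move: kE; rewrite k0 expr0n /= => /esym/eqP; rewrite mulf_eq0 invr_eq0 (negPf ba0) (negPf bc0).
(* Q and M become X2(x) and k e X2(x) after division by a power of D(u) *)
pose M := (k * (al - be)) *: ('X * pull (rts X1)); pose Q := pull (rts X2).
have evQ : ev u Q = ev u D ^+ (size (rts X1)).+1 * ev x X2 by rewrite /Q pullE // k21.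
have evMM : ev u M = iota k * e * ev u D ^+ (size (rts X1)).+1 * ev x X2.
  rewrite /M evZ evM evX pullE // rmorphM -dE /u exprS.
  by field; rewrite P10 xb0.
have pull0 s : pull s != 0.
  have p0 : ev u (pull s) != 0.
    rewrite (ev_prod_pull _ evN) mulf_neq0 ?expf_neq0 //.
    by apply: transc_neq0 tx _; exact: monic_neq0 (monic_prod_XsubC _ _ _).
  by apply: contraNneq p0 => ->; rewrite rmorph0.
have R : (Q + M) * (Q - M) = ((c - a) / (b - a)) *: pull (rts W) ^+ 3.
  apply/eqP; rewrite -subr_eq0; apply/eqP/tu.
  have dq : ev u D ^+ (size (rts W) * 3) = (ev u D ^+ (size (rts X1)).+1) ^+ 2.
    by rewrite -exprM; congr (_ ^+ _); move: kw2; clear=> *; lia.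
  rewrite evB evM evD evB evQ evMM evZ evXn pullE // exprMn -exprM dq FB.
  set q := ev u D ^+ _.
  transitivity (q ^+ 2 * (ev x X2 ^+ 2 * (1 - iota k ^+ 2 * e ^+ 2) -
     iota ((c - a) / (b - a)) * ((tau - iota b) * ev x B))); first by ring.
  rewrite FC eE -rmorphXn kE !fmorph_div !rmorphB.
  have ba' : iota b - iota a != 0 by rewrite -rmorphB fmorph_eq0.
  by field; rewrite tc0 ba'.
have cop : coprimep Q M.
  apply: coprimep_closed => [|r rQ]; first exact: pull0.
  have ex s : root (pull s) r -> exists2 p, p \in s & N.[r] = p * D.[r].
    rewrite rootE horner_prod prodf_seq_eq0 => /hasP[p ps] /=.
    by rewrite !(hornerD, hornerN, hornerZ) subr_eq0 => /eqP pE; exists p.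
  have [p pX pN] := ex _ rQ.
  have rp : root (A - c *: B) p.
    by rewrite EX2 rootE horner_exp (eqP (_ : root X2 p)) ?expr0n // -mem_rts ?monic_neq0.
  have NE : N.[r] = al - be * r ^+ 2.
    by rewrite /N !(hornerD, hornerN, hornerZ, hornerXn, hornerC).
  have DE : D.[r] = 1 - r ^+ 2.
    by rewrite /D !(hornerD, hornerN, hornerXn, hornerC).
  apply/negP; rewrite /M rootZ ?mulf_neq0 ?subr_eq0 // rootM => /orP[].
    rewrite rootX => /eqP r0; apply: (fib_disjoint cAB ac (p := p)) => //.
    move: pN; rewrite NE DE r0 expr0n /= mulr0 !subr0 mulr1 => <-.
    by rewrite EA rootM; apply/orP; right; rewrite rootM root_XsubC eqxx.
  case/ex => p' pX' pN'; apply: (fib_disjoint cAB ac (p := p')).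
    rewrite EA rootE hornerM horner_exp (eqP (_ : root X1 p')) ?expr0n ?mul0r //.
    by rewrite -mem_rts ?monic_neq0.
  have [<-//|pp] := eqVneq p p'.
  have /eqP : (p - p') * D.[r] = 0 by rewrite mulrBl -pN -pN' subrr.
  rewrite mulf_eq0 subr_eq0 (negPf pp) /= => /eqP D0'.
  move: pN; rewrite D0' mulr0 NE; move/eqP: D0'; rewrite DE subr_eq0 => /eqP <-.
  by rewrite mulr1 => /eqP; rewrite subr_eq0 (negPf alb).
have [|S1 [S2 [E1 E2]]] := sum_diff_cubes _ (pull0 (rts W)) cop R.
  by rewrite mulf_neq0 ?invr_eq0.
have [S10 S20] : S1 != 0 /\ S2 != 0.
  have : (Q + M) * (Q - M) != 0.
    by rewrite R scaler_eq0 negb_or !mulf_neq0 ?invr_eq0 ?expf_neq0.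
  by rewrite E1 E2 mulf_eq0 !expf_eq0 negb_or /= => /andP[].
exists u, al, be, S1, S2; split=> //.
by rewrite -!evXn -E1 -E2 evD evB evQ evMM; ring.
Qed.
End Octahedral.

Section OctahedralPair.
Variables (C : numClosedFieldType) (T : fieldType) (iota : {rmorphism C -> T}).
Local Notation ev := (ev iota).
Local Notation ev2 := (ev2 iota).
Variables (x y tau : T) (A1 B1 A2 B2 : {poly C}) (m n : nat).
Hypotheses (tx : transc iota x) (ty : transc iota y).
Hypotheses (c1 : cover A1 B1 m) (c2 : cover A2 B2 n).
Hypotheses (h1 : ev x A1 = tau * ev x B1) (h2 : ev y A2 = tau * ev y B2).
Hypothesis hdeg : forall d (P Q : {poly C}) w (p q : {poly C}) (H : {poly {poly C}}),
  coprimep P Q -> maxn (size P) (size Q) = d.+1 ->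
  ev y q != 0 -> w = ev y p / ev y q -> ev w P = tau * ev w Q ->
  (size H <= d)%N -> ev2 x w H = 0 -> H = 0.

Lemma no_octahedral a b c : uniq [:: a; b; c] ->
  ~ octahedral (fibm A1 B1 a) (fibm A2 B2 a) (fibm A1 B1 b) (fibm A2 B2 b)
      (fibm A1 B1 c) (fibm A2 B2 c).
Proof.
rewrite /= !inE negb_or => /and3P[/andP[ab ac] bc _] [da1 [da2 db1 db2 dc1 dc2]].
have ba0 : b - a != 0 by rewrite subr_eq0 eq_sym.
have bc0 : b - c != 0 by rewrite subr_eq0.
have [k kE] := root_exists ((b - c) / (b - a)) (isT : 0 < 2)%N.
have k20 : k ^+ 2 != 0 by rewrite kE mulf_neq0 ?invr_eq0.
have [e [S1 [S2 [S10 S20 eE Ey]]]] := octa_divisible ty c2 h2 ab ac bc kE da2 db2 dc2.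
have [u [al [be [R1 [R2 [alb hu R10 R20 Ex]]]]]] :=
  octa_defect tx c1 h1 ab ac bc kE eE da1 db1 dc1.
have tu := transc_sqrt tx alb hu.
have s10 : ev y S1 != 0 by exact: transc_neq0.
have s20 : ev y S2 != 0 by exact: transc_neq0.
have r10 : ev u R1 != 0 by exact: transc_neq0.
have r20 : ev u R2 != 0 by exact: transc_neq0.
have tc0 := point_neq tx c1 h1 c.
set f := 1 + iota k * e in Ey Ex; set g := 1 - iota k * e in Ey Ex.
have two0 : 2%:R != 0 :> T by rewrite -(rmorph_nat iota) fmorph_eq0 pnatr_eq0.
have g0 : g != 0.
  apply/negP => /eqP g0; move/eqP: Ey; rewrite g0 mulr0 eq_sym mulf_eq0 expf_eq0 (negPf s20) /=.
  have -> : f = 2%:R - g by rewrite /f /g; ring.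
  by rewrite g0 subr0 (negPf two0).
have f0 : f != 0.
  by apply/negP => /eqP f0; move/eqP: Ey; rewrite f0 mulr0 mulf_eq0 expf_eq0 (negPf s10) (negPf g0).
(* w^3 = f/g = (1 + k e)/(1 - k e) *)
pose w := ev y S1 / ev y S2.
have wE : w ^+ 3 * g = f.
  by rewrite /w expr_div_n mulrAC Ey mulrAC mulfV ?mul1r // expf_neq0.
have [|zeta zE] := @alg_const _ _ iota (w * ev u R2 / ev u R1) ('X^3 - 1%:P)
    (monic_neq0 (monicXnsubC _ (isT : 0 < 3)%N)).
  rewrite rmorphB /= rmorphXn /= evX evC rmorph1 expr_div_n exprMn.
  apply/eqP; rewrite subr_eq0; apply/eqP.
  apply: (mulIf (mulf_neq0 (expf_neq0 3 r10) g0)); rewrite mul1r [RHS]Ex -wE.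
  by field.
have [|H [H0 sH HE]] := @sqrt_quadratic _ _ iota x u al be tx alb hu (zeta *: R1) R2 w R20.
  by rewrite evZ -zE divfK.
move/eqP: H0; apply.
apply: (hdeg (d := 6) (octa_coprime ac k20) (octa_size _ ac) s20 (w := w) (p := S1)) => //.
  have e2 : (tau - iota a) = e ^+ 2 * (tau - iota c) by rewrite eE divfK.
  have evM (p q : {poly C}) : ev w (p * q) = ev w p * ev w q by exact: rmorphM.
  have evD (p q : {poly C}) : ev w (p + q) = ev w p + ev w q by exact: rmorphD.
  have evB (p q : {poly C}) : ev w (p - q) = ev w p - ev w q by exact: rmorphB.
  rewrite /octa_num /octa_den !evB !evZ ![ev w (_ ^+ 2)]rmorphXn /= !evB !evD !rmorph1.
  rewrite ![ev w 'X^3]rmorphXn /= !evX rmorphM rmorphXn.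
  have w1 : (w ^+ 3 - 1) * g = (iota k * e) * 2%:R by rewrite mulrBl wE /f /g; ring.
  have w2 : (w ^+ 3 + 1) * g = 2%:R by rewrite mulrDl wE /f /g; ring.
  apply: (mulIf (expf_neq0 2 g0)).
  transitivity (iota a * iota k ^+ 2 * ((w ^+ 3 + 1) * g) ^+ 2 - iota c * ((w ^+ 3 - 1) * g) ^+ 2).
    by ring.
  transitivity (tau * (iota k ^+ 2 * ((w ^+ 3 + 1) * g) ^+ 2 - ((w ^+ 3 - 1) * g) ^+ 2)); last by ring.
  rewrite w1 w2; apply/eqP; rewrite -subr_eq0.
  have -> : iota a * iota k ^+ 2 * 2%:R ^+ 2 - iota c * (iota k * e * 2%:R) ^+ 2 -
     tau * (iota k ^+ 2 * 2%:R ^+ 2 - (iota k * e * 2%:R) ^+ 2) =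
     iota k ^+ 2 * 2%:R ^+ 2 * (e ^+ 2 * (tau - iota c) - (tau - iota a)) by ring.
  by rewrite -e2 subrr mulr0.
by rewrite (leq_trans sH).
Qed.
End OctahedralPair.

(** * Integral elements over C[u] and C[1/u] *)

Section Gauss.
Variable C : numClosedFieldType.
Implicit Types (Psi Phi h : {poly {poly C}}) (a : C).

Lemma eval_eq0_scale Psi a : map_poly (horner_eval a) Psi = 0 ->
  exists Psi', Psi = ('X - a%:P) *: Psi'.
Proof.
move=> h; exists (map_poly (fun p => p %/ ('X - a%:P)) Psi).
apply/polyP => i; rewrite coefZ coef_map_id0 ?div0p // mulrC divpK //.
rewrite dvdp_XsubCl rootE; have := congr1 (fun q : {poly C} => q`_i) h.
by rewrite coef_map coef0 /= /horner_eval => ->.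
Qed.

(** Lemma of Gauss: a factor of a monic polynomial over C[u] is monic up to
    scaling. *)
Lemma gauss_monic Psi Phi h : h \is monic -> Psi != 0 -> Phi != 0 ->
  Psi * Phi = (lead_coef Psi * lead_coef Phi) *: h ->
  exists Psi0, Psi = lead_coef Psi *: Psi0.
Proof.
move=> mh; move: {2}(size _ + size _)%N (leqnn (size (lead_coef Psi) + size (lead_coef Phi))) => k.
elim: k Psi Phi => [|k IH] Psi Phi.
  by rewrite leqn0 addn_eq0 !size_poly_eq0 !lead_coef_eq0 => /andP[/eqP ->]; rewrite eqxx.
move=> le P0 Q0 E; set l := lead_coef Psi; have l0 : l != 0 by rewrite lead_coef_eq0.
have [s1|s1] := eqVneq (size l) 1%N.
  have lE : l = (l`_0)%:P by apply: size1_polyC; rewrite s1.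
  exists ((l`_0)^-1%:P *: Psi); rewrite scalerA {1}lE -polyCM mulfV ?scale1r //.
  by apply: contraNneq l0 => c0; rewrite lE c0.
have /closed_rootP[a ra] := s1.
have split_root R : R != 0 -> map_poly (horner_eval a) R = 0 ->
    exists R', [/\ R = ('X - a%:P) *: R', R' != 0 &
      size (lead_coef R) = (size (lead_coef R')).+1].
  move=> R0 /eval_eq0_scale[R' RE]; have R'0 : R' != 0.
    by apply: contraNneq R0 => R'0; rewrite RE R'0 scaler0.
  exists R'; split=> //; rewrite RE lead_coefZ size_mul ?size_XsubC //.
    by rewrite polyXsubC_eq0.
  by rewrite lead_coef_eq0.
have Xa0 : ('X - a%:P : {poly C}) != 0 by rewrite polyXsubC_eq0.
have cancelX (u v : {poly {poly C}}) : ('X - a%:P) *: u = ('X - a%:P) *: v -> u = v.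
  by rewrite -!mul_polyC; apply: mulfI; rewrite polyC_eq0.
have : map_poly (horner_eval a) Psi * map_poly (horner_eval a) Phi = 0.
  by rewrite -rmorphM /= E map_evalZ hornerM (eqP ra) mul0r scale0r.
move/eqP; rewrite mulf_eq0 => /orP[]/eqP.
  move=> /(split_root _ P0)[Psi' [PE P'0 sP]].
  have [||||Psi0 PE0] := IH Psi' Phi => //.
  - by move: le; rewrite sP addSn ltnS.
  - by apply: cancelX; rewrite scalerAl -PE E PE lead_coefZ -mulrA scalerA.
  by exists Psi0; rewrite /l PE lead_coefZ -scalerA -PE0.
move=> /(split_root _ Q0)[Phi' [QE Q'0 sQ]].
have [||||Psi0 PE0] := IH Psi Phi' => //; last by exists Psi0.
- by move: le; rewrite sQ addnS ltnS.
- by apply: cancelX; rewrite scalerAr -QE E QE lead_coefZ mulrCA scalerA.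
Qed.

Variables (F : fieldType) (j : {rmorphism {poly C} -> F}).
Hypothesis j_inj : forall p, j p = 0 -> p = 0.
Hypothesis j_frac : forall f : F, exists p q, q != 0 /\ f = j p / j q.

Lemma j_neq0 p : p != 0 -> j p != 0.
Proof. by apply: contraNneq => /j_inj ->. Qed.

Lemma common_denominator (mu : {poly F}) : exists (Psi : {poly {poly C}}) d,
  d != 0 /\ j d *: mu = map_poly j Psi.
Proof.
elim/poly_ind: mu => [|mu c [Psi [d [d0 E]]]].
  by exists 0, 1; rewrite oner_neq0 scaler0 rmorph0.
have [p [q [q0 ->]]] := j_frac c.
exists (q *: Psi * 'X + (d * p)%:P), (d * q); split; first by rewrite mulf_neq0.
have -> : map_poly j (q *: Psi * 'X + (d * p)%:P) =
    j q *: (j d *: mu) * 'X + (j d * j p)%:P.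
  by rewrite rmorphD /= [map_poly _ (_ * 'X)]rmorphM /= map_polyX map_polyC /= map_polyZ E rmorphM.
rewrite rmorphM /= scalerDr -!scalerAl scalerA [j q * _]mulrC; congr (_ + _).
by rewrite -mul_polyC -polyCM; congr (_%:P); field; apply: j_neq0.
Qed.

(** A monic factor over the fraction field has coefficients in C[u]. *)
Lemma gauss_factor (mu : {poly F}) h : mu \is monic -> h \is monic ->
  mu %| map_poly j h -> exists Psi0, mu = map_poly j Psi0.
Proof.
move=> mmu mh /dvdpP[nu E].
have mh' : map_poly j h \is monic by rewrite monic_map.
have mnu : nu \is monic.
  move: mh'; rewrite E monicE lead_coefM (monicP mmu) mulr1 => /eqP h1.
  by rewrite monicE h1.
have [Psi [d [d0 EP]]] := common_denominator mu.
have [Phi [e [e0 EQ]]] := common_denominator nu.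
have injm (A B : {poly {poly C}}) : map_poly j A = map_poly j B -> A = B.
  move=> AB; apply/polyP => i; apply/eqP; rewrite -subr_eq0; apply/eqP/j_inj.
  by have := congr1 (fun q : {poly F} => q`_i) AB; rewrite !coef_map rmorphB /= => ->; rewrite subrr.
have lcm (A : {poly {poly C}}) : lead_coef (map_poly j A) = j (lead_coef A).
  have [->|A0] := eqVneq A 0; first by rewrite rmorph0 !lead_coef0 rmorph0.
  by rewrite lead_coef_map_eq // j_neq0 // lead_coef_eq0.
have lP : lead_coef Psi = d.
  apply/eqP; rewrite -subr_eq0; apply/eqP/j_inj.
  by rewrite rmorphB /= -lcm -EP lead_coefZ (monicP mmu) mulr1 subrr.
have lQ : lead_coef Phi = e.
  apply/eqP; rewrite -subr_eq0; apply/eqP/j_inj.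
  by rewrite rmorphB /= -lcm -EQ lead_coefZ (monicP mnu) mulr1 subrr.
have [||||Psi0 PE] := @gauss_monic Psi Phi h => //.
- by rewrite -lead_coef_eq0 lP.
- by rewrite -lead_coef_eq0 lQ.
- apply: injm; rewrite rmorphM /= -EP -EQ map_polyZ E lP lQ rmorphM /=.
  by rewrite -scalerAl -scalerAr scalerA [nu * _]mulrC.
exists Psi0; have := EP; rewrite PE map_polyZ lP /= => h1.
have := congr1 (fun q => (j d)^-1 *: q) h1.
by rewrite !scalerA mulVf ?scale1r // j_neq0.
Qed.

(** Integral elements of a finite extension have an integral minimal polynomial. *)
Lemma integral_minPoly (E : fieldExtType F) (e : E) :
  integralOver (in_alg E \o j) e ->
  exists Psi0, minPoly 1 e = map_poly (in_alg E) (map_poly j Psi0).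
Proof.
case=> h mh rh.
have [/polyOver1P[mu Dmu] mon_mu] := (minPolyOver 1 e, monic_minPoly 1 e).
have mmu : mu \is monic by rewrite Dmu map_monic in mon_mu.
have : mu %| map_poly j h.
  rewrite -(dvdp_map (in_alg E)) -Dmu minPoly_dvdp //.
    by apply/polyOver1P; exists (map_poly j h).
  by rewrite -map_poly_comp.
by move=> dv; have [Psi0 PE] := gauss_factor mmu mh dv; exists Psi0; rewrite Dmu PE.
Qed.
End Gauss.

(** The reversed polynomial X^N p(1/X), meaningful when deg p <= N. *)
Definition revp (R : nzRingType) N (p : {poly R}) := \poly_(i < N.+1) p`_(N - i).

Section Infinity.
Variable C : numClosedFieldType.
Local Notation F := {fraction {poly C}}.
Local Notation u := (tofrac 'X : F).

Lemma tofrac_X_neq0 : u != 0.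
Proof. by rewrite tofrac_eq0 polyX_eq0. Qed.

(** The constants of C(u). *)
Definition cst : C -> F := @tofrac {poly C} \o polyC.
HB.instance Definition _ := GRing.RMorphism.on cst.

(** The value of a polynomial at 1/u: the embedding of C[1/u]. *)
Definition jinf : {poly C} -> F := ev cst u^-1.
HB.instance Definition _ := GRing.RMorphism.on jinf.

Lemma tofracE (p : {poly C}) : tofrac p = ev cst u p.
Proof.
elim/poly_ind: p => [|p c IH]; first by rewrite !rmorph0.
by rewrite !rmorphD !rmorphM /= IH evX evC.
Qed.

Lemma ev_rev (v : F) N (p : {poly C}) : v != 0 -> (size p <= N.+1)%N ->
  ev cst v p = v ^+ N * ev cst v^-1 (revp N p).
Proof.
move=> v0 sp; rewrite /ev /= /horner_eval !(horner_coef_wide _ (n := N.+1)); last first.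
- by rewrite size_map_poly.
- by rewrite size_map_poly size_poly.
rewrite mulr_sumr (reindex_inj rev_ord_inj) /=; apply: eq_bigr => i _.
have iN : (i <= N)%N by rewrite -ltnS.
rewrite !coef_map /= subSS coef_poly ltn_ord mulrCA; congr (_ * _).
by rewrite exprVn -expfB_cond ?(negPf v0) ?add0n //.
Qed.

Lemma tofrac_rev N (p : {poly C}) : (size p <= N.+1)%N -> tofrac p = u ^+ N * jinf (revp N p).
Proof. by move=> sp; rewrite tofracE (ev_rev tofrac_X_neq0 sp). Qed.

Lemma jinf_rev N (p : {poly C}) : (size p <= N.+1)%N -> jinf p = u^-1 ^+ N * tofrac (revp N p).
Proof.
by move=> sp; rewrite /jinf (ev_rev _ sp) ?invr_eq0 ?tofrac_X_neq0 // invrK -tofracE.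
Qed.

Lemma revp_eq0 N (p : {poly C}) : (size p <= N.+1)%N -> revp N p = 0 -> p = 0.
Proof.
move=> sp r0; apply/polyP => i; rewrite coef0.
have [iN|iN] := leqP i N; last by rewrite nth_default // (leq_trans sp).
have := congr1 (fun q : {poly C} => q`_(N - i)) r0.
by rewrite coef0 coef_poly ltnS leq_subr subKn.
Qed.

Lemma jinf_inj (p : {poly C}) : jinf p = 0 -> p = 0.
Proof.
have sp := leqnSn (size p); move=> /eqP; rewrite (jinf_rev sp) mulf_eq0.
rewrite expf_eq0 invr_eq0 (negPf tofrac_X_neq0) andbF /= tofrac_eq0 => /eqP.
exact: revp_eq0.
Qed.

End Infinity.

Lemma tofrac_fracP (R : idomainType) (f : {fraction R}) :
  exists p q, q != 0 /\ f = tofrac p / tofrac q.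
Proof.
pose r := repr f; exists (val r).1, (val r).2; have d0 := denom_ratioP r.
split=> //; have T0 : tofrac (val r).2 != 0 by rewrite tofrac_eq0.
apply: (mulIf T0); rewrite divfK // -[f]reprK -/r.
unlock tofrac; rewrite -[LHS]FracField.pi_mul; apply/eqmodP => /=.
by rewrite FracField.equivfE /FracField.mulf !numden_Ratio ?oner_neq0 ?mulr1 //= mulrC.
Qed.

(** * Functions integral over both rings, and a quintic extension *)

Section BothConst.
Variable C : numClosedFieldType.
Local Notation F := {fraction {poly C}}.
Local Notation u := (tofrac 'X : F).

Lemma tofrac_inj (p : {poly C}) : tofrac p = 0 -> p = 0.
Proof. by move/eqP; rewrite tofrac_eq0 => /eqP. Qed.

Lemma jinf_frac (f : F) : exists p q, q != 0 /\ f = jinf p / jinf q.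
Proof.
have [p [q [q0 ->]]] := tofrac_fracP f; pose N := maxn (size p) (size q).
have sp : (size p <= N.+1)%N by rewrite ltnW // ltnS leq_maxl.
have sq : (size q <= N.+1)%N by rewrite ltnW // ltnS leq_maxr.
exists (revp N p), (revp N q); split.
  by apply: contraNneq q0 => /(revp_eq0 sq) ->.
rewrite (tofrac_rev sp) (tofrac_rev sq) invfM mulrACA divff ?mul1r //.
by rewrite expf_neq0 // tofrac_X_neq0.
Qed.

Lemma both_poly_const (p q : {poly C}) : tofrac p = jinf q -> (size p <= 1)%N.
Proof.
have sq := leqnSn (size q); set N := size q in sq *; rewrite (jinf_rev sq) => E.
have : tofrac ('X^N * p) = tofrac (revp N q).
  rewrite tofracM E tofracXn exprVn mulrA mulfV ?mul1r //.
  by rewrite expf_neq0 // tofrac_X_neq0.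
move/eqP; rewrite tofrac_eq => /eqP h.
have [->|p0] := eqVneq p 0; first by rewrite size_poly0.
have : (size ('X^N * p)%R <= N.+1)%N by rewrite h size_poly.
by rewrite mulrC size_mulXn // -addn1 leq_add2l.
Qed.

(** A function integral over C[u] and over C[1/u] is constant. *)
Lemma integral_both_const (E : fieldExtType F) (e : E) :
  integralOver (in_alg E \o @tofrac {poly C}) e -> integralOver (in_alg E \o @jinf C) e ->
  exists c : C, e = in_alg E (cst c).
Proof.
move=> /(integral_minPoly tofrac_inj (@tofrac_fracP _))[P DP].
move=> /(integral_minPoly (@jinf_inj C) jinf_frac)[Q DQ].
have Pc i : P`_i = (P`_i`_0)%:P.
  apply: size1_polyC; apply: (@both_poly_const _ Q`_i).
  have : map_poly (in_alg E) (map_poly (@tofrac _) P) = map_poly (in_alg E) (map_poly (@jinf C) Q).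
    by rewrite -DP -DQ.
  move/(congr1 (fun q : {poly E} => q`_i)); rewrite !coef_map /=.
  exact: (fmorph_inj (in_alg E)).
pose g : {poly C} := map_poly (fun p : {poly C} => p`_0) P.
have gE : minPoly 1 e = map_poly (in_alg E \o @cst C) g.
  rewrite DP; apply/polyP => i; rewrite !coef_map /= coef_map_id0 ?coef0 //.
  by rewrite {1}Pc.
apply: (@alg_const C E (in_alg E \o @cst C) e g).
  apply: contraTneq (monic_minPoly 1 e) => g0.
  by rewrite gE g0 rmorph0 monicE lead_coef0 eq_sym oner_eq0.
by have := root_minPoly 1 e; rewrite gE => /eqP.
Qed.
End BothConst.

Section IntegralRoot.
Variables (R : comNzRingType) (E : fieldType) (j : {rmorphism R -> E}).

Lemma integral_exp_root (e : E) n (a : E) : (0 < n)%N -> e ^+ n = a ->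
  integralOver j a -> integralOver j e.
Proof.
move=> n0 en ia; apply: (@integral_root_monic _ _ j e ('X^n - a%:P)).
- by rewrite monicXnsubC.
- by rewrite rootE !hornerE en subrr.
apply/integral_poly => i; rewrite coefB coefXn coefC.
apply: integral_sub; first exact: integral_nat.
by case: ifP => _ //; exact: integral0.
Qed.

Lemma integral_exp (e : E) n : integralOver j e -> integralOver j (e ^+ n).
Proof.
move=> ie; elim: n => [|n IH]; first by rewrite expr0; apply: integral1.
by rewrite exprS; apply: integral_mul.
Qed.
End IntegralRoot.

(** A root r of t^3 (t^2 + 5 t + 40) = X^3/Z^5.  The polynomial on the left has
    critical values 0 and 1728, and subtracting 1728 leaves
    (t - 3) (t^2 + 4 t + 24)^2. *)
Section QuinticIntegral.
Variables (C : numClosedFieldType) (E : fieldType) (j : {rmorphism {poly C} -> E}).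
Variables (X Y Z h : {poly C}) (r : E).
Hypothesis XYZ : X ^+ 3 - 1728%:R * Z ^+ 5 = Y ^+ 2 * h.
Hypotheses (jX0 : j X != 0) (jY0 : j Y != 0) (jZ0 : j Z != 0).
Hypothesis rE : (r ^+ 3 * (r ^+ 2 + 5%:R * r + 40%:R)) * j Z ^+ 5 = j X ^+ 3.
Local Notation int := (integralOver j).

Let x := j X. Let y := j Y. Let z := j Z.
Let q := r ^+ 2 + 5%:R * r + 40%:R.
Let l := r - 3%:R.
Let k := r ^+ 2 + 4%:R * r + 24%:R.

Lemma quintic_critical : z ^+ 5 * (l * k ^+ 2) = y ^+ 2 * j h.
Proof.
have := congr1 j XYZ; rewrite rmorphB /= rmorphXn /= => jXYZ.
have -> : y ^+ 2 * j h = j (Y ^+ 2 * h) by rewrite rmorphM /= rmorphXn.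
rewrite -jXYZ -rE rmorphM /= rmorphXn /= rmorph_nat /l /k /z; ring.
Qed.

Lemma int_zr : int (z * r).
Proof.
pose p : {poly E} := 'X^5 + (5%:R * z) *: 'X^4 + (40%:R * z ^+ 2) *: 'X^3 - (x ^+ 3)%:P.
have lowp : (size ((5%:R * z) *: 'X^4 + (40%:R * z ^+ 2) *: 'X^3 - (x ^+ 3)%:P : {poly E})%R < 6)%N.
  rewrite ltnS; apply: size_subP.
    rewrite (leq_trans (size_polyD _ _)) // geq_max.
    by rewrite !(leq_trans (size_scale_leq _ _)) ?size_polyXn.
  by rewrite (leq_trans (size_polyC_leq1 _)).
have pE : p = 'X^5 + ((5%:R * z) *: 'X^4 + (40%:R * z ^+ 2) *: 'X^3 - (x ^+ 3)%:P).
  by rewrite /p !addrA.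
apply: (@integral_root_monic _ _ j _ p).
- by rewrite pE monicE lead_coefDl ?size_polyXn // lead_coefXn.
- rewrite rootE /p !(hornerD, hornerN, hornerZ, hornerXn, hornerC) /x -rE /z.
  by apply/eqP; ring.
apply/integral_poly => i; rewrite /p !(coefD, coefB, coefZ, coefXn, coefC, coefN).
apply: integral_sub; last by case: ifP => _; [apply/integral_exp/integral_id|apply: integral0].
apply: integral_add; first apply: integral_add.
- exact: integral_nat.
- by apply: integral_mul; [apply: integral_mul; [apply: integral_nat|apply: integral_id]|apply: integral_nat].
- by apply: integral_mul; [apply: integral_mul; [apply: integral_nat|apply/integral_exp/integral_id]|apply: integral_nat].
Qed.

Lemma int_zl : int (z * l).
Proof.
have -> : z * l = z * r - 3%:R * z by rewrite /l; ring.
apply: integral_sub; first exact: int_zr.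
by apply: integral_mul; [apply: integral_nat|apply: integral_id].
Qed.

Lemma int_z2 a b : int (z ^+ 2 * (r ^+ 2 + a%:R * r + b%:R)).
Proof.
have -> : z ^+ 2 * (r ^+ 2 + a%:R * r + b%:R) =
  (z * r) ^+ 2 + a%:R * z * (z * r) + b%:R * z ^+ 2 by ring.
have iz := integral_id j Z; have ir := int_zr.
apply: integral_add; first apply: integral_add.
- exact: integral_exp.
- by do !apply: integral_mul => //; apply: integral_nat.
- by apply: integral_mul; [apply: integral_nat|apply: integral_exp].
Qed.

Lemma int_lk : int (z ^+ 3 * l * k / y).
Proof.
apply: (@integral_exp_root _ _ _ _ 2 ((z * l) * j h)) => //.
  have := quintic_critical => H; rewrite -/z in H.
  apply: (mulfI (expf_neq0 2 jY0)).
  have -> : j Y ^+ 2 * (z ^+ 3 * l * k / y) ^+ 2 = z * l * (z ^+ 5 * (l * k ^+ 2)).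
    by rewrite /y; field.
  by rewrite H -/y; ring.
by apply: integral_mul; [apply: int_zl|apply: integral_id].
Qed.

Lemma int_qr : int (z ^+ 3 * (q * r) / x).
Proof.
apply: (@integral_exp_root _ _ _ _ 3 ((z ^+ 2 * q) ^+ 2)) => //.
  apply: (mulfI (expf_neq0 3 jX0)).
  have -> : j X ^+ 3 * (z ^+ 3 * (q * r) / x) ^+ 3 = z ^+ 9 * q ^+ 3 * r ^+ 3.
    by rewrite /x; field.
  by rewrite -rE -/q /z; ring.
by apply: integral_exp; apply: int_z2.
Qed.

Lemma int_qr2 : int (z ^+ 4 * (q * r ^+ 2) / x ^+ 2).
Proof.
apply: (@integral_exp_root _ _ _ _ 3 (z ^+ 2 * q)) => //; last exact: int_z2.
apply: (mulfI (expf_neq0 6 jX0)).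
have -> : j X ^+ 6 * (z ^+ 4 * (q * r ^+ 2) / x ^+ 2) ^+ 3 =
    z ^+ 12 * q * (r ^+ 3 * q) ^+ 2.
  by rewrite /x; field.
have -> : j X ^+ 6 = (j X ^+ 3) ^+ 2 by rewrite -exprM.
by rewrite -rE -/q /z; ring.
Qed.

Let jn n p : j (n%:R * p) = n%:R * j p.
Proof. by rewrite rmorphM rmorph_nat. Qed.
Let jD p p' : j (p + p') = j p + j p'. Proof. exact: rmorphD. Qed.
Let jN p : j (- p) = - j p. Proof. exact: rmorphN. Qed.
Let jM p p' : j (p * p') = j p * j p'. Proof. exact: rmorphM. Qed.
Let jXn p n : j (p ^+ n) = j p ^+ n. Proof. exact: rmorphXn. Qed.

Variables (g0 g1 g2 g3 g4 f0 f1 f2 f3 f4 : {poly C}).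
(** The combination of 1, r, ..., r^4 with coefficients e0, ..., e4. *)
Definition quint_num (e0 e1 e2 e3 e4 : {poly C}) :=
  j e0 + j e1 * r + j e2 * r ^+ 2 + j e3 * r ^+ 3 + j e4 * r ^+ 4.
Variables e0 e1 e2 e3 e4 : {poly C}.

(** Integrality at the zeros of X of a combination of 1, ..., r^4, expressed in
    the basis q, q r, q r^2, r^3, r^4. *)
Lemma int_at_X :
  e0 = 40%:R * (X ^+ 2 * g0) ->
  e1 = 5%:R * (X ^+ 2 * g0) + 40%:R * (X * g1) ->
  e2 = X ^+ 2 * g0 + 5%:R * (X * g1) + 40%:R * g2 ->
  e3 = X * g1 + 5%:R * g2 + X ^+ 2 * g3 ->
  e4 = g2 + X ^+ 2 * g4 ->
  int (z ^+ 4 * (quint_num e0 e1 e2 e3 e4 / x ^+ 2)).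
Proof.
move=> -> -> -> -> ->.
have -> : z ^+ 4 * (quint_num (40%:R * (X ^+ 2 * g0))
   (5%:R * (X ^+ 2 * g0) + 40%:R * (X * g1))
   (X ^+ 2 * g0 + 5%:R * (X * g1) + 40%:R * g2)
   (X * g1 + 5%:R * g2 + X ^+ 2 * g3) (g2 + X ^+ 2 * g4) / x ^+ 2) =
   j g0 * (z ^+ 2 * (z ^+ 2 * q)) + j g1 * (z * (z ^+ 3 * (q * r) / x)) +
   j g2 * (z ^+ 4 * (q * r ^+ 2) / x ^+ 2) + j g3 * (z * (z * r) ^+ 3) +
   j g4 * (z * r) ^+ 4.
  rewrite /quint_num !(jn, jD, jXn, jM) /q /x /z.
  by field.
have iz := integral_id j Z; have ir := int_zr.
have ig p := integral_id j p.
apply: integral_add; [apply: integral_add; [apply: integral_add; [apply: integral_add|]|]|];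
  apply: integral_mul (ig _) _.
- by apply: integral_mul; [apply: integral_exp|apply: int_z2].
- by apply: integral_mul => //; apply: int_qr.
- exact: int_qr2.
- by apply: integral_mul => //; apply: integral_exp.
- exact: integral_exp.
Qed.

(** Integrality at the zeros of Y, in the basis l, l r, l k, l k r, k^2. *)
Lemma int_at_Y :
  e0 = - (3%:R * (Y * f0)) - 72%:R * f2 + 576%:R * (Y * f4) ->
  e1 = Y * f0 - 3%:R * (Y * f1) + 12%:R * f2 - 72%:R * f3 + 192%:R * (Y * f4) ->
  e2 = Y * f1 + f2 + 12%:R * f3 + 64%:R * (Y * f4) ->
  e3 = f2 + f3 + 8%:R * (Y * f4) ->
  e4 = f3 + Y * f4 ->
  int (z ^+ 4 * (quint_num e0 e1 e2 e3 e4 / y)).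
Proof.
move=> -> -> -> -> ->.
set Q := quint_num _ _ _ _ _.
have -> : z ^+ 4 * (Q / y) =
   j f0 * (z ^+ 3 * (z * l)) + j f1 * (z ^+ 2 * ((z * r) * (z * l))) +
   j f2 * (z * (z ^+ 3 * l * k / y)) + j f3 * ((z * r) * (z ^+ 3 * l * k / y)) +
   j f4 * (z ^+ 2 * k) ^+ 2.
  rewrite /Q /quint_num !(jn, jD, jN, jM) /l /k /y /z.
  by field.
have iz := integral_id j Z; have ir := int_zr.
have ig p := integral_id j p.
apply: integral_add; [apply: integral_add; [apply: integral_add; [apply: integral_add|]|]|];
  apply: integral_mul (ig _) _.
- by apply: integral_mul; [apply: integral_exp|apply: int_zl].
- apply: integral_mul; [exact: integral_exp|apply: integral_mul => //; exact: int_zl].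
- by apply: integral_mul => //; apply: int_lk.
- by apply: integral_mul => //; apply: int_lk.
- by apply: integral_exp; apply: int_z2.
Qed.
End QuinticIntegral.

(** The embedding jI is that of C[1/u], and v is 1/u. *)
Section IntegralInfinity.
Variables (C : numClosedFieldType) (E : fieldType).
Variables (j jI : {rmorphism {poly C} -> E}) (v : E).
Hypothesis jrev : forall N (p : {poly C}), (size p <= N.+1)%N ->
  jI (revp N p) = v ^+ N * j p.

Lemma jI_X : jI 'X = v.
Proof.
have -> : 'X = revp 1 (1 : {poly C}).
  by apply/polyP => -[|[|i]]; rewrite coefX coef_poly ?coefC.
by rewrite jrev ?size_poly1 // rmorph1 mulr1 expr1.
Qed.

(** An element integral over C[u] is integral over C[1/u] away from 1/u = 0. *)
Lemma integral_infty (e : E) : integralOver j e ->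
  exists N, integralOver jI (v ^+ N * e).
Proof.
case=> h mh rh; pose n := (size h).-1.
have sh : size h = n.+1 by rewrite prednK // size_poly_gt0 monic_neq0.
pose N := (\max_(i < n) size (h`_i)%R)%N; exists N.
pose p : {poly E} := \poly_(i < n.+1) (v ^+ (N * (n - i)) * j h`_i).
have hn : h`_n = 1 by have := monicP mh; rewrite lead_coefE sh.
have pn : p`_n = 1 by rewrite coef_poly ltnSn subnn muln0 hn rmorph1 mulr1 expr0.
apply: (@integral_root_monic _ _ jI _ p).
- rewrite monicE lead_coef_poly //; move: pn; rewrite coef_poly ltnSn => -> //.
  exact: oner_neq0.
- rewrite rootE horner_poly; apply/eqP.
  transitivity (v ^+ (N * n) * (map_poly j h).[e]); last by rewrite (eqP rh) mulr0.
  rewrite (@horner_coef_wide _ n.+1) ?mulr_sumr; last by rewrite (leq_trans (size_poly _ _)) ?sh.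
  apply: eq_bigr => i _; rewrite coef_map /= exprMn -exprM mulrACA -exprD -mulnDr.
  by rewrite subnK ?mulrA // -ltnS.
apply/integral_poly => i; rewrite coef_poly ltnS leq_eqVlt.
have [->|_] /= := eqVneq i n.
  by rewrite subnn muln0 hn rmorph1 mulr1 expr0; exact: integral1.
case: ifP => [iN|_]; last exact: integral0.
have -> : (N * (n - i) = N * (n - i).-1 + N)%N by rewrite -mulnSr prednK // subn_gt0.
rewrite exprD -mulrA -jrev; last first.
  exact: leq_trans (leq_bigmax (Ordinal iN)) (leqnSn _).
apply: integral_mul; last exact: integral_id.
by rewrite -jI_X -rmorphXn; exact: integral_id.
Qed.

Variables (X Y Z h : {poly C}) (r : E).
Hypothesis XYZ : X ^+ 3 - 1728%:R * Z ^+ 5 = Y ^+ 2 * h.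
Hypotheses (jX0 : j X != 0) (jY0 : j Y != 0) (jZ0 : j Z != 0) (v0 : v != 0).
Hypothesis rE : (r ^+ 3 * (r ^+ 2 + 5%:R * r + 40%:R)) * j Z ^+ 5 = j X ^+ 3.
Hypothesis copXZ : coprimep X Z.
Variables (xi upsilon zeta : nat).
Hypotheses (sX : size X = xi.+1) (sY : size Y = upsilon.+1) (sZ : size Z = zeta.+1).
Hypothesis xz : (3 * xi = 5 * zeta)%N.
Local Notation d := (2 * xi + upsilon)%N.
Hypothesis zd : (4 * zeta <= d)%N.
Variables c0 c1 c2 c3 c4 : {poly C}.
Hypotheses (s0 : (size c0 <= d.+1)%N) (s1 : (size c1 <= (d - zeta).+1)%N)
  (s2 : (size c2 <= (d - 2 * zeta).+1)%N) (s3 : (size c3 <= (d - 3 * zeta).+1)%N)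
  (s4 : (size c4 <= (d - 4 * zeta).+1)%N).
Local Notation N := (quint_num j r c0 (Z * c1) (Z ^+ 2 * c2) (Z ^+ 3 * c3) (Z ^+ 4 * c4)).
Hypothesis atX : integralOver j (j Z ^+ 4 * (N / j X ^+ 2)).
Hypothesis atY : integralOver j (j Z ^+ 4 * (N / j Y)).

Let X0 : X != 0. Proof. by rewrite -size_poly_gt0 sX. Qed.
Let Y0 : Y != 0. Proof. by rewrite -size_poly_gt0 sY. Qed.
Let Z0 : Z != 0. Proof. by rewrite -size_poly_gt0 sZ. Qed.

Lemma copYX : coprimep Y X.
Proof.
apply: coprimep_closed Y0 _ => a Ya; apply/negP => Xa.
have : (X ^+ 3 - 1728%:R * Z ^+ 5).[a] = 0.
  by rewrite XYZ hornerM horner_exp (eqP Ya) expr0n mul0r.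
rewrite hornerD hornerN horner_exp (eqP Xa) expr0n /= sub0r => /eqP.
rewrite oppr_eq0 hornerM horner_exp mulf_eq0 -polyC_natr hornerC pnatr_eq0 /=.
rewrite expf_eq0 /= => Za.
by have := coprimep_root copXZ Xa; rewrite Za.
Qed.

Lemma copYZ : coprimep Y Z.
Proof.
apply: coprimep_closed Y0 _ => a Ya; apply/negP => Za.
have : (X ^+ 3 - 1728%:R * Z ^+ 5).[a] = 0.
  by rewrite XYZ hornerM horner_exp (eqP Ya) expr0n mul0r.
rewrite hornerD hornerN [(1728%:R * _).[a]]hornerM !horner_exp (eqP Za) expr0n /= mulr0 subr0 => /eqP.
rewrite expf_eq0 /= => Xa.
by have := coprimep_root copXZ Xa; rewrite (eqP Za) eqxx.
Qed.

Lemma int_num : integralOver j N.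
Proof.
have zr := int_zr rE; have ic p := integral_id j p.
have -> : N = j c0 + j c1 * (j Z * r) + j c2 * (j Z * r) ^+ 2 +
    j c3 * (j Z * r) ^+ 3 + j c4 * (j Z * r) ^+ 4.
  by rewrite /quint_num !(rmorphXn, rmorphM); ring.
apply: integral_add; [apply: integral_add; [apply: integral_add; [apply: integral_add|]|]|] => //;
 apply: integral_mul (ic _) _ => //; exact: integral_exp.
Qed.

(** The two local conditions suffice, as X^2, Y and Z are pairwise coprime. *)
Lemma int_fin : integralOver j (N / j (X ^+ 2 * Y)).
Proof.
have jXY : j (X ^+ 2 * Y) = j X ^+ 2 * j Y by rewrite rmorphM /= rmorphXn.
have copX2Y : coprimep (X ^+ 2) Y by rewrite coprimep_expl // coprimep_sym copYX.
have [[a b] /= ab] := Bezout_eq1_coprimepP _ _ copX2Y.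
have cop2 : coprimep (Z ^+ 4) (X ^+ 2 * Y).
  by rewrite coprimep_expl // coprimepMr coprimep_expr ?(coprimep_sym Z) ?copXZ ?copYZ.
have [[a' b'] /= ab'] := Bezout_eq1_coprimepP _ _ cop2.
have ia p := integral_id j p.
have -> : N / j (X ^+ 2 * Y) = j a' * (j a * (j Z ^+ 4 * (N / j Y)) + j b * (j Z ^+ 4 * (N / j X ^+ 2))) + j b' * N.
  have E1 : j a * j X ^+ 2 + j b * j Y = 1 by rewrite -rmorphXn -!rmorphM -rmorphD ab rmorph1.
  have E2 : j a' * j Z ^+ 4 + j b' * (j X ^+ 2 * j Y) = 1.
    by rewrite -jXY -rmorphXn -!rmorphM -rmorphD ab' rmorph1.
  rewrite jXY -[LHS]mul1r -{1}E2 mulrDl; congr (_ + _); last by field; rewrite ?jX0 ?jY0.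
  rewrite -!mulrA; congr (_ * _); rewrite -[LHS]mul1r -{1}E1.
  by field; rewrite ?jX0 ?jY0.
apply: integral_add; last by apply: integral_mul => //; exact: int_num.
by apply: integral_mul => //; apply: integral_add; apply: integral_mul.
Qed.

(** At infinity the degree bounds on the ci suffice. *)
Lemma int_inf : integralOver jI (N / j (X ^+ 2 * Y)).
Proof.
have sD : size (X ^+ 2 * Y) = d.+1.
  by rewrite size_mul ?expf_neq0 // expr2 size_mul // sX sY !addSn !addnS /= mul2n -addnn.
pose D := revp d (X ^+ 2 * Y); pose Zr := revp zeta Z.
have jD : jI D = v ^+ d * j (X ^+ 2 * Y) by rewrite jrev ?sD.
have jZr : jI Zr = v ^+ zeta * j Z by rewrite jrev ?sZ.
have jXr : jI (revp xi X) = v ^+ xi * j X by rewrite jrev ?sX.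
have zr : integralOver jI (jI Zr * r).
  apply: (@int_zr C E jI (revp xi X) Zr r).
  rewrite jZr jXr !exprMn -!exprM [(xi * 3)%N]mulnC xz [(zeta * 5)%N]mulnC -rE; ring.
have [M iM] := integral_infty int_fin.
set G := N / _ in iM *.
have iD : integralOver jI (jI D * G).
  have -> : jI D * G = jI (revp d c0) + jI (revp (d - zeta) c1) * (jI Zr * r) +
     jI (revp (d - 2 * zeta) c2) * (jI Zr * r) ^+ 2 +
     jI (revp (d - 3 * zeta) c3) * (jI Zr * r) ^+ 3 +
     jI (revp (d - 4 * zeta) c4) * (jI Zr * r) ^+ 4.
    have vE k a : (k <= 4)%N -> v ^+ (d - k * zeta) * a * (v ^+ zeta * j Z * r) ^+ k =
       v ^+ d * (a * (j Z * r) ^+ k).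
      move=> k4; have kd : (k * zeta <= d)%N by apply: leq_trans zd; rewrite leq_mul2r k4 orbT.
      rewrite -(mulrA (v ^+ zeta)) exprMn -exprM mulrACA -exprD [(zeta * k)%N]mulnC.
      by rewrite subnK // mulrA.
    have v1 := vE 1%N (j c1); rewrite mul1n !expr1 in v1.
    rewrite jD jZr !jrev // v1 // !vE // /G.
    have jXY0 : j (X ^+ 2 * Y) != 0 by rewrite rmorphM /= rmorphXn mulf_neq0 ?expf_neq0.
    transitivity (v ^+ d * N).
      by rewrite -mulrA [j (_ * _) * _]mulrC divfK.
    by rewrite /quint_num !(rmorphXn, rmorphM); ring.
  have ic p := integral_id jI p.
  apply: integral_add; [apply: integral_add; [apply: integral_add; [apply: integral_add|]|]|] => //;
  apply: integral_mul (ic _) _ => //; exact: integral_exp.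
have copD : coprimep D 'X^M.
  rewrite coprimep_expr // coprimepX rootE horner_coef0 coef_poly /= subn0.
  have := lead_coef_eq0 (X ^+ 2 * Y); rewrite lead_coefE sD /= => ->.
  by rewrite mulf_neq0 ?expf_neq0.
have [[a b] /= ab] := Bezout_eq1_coprimepP _ _ copD.
have -> : G = jI a * (jI D * G) + jI b * (v ^+ M * G).
  have E1 : jI a * jI D + jI b * v ^+ M = 1.
    by rewrite -jI_X -rmorphXn -!rmorphM -rmorphD ab rmorph1.
  by rewrite -[LHS]mul1r -E1 mulrDl !mulrA.
by apply: integral_add; apply: integral_mul => //; exact: integral_id.
Qed.
End IntegralInfinity.

(** * Everywhere integral elements of the quintic algebra *)

(** The kernel of a linear map, as the row space of a free matrix. *)
Lemma linear_kernel (C : fieldType) N K (f : 'rV[C]_N -> 'rV[C]_K) k :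
  linear f -> (K + k <= N)%N ->
  exists r (B : 'M[C]_(r, N)), [/\ (k <= r)%N, row_free B &
    forall w : 'rV_r, f (w *m B) = 0].
Proof.
move=> lf KN.
pose f' : {linear 'rV[C]_N -> 'rV[C]_K} :=
  HB.pack f (GRing.isLinear.Build C 'rV[C]_N 'rV[C]_K _ f lf).
pose A := lin1_mx f'; exists (\rank (kermx A)), (row_base (kermx A)); split.
- by rewrite mxrank_ker leq_subRL ?rank_leq_row // (leq_trans _ KN) // leq_add2r rank_leq_col.
- exact: row_base_free.
move=> w; rewrite -[f _]/(f' _) -mul_rV_lin1 -mulmxA.
have /submxP[D ->] : (row_base (kermx A) <= kermx A)%MS by rewrite eq_row_base.
by rewrite -mulmxA mulmx_ker !mulmx0.
Qed.

Section Lattice.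
Variables (C : numClosedFieldType) (X Y Z : {poly C}) (xi upsilon zeta eta : nat).
Hypotheses (sX : size X = xi.+1) (sY : size Y = upsilon.+1) (sZ : size Z = zeta.+1).
Hypothesis xz : (3 * xi = 5 * zeta)%N.
Hypothesis yx : (2 * upsilon + eta = 3 * xi)%N.
Hypothesis eta2 : (eta <= 2)%N.
Local Notation d := (2 * xi + upsilon)%N.

Lemma zeta_le_d : (4 * zeta <= d)%N.
Proof. by move: xz yx eta2; clear=> *; lia. Qed.

(** coordinates in the bases (q, qt, qt^2, t^3, t^4) and
    (l, lt, lk, lkt, k^2) of polynomials in t of degree at most 4 *)
Let tt : {poly C} := (40%:R^-1)%:P.
Let ww : {poly C} := (2025%:R^-1)%:P.
Let ttE : 40%:R * tt = 1.
Proof. by rewrite /tt -polyC_natr -polyCM mulfV // pnatr_eq0. Qed.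
Let wwE : 2025%:R * ww = 1.
Proof. by rewrite /ww -polyC_natr -polyCM mulfV // pnatr_eq0. Qed.

(** G0, ..., G4 are the coordinates of e0 + ... + e4 t^4 in the basis q, q t,
    q t^2, t^3, t^4, where q = t^2 + 5 t + 40. *)
Definition G0 (e0 : {poly C}) := tt * e0.
Definition G1 e0 (e1 : {poly C}) := tt * (e1 - 5%:R * G0 e0).
Definition G2 e0 e1 (e2 : {poly C}) := tt * (e2 - G0 e0 - 5%:R * G1 e0 e1).
Definition G3 e0 e1 e2 (e3 : {poly C}) := e3 - G1 e0 e1 - 5%:R * G2 e0 e1 e2.
Definition G4 e0 e1 e2 (e4 : {poly C}) := e4 - G2 e0 e1 e2.

(** F0, ..., F4 are its coordinates in the basis l, l t, l k, l k t, k^2, where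
    l = t - 3 and k = t^2 + 4 t + 24.  The last one is the value at t = 3
    divided by k(3)^2 = 2025. *)
Definition F4 (e0 e1 e2 e3 e4 : {poly C}) :=
  ww * (e0 + 3%:R * e1 + 9%:R * e2 + 27%:R * e3 + 81%:R * e4).
Definition F3 e0 e1 e2 e3 e4 := e4 - F4 e0 e1 e2 e3 e4.
Definition F2 e0 e1 e2 e3 e4 := e3 - F3 e0 e1 e2 e3 e4 - 8%:R * F4 e0 e1 e2 e3 e4.
Definition F1 e0 e1 e2 e3 e4 := e2 - F2 e0 e1 e2 e3 e4 - 12%:R * F3 e0 e1 e2 e3 e4
  - 64%:R * F4 e0 e1 e2 e3 e4.
Definition F0 e0 e1 e2 e3 e4 := e1 + 3%:R * F1 e0 e1 e2 e3 e4
  - 12%:R * F2 e0 e1 e2 e3 e4 + 72%:R * F3 e0 e1 e2 e3 e4 - 192%:R * F4 e0 e1 e2 e3 e4.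

(** The shape of the coefficients required by [int_at_X]. *)
Definition at_X (e0 e1 e2 e3 e4 : {poly C}) := exists g0 g1 g2 g3 g4,
  [/\ e0 = 40%:R * (X ^+ 2 * g0),
  e1 = 5%:R * (X ^+ 2 * g0) + 40%:R * (X * g1),
  e2 = X ^+ 2 * g0 + 5%:R * (X * g1) + 40%:R * g2,
  e3 = X * g1 + 5%:R * g2 + X ^+ 2 * g3 &
  e4 = g2 + X ^+ 2 * g4].

(** The shape of the coefficients required by [int_at_Y]. *)
Definition at_Y (e0 e1 e2 e3 e4 : {poly C}) := exists f0 f1 f2 f3 f4,
  [/\ e0 = - (3%:R * (Y * f0)) - 72%:R * f2 + 576%:R * (Y * f4),
  e1 = Y * f0 - 3%:R * (Y * f1) + 12%:R * f2 - 72%:R * f3 + 192%:R * (Y * f4),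
  e2 = Y * f1 + f2 + 12%:R * f3 + 64%:R * (Y * f4),
  e3 = f2 + f3 + 8%:R * (Y * f4) &
  e4 = f3 + Y * f4].

Lemma at_XP e0 e1 e2 e3 e4 : X ^+ 2 %| G0 e0 -> X %| G1 e0 e1 ->
  X ^+ 2 %| G3 e0 e1 e2 e3 -> X ^+ 2 %| G4 e0 e1 e2 e4 -> at_X e0 e1 e2 e3 e4.
Proof.
move=> /dvdpP[g0 E0] /dvdpP[g1 E1] /dvdpP[g3 E3] /dvdpP[g4 E4].
have cancel40 (a b : {poly C}) : tt * a = b -> a = 40%:R * b.
  by move=> <-; rewrite mulrA ttE mul1r.
exists g0, g1, (G2 e0 e1 e2), g3, g4.
have H0 := cancel40 _ _ E0; have H1 := cancel40 _ _ E1.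
have H2 := cancel40 _ _ (erefl (G2 e0 e1 e2)).
rewrite E0 in H1; rewrite E0 E1 in H2; rewrite /G3 E1 in E3; rewrite /G4 in E4.
split.
- by rewrite H0; ring.
- by rewrite -[e1](subrK (5%:R * (g0 * X ^+ 2))) H1; ring.
- by rewrite -[LHS](subrK (g0 * X ^+ 2)) -[e2 - _](subrK (5%:R * (g1 * X))) H2; ring.
- by rewrite -[LHS](subrK (g1 * X)) -[e3 - _](subrK (5%:R * G2 e0 e1 e2)) E3; ring.
- by rewrite -[LHS](subrK (G2 e0 e1 e2)) E4; ring.
Qed.

Lemma at_YP e0 e1 e2 e3 e4 : Y %| F0 e0 e1 e2 e3 e4 -> Y %| F1 e0 e1 e2 e3 e4 ->
  Y %| F4 e0 e1 e2 e3 e4 -> at_Y e0 e1 e2 e3 e4.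
Proof.
move=> /dvdpP[f0 E0] /dvdpP[f1 E1] /dvdpP[f4 E4].
exists f0, f1, (F2 e0 e1 e2 e3 e4), (F3 e0 e1 e2 e3 e4), f4.
rewrite ![Y * _]mulrC -E0 -E1 -E4 /F0 /F1 /F2 /F3.
have h : e0 = 2025%:R * F4 e0 e1 e2 e3 e4 - 3%:R * e1 - 9%:R * e2 - 27%:R * e3 - 81%:R * e4.
  by rewrite /F4 mulrA wwE; ring.
move: (F4 e0 e1 e2 e3 e4) h => f h.
by split; first (by rewrite [LHS]h; ring); ring.
Qed.

Local Notation n0 := d.+1.
Local Notation n1 := (d - zeta).+1.
Local Notation n2 := (d - 2 * zeta).+1.
Local Notation n3 := (d - 3 * zeta).+1.
Local Notation n4 := (d - 4 * zeta).+1.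
Local Notation dimV := (n0 + (n1 + (n2 + (n3 + n4))))%N.

Let p0 (u : 'rV[C]_dimV) : {poly C} := rVpoly (lsubmx u).
Let p1 (u : 'rV[C]_dimV) : {poly C} := rVpoly (lsubmx (rsubmx u)).
Let p2 (u : 'rV[C]_dimV) : {poly C} := rVpoly (lsubmx (rsubmx (rsubmx u))).
Let p3 (u : 'rV[C]_dimV) : {poly C} := rVpoly (lsubmx (rsubmx (rsubmx (rsubmx u)))).
Let p4 (u : 'rV[C]_dimV) : {poly C} := rVpoly (rsubmx (rsubmx (rsubmx (rsubmx u)))).

(** C-linear maps to C[u]. *)
Definition lin_poly (V : lmodType C) (f : V -> {poly C}) :=
  forall a u v, f (a *: u + v) = a%:P * f u + f v.

Lemma lin_poly_mul (V : lmodType C) (f : V -> {poly C}) P :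
  lin_poly f -> lin_poly (fun u => P * f u).
Proof. by move=> lf a u v; rewrite lf mulrDr mulrCA. Qed.

Lemma lin_poly_add (V : lmodType C) (f g : V -> {poly C}) :
  lin_poly f -> lin_poly g -> lin_poly (fun u => f u + g u).
Proof. by move=> lf lg a u v; rewrite lf lg; ring. Qed.

Lemma lin_poly_sub (V : lmodType C) (f g : V -> {poly C}) :
  lin_poly f -> lin_poly g -> lin_poly (fun u => f u - g u).
Proof. by move=> lf lg a u v; rewrite lf lg; ring. Qed.

Let E0 u := p0 u.
Let E1 u := Z * p1 u.
Let E2 u := Z ^+ 2 * p2 u.
Let E3 u := Z ^+ 3 * p3 u.
Let E4 u := Z ^+ 4 * p4 u.

Let lp0 : lin_poly p0.
Proof. by move=> a u v; rewrite /p0 !linearP /= mul_polyC. Qed.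
Let lp1 : lin_poly p1.
Proof. by move=> a u v; rewrite /p1 !linearP /= mul_polyC. Qed.
Let lp2 : lin_poly p2.
Proof. by move=> a u v; rewrite /p2 !linearP /= mul_polyC. Qed.
Let lp3 : lin_poly p3.
Proof. by move=> a u v; rewrite /p3 !linearP /= mul_polyC. Qed.
Let lp4 : lin_poly p4.
Proof. by move=> a u v; rewrite /p4 !linearP /= mul_polyC. Qed.

Let lE0 : lin_poly E0. Proof. exact: lp0. Qed.
Let lE1 : lin_poly E1. Proof. exact: lin_poly_mul lp1. Qed.
Let lE2 : lin_poly E2. Proof. exact: lin_poly_mul lp2. Qed.
Let lE3 : lin_poly E3. Proof. exact: lin_poly_mul lp3. Qed.
Let lE4 : lin_poly E4. Proof. exact: lin_poly_mul lp4. Qed.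

(** The class of f(u) modulo W, as a vector. *)
Definition cond (W : {poly C}) k (f : 'rV[C]_dimV -> {poly C}) u : 'rV[C]_k :=
  poly_rV (f u %% W).

Lemma cond_linear (W : {poly C}) k f : lin_poly f -> linear (cond W k f).
Proof.
move=> lf a u v; rewrite /cond lf mul_polyC modpD modpZl.
by rewrite linearP.
Qed.

Lemma cond_eq0 (W : {poly C}) k f u : size W = k.+1 -> cond W k f u = 0 -> W %| f u.
Proof.
move=> sW c0; rewrite /dvdp; apply/eqP; rewrite -(@poly_rV_K _ k (f u %% W)).
  by rewrite -/(cond W k f u) c0 linear0.
by rewrite -ltnS -sW ltn_modp -size_poly_gt0 sW.
Qed.

Lemma row_mx_linear k l (f : 'rV[C]_dimV -> 'rV[C]_k) (g : 'rV[C]_dimV -> 'rV[C]_l) :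
  linear f -> linear g -> linear (fun u => row_mx (f u) (g u)).
Proof. by move=> lf lg a u v; rewrite lf lg scale_row_mx add_row_mx. Qed.

Lemma row_mx0E k l (A : 'rV[C]_k) (B : 'rV[C]_l) : row_mx A B = 0 -> A = 0 /\ B = 0.
Proof.
move=> AB; have := row_mxKl A B; have := row_mxKr A B.
by rewrite AB !linear0 => <- <-.
Qed.

(** At least three independent combinations of 1, ..., t^4 satisfy the integrality
    conditions everywhere: the coefficients form a space of dimension
    5 d + 5 - 10 zeta, and the conditions cost 7 xi + 3 upsilon. *)
Lemma lattice_sections : exists r (c0 c1 c2 c3 c4 : 'rV[C]_r -> {poly C}),
  [/\ (3 <= r)%N,
      [/\ lin_poly c0, lin_poly c1, lin_poly c2, lin_poly c3 & lin_poly c4],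
      forall w, [/\ (size (c0 w) <= d.+1)%N, (size (c1 w) <= (d - zeta).+1)%N,
        (size (c2 w) <= (d - 2 * zeta).+1)%N, (size (c3 w) <= (d - 3 * zeta).+1)%N &
        (size (c4 w) <= (d - 4 * zeta).+1)%N],
      forall w, at_X (c0 w) (Z * c1 w) (Z ^+ 2 * c2 w) (Z ^+ 3 * c3 w) (Z ^+ 4 * c4 w) /\
        at_Y (c0 w) (Z * c1 w) (Z ^+ 2 * c2 w) (Z ^+ 3 * c3 w) (Z ^+ 4 * c4 w) &
      forall w, c0 w = 0 -> c1 w = 0 -> c2 w = 0 -> c3 w = 0 -> c4 w = 0 -> w = 0].
Proof.
pose g0 u := G0 (E0 u); pose g1 u := G1 (E0 u) (E1 u).
pose g2 u := G2 (E0 u) (E1 u) (E2 u).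
pose g3 u := G3 (E0 u) (E1 u) (E2 u) (E3 u).
pose g4 u := G4 (E0 u) (E1 u) (E2 u) (E4 u).
pose f4 u := F4 (E0 u) (E1 u) (E2 u) (E3 u) (E4 u).
pose f3 u := F3 (E0 u) (E1 u) (E2 u) (E3 u) (E4 u).
pose f2 u := F2 (E0 u) (E1 u) (E2 u) (E3 u) (E4 u).
pose f1 u := F1 (E0 u) (E1 u) (E2 u) (E3 u) (E4 u).
pose f0 u := F0 (E0 u) (E1 u) (E2 u) (E3 u) (E4 u).
have L0 : lin_poly g0 by exact: lin_poly_mul.
have L1 : lin_poly g1 by apply/lin_poly_mul/lin_poly_sub => //; exact: lin_poly_mul.
have L2 : lin_poly g2.
  apply/lin_poly_mul/lin_poly_sub; last exact: lin_poly_mul.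
  exact: lin_poly_sub.
have L3 : lin_poly g3.
  apply/lin_poly_sub; last exact: lin_poly_mul.
  exact: lin_poly_sub.
have L4 : lin_poly g4 by exact: lin_poly_sub.
have M4 : lin_poly f4.
  apply/lin_poly_mul/lin_poly_add; last exact: lin_poly_mul.
  apply/lin_poly_add; last exact: lin_poly_mul.
  apply/lin_poly_add; last exact: lin_poly_mul.
  by apply/lin_poly_add => //; exact: lin_poly_mul.
have M3 : lin_poly f3 by exact: lin_poly_sub.
have M2 : lin_poly f2.
  by apply: lin_poly_sub; [apply: lin_poly_sub|apply: lin_poly_mul].
have M1 : lin_poly f1.
  apply: lin_poly_sub; last exact: lin_poly_mul.
  by apply: lin_poly_sub; [apply: lin_poly_sub|apply: lin_poly_mul].
have M0 : lin_poly f0.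
  apply: lin_poly_sub; last exact: lin_poly_mul.
  apply: lin_poly_add; last exact: lin_poly_mul.
  apply: lin_poly_sub; last exact: lin_poly_mul.
  by apply: lin_poly_add => //; apply: lin_poly_mul.
pose phi u := row_mx (cond (X ^+ 2) (2 * xi) g0 u) (row_mx (cond X xi g1 u)
  (row_mx (cond (X ^+ 2) (2 * xi) g3 u) (row_mx (cond (X ^+ 2) (2 * xi) g4 u)
  (row_mx (cond Y upsilon f0 u) (row_mx (cond Y upsilon f1 u) (cond Y upsilon f4 u)))))).
have lphi : linear phi by do !apply: row_mx_linear; exact: cond_linear.
(* three more unknowns than conditions; this is where deg h <= 2 is used *)
have dims : (2 * xi + (xi + (2 * xi + (2 * xi + (upsilon + (upsilon + upsilon))))) + 3 <= dimV)%N.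
  by move: xz yx eta2; clear=> *; lia.
have [r [B [r3 fB kB]]] := linear_kernel lphi dims.
have lmul : forall a (w w' : 'rV_r), (a *: w + w') *m B = a *: (w *m B) + w' *m B.
  by move=> a w w'; rewrite mulmxDl scalemxAl.
exists r, (fun w => p0 (w *m B)), (fun w => p1 (w *m B)), (fun w => p2 (w *m B)),
  (fun w => p3 (w *m B)), (fun w => p4 (w *m B)).
have sX2 : size (X ^+ 2) = (2 * xi).+1.
  by rewrite expr2 size_mul -?size_poly_gt0 sX // addSn addnS /= mul2n addnn.
split=> //.
- by split=> a w w'; rewrite lmul ?lp0 ?lp1 ?lp2 ?lp3 ?lp4.
- by move=> w; split; exact: size_poly.
- move=> w; have := kB w; set u := w *m B.
  move=> /row_mx0E[k0 /row_mx0E[k1 /row_mx0E[k3 /row_mx0E[k4 /row_mx0E[l0 /row_mx0E[l1 l4]]]]]].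
  split.
    exact: at_XP (cond_eq0 sX2 k0) (cond_eq0 sX k1) (cond_eq0 sX2 k3) (cond_eq0 sX2 k4).
  exact: at_YP (cond_eq0 sY l0) (cond_eq0 sY l1) (cond_eq0 sY l4).
- move=> w h0 h1 h2 h3 h4; have rV0 k (v : 'rV[C]_k) : rVpoly v = 0 -> v = 0.
    by move=> v0; apply: (can_inj rVpolyK); rewrite v0 linear0.
  have u0 : w *m B = 0.
    rewrite -[w *m B]hsubmxK (rV0 _ _ h0) -[rsubmx (w *m B)]hsubmxK (rV0 _ _ h1).
    rewrite -[rsubmx (rsubmx _)]hsubmxK (rV0 _ _ h2).
    rewrite -[rsubmx (rsubmx (rsubmx _))]hsubmxK (rV0 _ _ h3) (rV0 _ _ h4).
    by rewrite !row_mx0.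
  by apply/eqP; rewrite -(mulmx_free_eq0 _ fB) u0.
Qed.
End Lattice.

(** * Rational roots of the quintic *)

Lemma exists_irredp (F : fieldType) (p : {poly F}) : (1 < size p)%N ->
  exists2 q, irreducible_poly q & q %| p.
Proof.
move: {2}(size p) (leqnn (size p)) => n; elim: n p => [|n IH] p sp p1.
  by rewrite leqNgt (leq_trans _ p1) in sp.
have [irr|nirr] := pselect (irreducible_poly p); first by exists p.
have [q sq [qp nq]] : exists2 q : {poly F}, size q != 1%N & q %| p /\ ~~ (q %= p).
  apply: contrapT => H; apply: nirr; split=> // q sq qp.
  by apply: contrapT => nq; apply: H; exists q => //; split=> //; apply/negP.
have p0 : p != 0 by rewrite -size_poly_gt0 ltnW.
have q0 : q != 0 by apply: contraTneq qp => ->; rewrite dvd0p.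
have sq1 : (1 < size q)%N by rewrite ltn_neqAle eq_sym sq size_poly_gt0.
have sqp : (size q < size p)%N.
  rewrite ltn_neqAle dvdp_leq // andbT; apply: contra nq.
  by rewrite (dvdp_size_eqp qp).
have [r irr rq] := IH q (leq_trans sqp sp) sq1.
by exists r => //; apply: dvdp_trans qp.
Qed.

Lemma irredp_coprime (F : fieldType) (p q : {poly F}) :
  irreducible_poly p -> coprimep p q || (p %| q).
Proof.
case=> p1 irr; have [sg|sg] := eqVneq (size (gcdp p q)) 1%N.
  by rewrite coprimep_def sg.
have := irr _ sg (dvdp_gcdl p q); rewrite /eqp => /andP[_ h].
by rewrite (dvdp_trans h) ?dvdp_gcdr ?orbT.
Qed.

Lemma irredp_dvd_root (F : fieldType) (E : fieldExtType F) (p q : {poly F}) (r : E) :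
  irreducible_poly p -> root (map_poly (in_alg E) p) r ->
  root (map_poly (in_alg E) q) r -> p %| q.
Proof.
move=> irr rp rq; have /orP[cop|//] := irredp_coprime q irr.
have := coprimep_root _ rp; rewrite -(coprimep_map (in_alg E)) in cop.
by move=> /(_ _ cop); rewrite (eqP rq) eqxx.
Qed.

Section Quintic.
Variables (K : fieldType) (th : K).
Hypothesis nat_neq0 : forall n, n.+1%:R != 0 :> K.

(** The quintic of parameter th. *)
Definition quintic : {poly K} := 'X^3 * ('X^2 + 5%:R * 'X + 40%:R) - th%:P.

Lemma quinticE : quintic = 'X^5 + (5%:R *: 'X^4 + 40%:R *: 'X^3 - th%:P).
Proof. by rewrite /quintic -!mul_polyC !polyC_natr; ring. Qed.

Lemma horner_quintic (E : fieldType) (g : {rmorphism K -> E}) r :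
  (map_poly g quintic).[r] = r ^+ 3 * (r ^+ 2 + 5%:R * r + 40%:R) - g th.
Proof.
have mD p q : map_poly g (p + q) = map_poly g p + map_poly g q by exact: rmorphD.
have mN p : map_poly g (- p) = - map_poly g p by exact: rmorphN.
rewrite quinticE !(mD, mN) !map_polyZ !map_polyXn map_polyC /= !rmorph_nat.
by rewrite !(hornerD, hornerN, hornerZ, hornerXn, hornerC); ring.
Qed.

Lemma size_quintic_low : (size (5%:R *: 'X^4 + 40%:R *: 'X^3 - th%:P : {poly K})%R < 6)%N.
Proof.
rewrite ltnS; apply: size_subP.
  rewrite (leq_trans (size_polyD _ _)) // geq_max.
  by rewrite !(leq_trans (size_scale_leq _ _)) ?size_polyXn.
by rewrite (leq_trans (size_polyC_leq1 _)).
Qed.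

Lemma size_quintic : size quintic = 6%N.
Proof. by rewrite quinticE size_polyDl size_polyXn // size_quintic_low. Qed.

Lemma quintic_separable : th != 0 -> th != 1728%:R -> coprimep quintic quintic^`().
Proof.
(* t^2 k is the derivative up to a factor 5, and the quintic is (t - 3) k^2 + 1728 - th *)
move=> th0 th1; pose k : {poly K} := 'X^2 + 4%:R * 'X + 24%:R.
have dq : quintic^`() = 5%:R *: ('X^2 * k).
  rewrite quinticE !derivD derivN derivC subr0 !derivZ !derivXn /= /k -!mul_polyC.
  by rewrite !polyC_natr; ring.
rewrite dq coprimepZr ?nat_neq0 // coprimepMr coprimep_expr ?coprimepX; last first.
  rewrite rootE quinticE !(hornerD, hornerN, hornerZ, hornerXn, hornerC).
  by rewrite !expr0n /= !mulr0 !add0r oppr_eq0.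
have -> : quintic = (('X - 3%:R) * k) * k + (1728%:R - th)%:P.
  by rewrite /quintic /k polyCB !polyC_natr; ring.
rewrite coprimep_sym coprimep_addl_mul coprimep_sym.
rewrite (eqp_coprimepl _ (_ : _ %= 1)) ?coprime1p //.
by rewrite polyC_eqp1 subr_eq0 eq_sym.
Qed.
End Quintic.

(** A separable quintic without a root is irreducible, or the product of a
    quadratic and a cubic.  In the first case p1 = p2. *)
Lemma quintic_factor (K : fieldType) (p : {poly K}) : size p = 6%N ->
  coprimep p p^`() -> (forall a, ~~ root p a) ->
  exists p1 p2, [/\ irreducible_poly p1, irreducible_poly p2, p1 %| p, p2 %| p &
    forall G, p1 %| G -> p2 %| G -> p %| G].
Proof.
move=> sp cop nr; have p0 : p != 0 by rewrite -size_poly_gt0 sp.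
have [p1 irr1 d1] : exists2 q, irreducible_poly q & q %| p by apply: exists_irredp; rewrite sp.
have /dvdpP[Q E] := d1.
have Q0 : Q != 0 by apply: contraNneq p0 => Q0; rewrite E Q0 mul0r.
have q0 := irredp_neq0 irr1.
have sE : (size Q + size p1 = 7)%N.
  have := sp; rewrite E size_mul //; have := irr1.1.
  by move: (size Q) (size p1); clear=> *; lia.
have no2 (q : {poly K}) : q %| p -> size q != 2%N.
  move=> dq; apply/negP => /eqP/(@poly2_root _ _)[a ra].
  by have /negP[] := nr a; move: ra; rewrite -!dvdp_XsubCl => ra; apply: dvdp_trans dq.
have dQ : Q %| p by rewrite E dvdp_mulr.
have n1 := no2 _ d1; have nQ := no2 _ dQ.
have s1 := irr1.1; have sQ : (0 < size Q)%N by rewrite size_poly_gt0.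
have [sQ1|sQ1] := eqVneq (size Q) 1%N.
  exists p1, p1; split=> // G g _; rewrite E; have /size_poly1P[c c0 ->] := introT eqP sQ1.
  by rewrite mul_polyC dvdpZl.
have irrQ : irreducible_poly Q.
  have rQ a : ~~ root Q a by apply: contra (nr a) => ra; rewrite E rootM ra.
  apply: cubic_irreducible => //; move: (size Q) (size p1) sE n1 nQ s1 sQ sQ1; clear=> *; lia.
exists p1, Q; split=> // G g1 gQ; rewrite E mulrC Gauss_dvdp ?g1 //.
have := cop; rewrite E derivM coprimepMl => /andP[H _].
move: H; rewrite addrC [Q * _]mulrC coprimep_addl_mul coprimepMr.
by case/andP=> _; rewrite coprimep_sym.
Qed.

Lemma morph_expM (K E : fieldType) (g : {rmorphism K -> E}) (a b c : K) n :
  a = b ^+ n * c -> g a = g b ^+ n * g c.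
Proof. by move=> ->; rewrite rmorphM rmorphXn. Qed.

Lemma morph_expM2 (K E : fieldType) (g : {rmorphism K -> E}) (a b c : K) n m :
  a ^+ m = b * c ^+ n -> g a ^+ m = g b * g c ^+ n.
Proof. by move=> H; rewrite -!rmorphXn -rmorphM H. Qed.

Lemma morph_neq0 (K E : fieldType) (g : {rmorphism K -> E}) (a : K) : a != 0 -> g a != 0.
Proof. by rewrite fmorph_eq0. Qed.

Lemma exp_swap (K : fieldType) (a b u : K) N :
  u != 0 -> a = u ^+ N * b -> b = u^-1 ^+ N * a.
Proof. by move=> u0 ->; rewrite mulrA -exprMn mulVf // expr1n mul1r. Qed.

Section QuinticRoot.
Variables (C : numClosedFieldType) (X Y Z h : {poly C}) (xi upsilon zeta eta : nat).
Local Notation F := {fraction {poly C}}.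
Hypotheses (sX : size X = xi.+1) (sY : size Y = upsilon.+1) (sZ : size Z = zeta.+1).
Hypothesis xz : (3 * xi = 5 * zeta)%N.
Hypothesis yx : (2 * upsilon + eta = 3 * xi)%N.
Hypothesis eta2 : (eta <= 2)%N.
Hypothesis XYZ : X ^+ 3 - 1728%:R * Z ^+ 5 = Y ^+ 2 * h.
Hypothesis h0 : h != 0.
Hypothesis copXZ : coprimep X Z.
Local Notation d := (2 * xi + upsilon)%N.
Let X0 : X != 0. Proof. by rewrite -size_poly_gt0 sX. Qed.
Let Y0 : Y != 0. Proof. by rewrite -size_poly_gt0 sY. Qed.
Let Z0 : Z != 0. Proof. by rewrite -size_poly_gt0 sZ. Qed.
Local Notation t := (@tofrac {poly C}).
Let tX0 : t X != 0. Proof. by rewrite tofrac_eq0. Qed.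
Let tY0 : t Y != 0. Proof. by rewrite tofrac_eq0. Qed.
Let tZ0 : t Z != 0. Proof. by rewrite tofrac_eq0. Qed.

Lemma div_neq0 (K : fieldType) (a b : K) : a != 0 -> b != 0 -> a / b != 0.
Proof. by move=> a0 b0; rewrite mulf_neq0 ?invr_eq0. Qed.

Lemma div_neq (K : fieldType) (a b c : K) : b != 0 -> a - c * b != 0 -> a / b != c.
Proof. by move=> b0; apply: contraNneq => <-; rewrite divfK ?subrr. Qed.

(** The parameter X^3/Z^5. *)
Definition theta : F := t X ^+ 3 / t Z ^+ 5.

Lemma theta_neq0 : theta != 0.
Proof. exact: (div_neq0 (expf_neq0 3 tX0) (expf_neq0 5 tZ0)). Qed.

Lemma theta_neq1728 : theta != 1728%:R.
Proof.
apply: (div_neq (expf_neq0 5 tZ0)).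
have -> : t X ^+ 3 - 1728%:R * t Z ^+ 5 = t (Y ^+ 2 * h).
  by rewrite -XYZ tofracB tofracXn tofracM tofracXn tofracMn tofrac1.
by rewrite tofrac_eq0 mulf_neq0 // expf_neq0.
Qed.

Lemma F_nat_neq0 n : (n.+1%:R : F) != 0.
Proof. by rewrite -tofrac1 -tofracMn tofrac_eq0 -polyC_natr polyC_eq0 pnatr_eq0. Qed.

(** The element of C(u)[t] with numerators e0, ..., e4 and denominator X^2 Y. *)
Definition section_poly (e0 e1 e2 e3 e4 : {poly C}) : {poly F} :=
  (t (X ^+ 2 * Y))^-1 *: ((t e0)%:P + t e1 *: 'X + t e2 *: 'X^2 + t e3 *: 'X^3 + t e4 *: 'X^4).

Lemma horner_section (E : fieldExtType F) (r : E) e0 e1 e2 e3 e4 :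
  (map_poly (in_alg E) (section_poly e0 e1 e2 e3 e4)).[r] =
  quint_num (in_alg E \o t) r e0 e1 e2 e3 e4 / (in_alg E \o t) (X ^+ 2 * Y).
Proof.
have mD p q : map_poly (in_alg E) (p + q) = map_poly (in_alg E) p + map_poly (in_alg E) q.
  exact: rmorphD.
rewrite /section_poly map_polyZ hornerZ !mD !map_polyZ !map_polyXn map_polyX map_polyC.
rewrite !(hornerD, hornerZ, hornerXn, hornerX, hornerC) /quint_num.
by rewrite fmorphV mulrC.
Qed.

(** Modulo an irreducible factor of the quintic an everywhere integral element
    is a constant. *)
Lemma section_const (psi : {poly F}) (c0 c1 c2 c3 c4 : {poly C}) :
  irreducible_poly psi -> psi %| quintic theta ->
  [/\ (size c0 <= d.+1)%N, (size c1 <= (d - zeta).+1)%N,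
        (size c2 <= (d - 2 * zeta).+1)%N, (size c3 <= (d - 3 * zeta).+1)%N &
        (size c4 <= (d - 4 * zeta).+1)%N] ->
  at_X X c0 (Z * c1) (Z ^+ 2 * c2) (Z ^+ 3 * c3) (Z ^+ 4 * c4) ->
  at_Y Y c0 (Z * c1) (Z ^+ 2 * c2) (Z ^+ 3 * c3) (Z ^+ 4 * c4) ->
  exists c, psi %| section_poly c0 (Z * c1) (Z ^+ 2 * c2) (Z ^+ 3 * c3) (Z ^+ 4 * c4) - (cst c)%:P.
Proof.
move=> irr dpsi [s0 s1 s2 s3 s4] aX aY.
have [E _ [r rpsi _]] := irredp_FAdjoin irr.
pose j : {rmorphism {poly C} -> E} := in_alg E \o t.
pose jI : {rmorphism {poly C} -> E} := in_alg E \o @jinf C.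
pose v := in_alg E (t 'X)^-1.
have jrev N (p : {poly C}) : (size p <= N.+1)%N -> jI (revp N p) = v ^+ N * j p.
  move=> sp; have H := exp_swap (tofrac_X_neq0 C) (tofrac_rev sp).
  exact: (morph_expM (in_alg E) H).
have v0 : v != 0 by rewrite /v fmorph_eq0 invr_eq0 tofrac_X_neq0.
have jX0 : j X != 0 by exact: (morph_neq0 (in_alg E) tX0).
have jY0 : j Y != 0 by exact: (morph_neq0 (in_alg E) tY0).
have jZ0 : j Z != 0 by exact: (morph_neq0 (in_alg E) tZ0).
have rE : (r ^+ 3 * (r ^+ 2 + 5%:R * r + 40%:R)) * j Z ^+ 5 = j X ^+ 3.
  have : (map_poly (in_alg E) (quintic theta)).[r] = 0.
    have /dvdpP[q ->] := dpsi.
    by rewrite (_ : map_poly _ (q * psi) = map_poly (in_alg E) q * map_poly (in_alg E) psi)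
      ?rmorphM // hornerM (eqP rpsi) mulr0.
  rewrite horner_quintic => /eqP; rewrite subr_eq0 => /eqP ->.
  have H : t X ^+ 3 = theta * t Z ^+ 5 by apply: esym; exact: (divfK (expf_neq0 5 tZ0)).
  exact/esym/(morph_expM2 (in_alg E) H).
have zd := zeta_le_d xz yx eta2.
have atX : integralOver j (j Z ^+ 4 * (quint_num j r c0 (Z * c1) (Z ^+ 2 * c2) (Z ^+ 3 * c3) (Z ^+ 4 * c4) / j X ^+ 2)).
  by case: aX => g0 [g1 [g2 [g3 [g4 [E0 E1 E2 E3 E4]]]]]; apply: (int_at_X jX0 rE E0 E1 E2 E3 E4).
have atY : integralOver j (j Z ^+ 4 * (quint_num j r c0 (Z * c1) (Z ^+ 2 * c2) (Z ^+ 3 * c3) (Z ^+ 4 * c4) / j Y)).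
  by case: aY => g0 [g1 [g2 [g3 [g4 [E0 E1 E2 E3 E4]]]]]; apply: (int_at_Y XYZ jY0 rE E0 E1 E2 E3 E4).
have ifin : integralOver j (quint_num j r c0 (Z * c1) (Z ^+ 2 * c2) (Z ^+ 3 * c3)
    (Z ^+ 4 * c4) / j (X ^+ 2 * Y)) by eapply int_fin; eassumption.
have iinf : integralOver jI (quint_num j r c0 (Z * c1) (Z ^+ 2 * c2) (Z ^+ 3 * c3)
    (Z ^+ 4 * c4) / j (X ^+ 2 * Y)) by eapply int_inf; eassumption.
have [c ce] := integral_both_const ifin iinf.
exists c; apply: (irredp_dvd_root irr rpsi).
rewrite rootE (_ : map_poly _ (_ - _) = map_poly (in_alg E) (section_poly c0 (Z * c1) (Z ^+ 2 * c2) (Z ^+ 3 * c3) (Z ^+ 4 * c4)) - map_poly (in_alg E) (cst c)%:P); last exact: rmorphB.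
by rewrite hornerD hornerN map_polyC hornerC horner_section ce subrr.
Qed.

End QuinticRoot.

Section Quartic.
Variables (K : fieldType) (b : K).
(** The polynomials of degree at most 4, with a common factor b. *)
Definition quartic (x0 x1 x2 x3 x4 : K) : {poly K} :=
  b *: (x0%:P + x1 *: 'X + x2 *: 'X^2 + x3 *: 'X^3 + x4 *: 'X^4).

Lemma quartic_linear a x0 x1 x2 x3 x4 y0 y1 y2 y3 y4 :
  quartic (a * x0 + y0) (a * x1 + y1) (a * x2 + y2) (a * x3 + y3) (a * x4 + y4) =
  a%:P * quartic x0 x1 x2 x3 x4 + quartic y0 y1 y2 y3 y4.
Proof. by rewrite /quartic -!mul_polyC !polyCD !polyCM; ring. Qed.

Lemma size_quartic x0 x1 x2 x3 x4 : (size (quartic x0 x1 x2 x3 x4) <= 5)%N.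
Proof.
have sZ a n : (n <= 4)%N -> (size (a *: 'X^n : {poly K}) <= 5)%N.
  by move=> n4; rewrite (leq_trans (size_scale_leq _ _)) // size_polyXn ltnS.
have sD (p q : {poly K}) : (size p <= 5)%N -> (size q <= 5)%N -> (size (p + q)%R <= 5)%N.
  by move=> sp sq; rewrite (leq_trans (size_polyD _ _)) // geq_max sp.
rewrite (leq_trans (size_scale_leq _ _)) //; do 4 (apply: (sD _ _); last by [exact: sZ | exact: (sZ _ 1%N)]).
by rewrite (leq_trans (size_polyC_leq1 _)).
Qed.

Lemma quartic_eq0 x0 x1 x2 x3 x4 : b != 0 -> quartic x0 x1 x2 x3 x4 = 0 ->
  [/\ x0 = 0, x1 = 0, x2 = 0, x3 = 0 & x4 = 0].
Proof.
move=> b0 /eqP; rewrite /quartic -mul_polyC mulf_eq0 polyC_eq0 (negPf b0) /= => /eqP q0.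
have cE i := congr1 (fun p : {poly K} => p`_i) q0.
split; [move: (cE 0%N)|move: (cE 1%N)|move: (cE 2%N)|move: (cE 3%N)|move: (cE 4%N)];
  by rewrite !(coefD, coefZ, coefC, coefX, coefXn) /= !(mulr0, mulr1, addr0, add0r).
Qed.
End Quartic.

Lemma dvdp_small_const (K : fieldType) (p : {poly K}) (a : K) :
  (1 < size p)%N -> p %| a%:P -> a = 0.
Proof.
move=> sp d; apply/eqP; apply: contraTT d => a0; apply/negP => d.
by have := dvdp_leq _ d; rewrite polyC_eq0 a0 size_polyC a0 leqNgt sp => /(_ isT).
Qed.

(** Two linear forms have a common zero in dimension at least three. *)
Lemma two_forms_kernel (C : fieldType) r (k1 k2 : 'rV[C]_r -> C) : (3 <= r)%N ->
  scalar k1 -> scalar k2 -> exists2 w, w != 0 & k1 w = 0 /\ k2 w = 0.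
Proof.
move=> r3 l1 l2.
have L1 : linear (k1 : 'rV[C]_r -> C^o) by exact: l1.
have L2 : linear (k2 : 'rV[C]_r -> C^o) by exact: l2.
pose kk w : 'rV[C]_2 := \row_(i < 2) (if i == 0 then k1 w else k2 w).
have lk : linear kk.
  by move=> a u v; apply/rowP => i; rewrite !mxE; case: ifP => _; rewrite ?l1 ?l2.
pose kL : {linear 'rV[C]_r -> 'rV[C]_2} := HB.pack kk (GRing.isLinear.Build _ _ _ _ kk lk).
have : kermx (lin1_mx kL) != 0.
  rewrite -mxrank_eq0 mxrank_ker subn_eq0 -ltnNge.
  by rewrite (leq_ltn_trans (rank_leq_col _)).
case/rowV0Pn=> w /sub_kermxP wk w0; exists w => //.
have := mul_rV_lin1 kL w; rewrite wk => /rowP E.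
by have := E 0; have := E 1; rewrite !mxE /= => <- <-.
Qed.

Lemma linear_defect (R : comNzRingType) (a u v k1 k2 k3 : R) :
  k3 - (a * k1 + k2) = a * (u - k1) + (v - k2) - (a * u + v - k3).
Proof. by ring. Qed.

Section QuinticRootExists.
Variables (C : numClosedFieldType) (X Y Z h : {poly C}) (xi upsilon zeta eta : nat).
Local Notation F := {fraction {poly C}}.
Hypotheses (sX : size X = xi.+1) (sY : size Y = upsilon.+1) (sZ : size Z = zeta.+1).
Hypothesis xz : (3 * xi = 5 * zeta)%N.
Hypothesis yx : (2 * upsilon + eta = 3 * xi)%N.
Hypothesis eta2 : (eta <= 2)%N.
Hypothesis XYZ : X ^+ 3 - 1728%:R * Z ^+ 5 = Y ^+ 2 * h.
Hypothesis h0 : h != 0.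
Hypothesis copXZ : coprimep X Z.
Local Notation t := (@tofrac {poly C}).

Lemma section_polyE e0 e1 e2 e3 e4 : section_poly X Y e0 e1 e2 e3 e4 =
  quartic (t (X ^+ 2 * Y))^-1 (t e0) (t e1) (t e2) (t e3) (t e4).
Proof. by []. Qed.

Let tl (W : {poly C}) (a : C) u v : t (W * (a%:P * u + v)) = cst a * t (W * u) + t (W * v).
Proof. by rewrite /cst /= -tofracM -tofracD; congr tofrac; ring. Qed.

Let tl0 (a : C) u v : t (a%:P * u + v) = cst a * t u + t v.
Proof. by rewrite /cst /= -tofracM -tofracD. Qed.

Let cst_lin (x a y z : C) : (cst (x - (a * y + z)))%:P =
  (cst x)%:P - ((cst a)%:P * (cst y)%:P + (cst z)%:P).
Proof. by rewrite !(rmorphB, rmorphD) /= rmorphM polyCM. Qed.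

(** The quintic has a root in C(u).  Otherwise the constants of
    [section_const], for its one or two irreducible factors, are linear forms
    on the space of [lattice_sections], and a common zero yields a nonzero
    polynomial of degree at most 4 divisible by the quintic. *)
Lemma quintic_root : exists f : F,
  f ^+ 3 * (f ^+ 2 + 5%:R * f + 40%:R) * t Z ^+ 5 = t X ^+ 3.
Proof.
have X0 : X != 0 by rewrite -size_poly_gt0 sX.
have Y0 : Y != 0 by rewrite -size_poly_gt0 sY.
have Z0 : Z != 0 by rewrite -size_poly_gt0 sZ.
have tXY0 : (t (X ^+ 2 * Y))^-1 != 0.
  by rewrite invr_eq0 tofrac_eq0 mulf_neq0 // expf_neq0.
have tZ0 : t Z != 0 by rewrite tofrac_eq0.
apply: contrapT => no; pose th := theta X Z.
have nr a : ~~ root (quintic th) a.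
  apply/negP => /eqP ra; apply: no; exists a.
  have := horner_quintic th idfun a; rewrite map_poly_id ?ra // => /esym/eqP.
  by rewrite subr_eq0 => /eqP ->; exact: (divfK (expf_neq0 5 tZ0)).
have sep := quintic_separable (@F_nat_neq0 C) (theta_neq0 sX sZ) (theta_neq1728 sY sZ XYZ h0).
have [p1 [p2 [irr1 irr2 d1 d2 all12]]] := quintic_factor (size_quintic th) sep nr.
have [r [c0 [c1 [c2 [c3 [c4 [r3 [l0 l1 l2 l3 l4] sc at12 inj]]]]]]] :=
  lattice_sections Z sX sY xz yx eta2.
pose S w := section_poly X Y (c0 w) (Z * c1 w) (Z ^+ 2 * c2 w) (Z ^+ 3 * c3 w) (Z ^+ 4 * c4 w).
have lS a u v : S (a *: u + v) = (cst a)%:P * S u + S v.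
  rewrite /S !section_polyE l0 l1 l2 l3 l4 (tl0 a (c0 u)) (tl Z a (c1 u)).
  rewrite (tl (Z ^+ 2) a (c2 u)) (tl (Z ^+ 3) a (c3 u)) (tl (Z ^+ 4) a (c4 u)).
  exact: quartic_linear.
have ex p : irreducible_poly p -> p %| quintic th ->
    exists k : 'rV[C]_r -> C, forall w, p %| S w - (cst (k w))%:P.
  move=> irr dp; have /choice[k kP] w : exists c : C, p %| S w - (cst c)%:P.
    have [aX aY] := at12 w.
    exact: (section_const sX sY sZ xz yx eta2 XYZ copXZ irr dp (sc w) aX aY).
  by exists k.
have lk p k : irreducible_poly p -> (forall w, p %| S w - (cst (k w))%:P) -> scalar k.
  move=> irr dk a u v; apply/eqP; rewrite -subr_eq0; apply/eqP.
  suff H : p %| (cst (k (a *: u + v) - (a * k u + k v)))%:P.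
    by apply: (fmorph_inj (@cst C)); rewrite rmorph0; apply: dvdp_small_const H; exact: irr.1.
  have -> : (cst (k (a *: u + v) - (a * k u + k v)))%:P =
     (cst a)%:P * (S u - (cst (k u))%:P) + (S v - (cst (k v))%:P) -
       (S (a *: u + v) - (cst (k (a *: u + v)))%:P).
    by rewrite lS cst_lin; exact: linear_defect.
  exact: (dvdp_sub (dvdp_add (dvdp_mull _ (dk u)) (dk v)) (dk _)).
have [k1 k1P] := ex _ irr1 d1; have [k2 k2P] := ex _ irr2 d2.
have [w w0 [k10 k20]] := two_forms_kernel r3 (lk _ _ irr1 k1P) (lk _ _ irr2 k2P).
have Sw : quintic th %| S w.
  apply: all12; [have := k1P w; rewrite k10|have := k2P w; rewrite k20];
  by rewrite [cst 0]rmorph0 subr0.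
have S0 : S w = 0.
  apply/eqP; apply: contraTT Sw => S0; apply/negP => /(dvdp_leq S0).
  by rewrite size_quintic leqNgt ltnS /S section_polyE size_quartic.
have [] := quartic_eq0 tXY0 S0.
have t0 W (p : {poly C}) : W != 0 -> t (W * p) = 0 -> p = 0.
  by move=> W0 /eqP; rewrite tofrac_eq0 mulf_eq0 (negPf W0) => /eqP.
rewrite -[c0 w]mul1r => /(t0 _ _ (oner_neq0 _)) e0 /(t0 _ _ Z0) e1.
move=> /(t0 _ _ (expf_neq0 2 Z0)) e2 /(t0 _ _ (expf_neq0 3 Z0)) e3 /(t0 _ _ (expf_neq0 4 Z0)) e4.
by move/eqP: w0; apply; apply: inj.
Qed.
End QuinticRootExists.

(** * The icosahedral case *)

Lemma quintic_hom (K : fieldType) (f g h z x : K) : h != 0 -> f = g / h ->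
  f ^+ 3 * (f ^+ 2 + 5%:R * f + 40%:R) * z ^+ 5 = x ^+ 3 ->
  g ^+ 3 * (g ^+ 2 + 5%:R * (g * h) + 40%:R * h ^+ 2) * z ^+ 5 = x ^+ 3 * h ^+ 5.
Proof. by move=> h0 -> <-; field. Qed.

Lemma quintic_dehom (K : fieldType) (g h z x : K) : h != 0 ->
  g ^+ 3 * (g ^+ 2 + 5%:R * (g * h) + 40%:R * h ^+ 2) * z ^+ 5 = x ^+ 3 * h ^+ 5 ->
  (g / h) ^+ 3 * ((g / h) ^+ 2 + 5%:R * (g / h) + 40%:R) * z ^+ 5 = x ^+ 3.
Proof.
move=> h0 E; apply: (mulIf (expf_neq0 5 h0)); rewrite -E.
by field.
Qed.

Lemma quintic_morph (R S : comNzRingType) (j : {rmorphism R -> S}) g h z x :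
  (j (g ^+ 3 * (g ^+ 2 + 5%:R * (g * h) + 40%:R * h ^+ 2) * z ^+ 5) =
   j g ^+ 3 * (j g ^+ 2 + 5%:R * (j g * j h) + 40%:R * j h ^+ 2) * j z ^+ 5) /\
  (j (x ^+ 3 * h ^+ 5) = j x ^+ 3 * j h ^+ 5).
Proof.
have jM a b : j (a * b) = j a * j b by exact: rmorphM.
have jD a b : j (a + b) = j a + j b by exact: rmorphD.
have jX a n : j (a ^+ n) = j a ^+ n by exact: rmorphXn.
have jn n a : j (n%:R * a) = n%:R * j a by rewrite jM rmorph_nat.
split; last by rewrite jM !jX.
by rewrite jM jX jM jX jD jD jX !jn jX jM.
Qed.

Lemma quintic_root_poly (C : numClosedFieldType) (X Y Z h : {poly C})
    (xi upsilon zeta eta : nat) :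
  size X = xi.+1 -> size Y = upsilon.+1 -> size Z = zeta.+1 ->
  (3 * xi = 5 * zeta)%N -> (2 * upsilon + eta = 3 * xi)%N -> (eta <= 2)%N ->
  X ^+ 3 - 1728%:R * Z ^+ 5 = Y ^+ 2 * h -> h != 0 -> coprimep X Z ->
  exists G H : {poly C}, H != 0 /\
    G ^+ 3 * (G ^+ 2 + 5%:R * (G * H) + 40%:R * H ^+ 2) * Z ^+ 5 = X ^+ 3 * H ^+ 5.
Proof.
move=> sX sY sZ xz yx e2 E h0 cop.
have [f fE] := quintic_root sX sY sZ xz yx e2 E h0 cop.
have [G [H [H0 fGH]]] := tofrac_fracP f.
exists G, H; split=> //.
have tH0 : tofrac H != 0 by rewrite tofrac_eq0.
have eqf := quintic_hom tH0 fGH fE.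
have [j1 j2] := quintic_morph (@tofrac {poly C}) G H Z X.
apply/eqP; rewrite -subr_eq0; apply/eqP/tofrac_inj.
by rewrite tofracB j1 j2 eqf subrr.
Qed.

Lemma size_monic_pow (C : fieldType) (p q : {poly C}) l m : (0 < l)%N -> q \is monic ->
  p = q ^+ l -> size p = m.+1 -> exists2 k, size q = k.+1 & m = (l * k)%N.
Proof.
move=> l0 mq E sp; exists (size q).-1.
  by rewrite prednK // size_poly_gt0 monic_neq0.
by have := size_exp q l; rewrite -E sp /= mulnC.
Qed.

Section IcosaPoint.
Variables (C : numClosedFieldType) (T : fieldType) (iota : {rmorphism C -> T}).
Local Notation ev := (ev iota).
Variables (x tau : T) (A B : {poly C}) (m : nat) (a b c s t : C).
Hypotheses (tx : transc iota x) (cAB : cover A B m) (hA : ev x A = tau * ev x B).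
Hypotheses (ab : a != b) (ac : a != c) (bc : b != c).
Hypothesis sE : s ^+ 3 = (c - a) / (c - b).
Hypothesis tE : 1728%:R * t ^+ 5 = (b - a) / (c - b).

(** The constants s and t bring the relation between the three fibres into the
    form (s X)^3 - 1728 (t Z)^5 = Y^2 h. *)
Lemma icosa_root : (ndvd 2 (fibm A B a) <= 2)%N ->
  all (dvdn 3) (fibm A B b) -> all (dvdn 5) (fibm A B c) ->
  exists G H : {poly C}, let w := ev x G / ev x H in [/\ ev x H != 0 &
    w ^+ 3 * (w ^+ 2 + 5%:R * w + 40%:R) * (iota (t ^+ 5) * (tau - iota c)) =
    iota (s ^+ 3) * (tau - iota b)].
Proof.
move=> da db dc.
have ba0 : b - a != 0 by rewrite subr_eq0 eq_sym.
have ca0 : c - a != 0 by rewrite subr_eq0 eq_sym.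
have cb0 : c - b != 0 by rewrite subr_eq0 eq_sym.
have s0 : s != 0.
  by apply/negP => /eqP s0; move: sE; rewrite s0 expr0n /= => /esym/eqP; rewrite mulf_eq0 invr_eq0 (negPf ca0) (negPf cb0).
have t0 : t != 0.
  by apply/negP => /eqP t0; move: tE; rewrite t0 expr0n /= mulr0 => /esym/eqP; rewrite mulf_eq0 invr_eq0 (negPf ba0) (negPf cb0).
have [Y [S [mY uS sS EA]]] := monic_odd (cover_monic cAB a).
rewrite -/(fib A B a) -/(fibm A B a) in sS.
have [X mX EB] := monic_power (cover_monic cAB b) db.
have [Z mZ EC] := monic_power (cover_monic cAB c) dc.
pose h := \prod_(z <- S) ('X - z%:P).
have mh : h \is monic by exact: monic_prod_XsubC.
have sh : size h = (size S).+1 by rewrite size_prod_XsubC.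
have [xi sX mX3] := size_monic_pow (isT : 0 < 3)%N mX EB (cover_size cAB b).
have [zeta sZ mZ5] := size_monic_pow (isT : 0 < 5)%N mZ EC (cover_size cAB c).
have [ups sY mY2] : exists2 k, size Y = k.+1 & m = (2 * k + size S)%N.
  exists (size Y).-1; first by rewrite prednK // size_poly_gt0 monic_neq0.
  have Y20 : Y ^+ 2 != 0 by rewrite expf_neq0 // monic_neq0.
  have := cover_size cAB a; rewrite EA -/h size_mul ?(monic_neq0 mh) // sh addnS /=.
  rewrite -(prednK (_ : 0 < size (Y ^+ 2))%N) ?size_poly_gt0 // size_exp.
  by move=> [<-]; rewrite mulnC.
have XYZ : (s *: X) ^+ 3 - 1728%:R * (t *: Z) ^+ 5 = Y ^+ 2 * h.
  rewrite -EA !exprZn -EB -EC sE -polyC_natr mul_polyC scalerA tE.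
  apply: (@scalerI _ _ (c - b)) => //; rewrite scalerBr !scalerA.
  have dE z : (c - b) * (z / (c - b)) = z by rewrite mulrCA mulfV ?mulr1.
  by rewrite !dE -!mul_polyC !polyCB; ring.
have cop : coprimep (s *: X) (t *: Z).
  rewrite coprimepZl // coprimepZr //; apply: coprimep_closed => [|r rX]; first exact: monic_neq0.
  apply/negP => rZ; apply: (fib_disjoint cAB bc (p := r)).
    by rewrite EB rootE horner_exp (eqP rX) expr0n.
  by rewrite EC rootE horner_exp (eqP rZ) expr0n.
have [|||||||G [H [H0 GH]]] := @quintic_root_poly C (s *: X) Y (t *: Z) h xi ups zeta (size S) _ _ _ _ _ _ XYZ _ cop.
- by rewrite size_scale.
- by [].
- by rewrite size_scale.
- by rewrite -mX3 -mZ5.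
- by rewrite -mY2 -mX3.
- by rewrite sS.
- exact: monic_neq0.
have hx0 : ev x H != 0 by exact: transc_neq0.
exists G, H; split=> //.
have [j1 j2] := quintic_morph (ev x) G H (t *: Z) (s *: X).
have := congr1 (ev x) GH; rewrite j1 j2 => /(quintic_dehom hx0) /=.
rewrite !evZ !exprMn -!rmorphXn /= -EB -EC !(point_fibre hA).
have B0 := point_B_neq0 tx cAB.
set w := _ / _ => E; apply: (mulIf B0); rewrite -[RHS]mulrA -E; ring.
Qed.
End IcosaPoint.

Section IcosaPair.
Variables (C : numClosedFieldType) (T : fieldType) (iota : {rmorphism C -> T}).
Local Notation ev := (ev iota).
Local Notation ev2 := (ev2 iota).
Variables (x y tau : T) (A1 B1 A2 B2 : {poly C}) (m n : nat).
Hypotheses (tx : transc iota x) (ty : transc iota y).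
Hypotheses (c1 : cover A1 B1 m) (c2 : cover A2 B2 n).
Hypotheses (h1 : ev x A1 = tau * ev x B1) (h2 : ev y A2 = tau * ev y B2).
Hypothesis hdeg : forall d (P Q : {poly C}) w (p q : {poly C}) (H : {poly {poly C}}),
  coprimep P Q -> maxn (size P) (size Q) = d.+1 ->
  ev y q != 0 -> w = ev y p / ev y q -> ev w P = tau * ev w Q ->
  (size H <= d)%N -> ev2 x w H = 0 -> H = 0.

Let pol5 : {poly C} := 'X^5 + (5%:R *: 'X^4 + 40%:R *: 'X^3).

Let size_low : (size (5%:R *: 'X^4 + 40%:R *: 'X^3 : {poly C})%R < 6)%N.
Proof.
rewrite ltnS (leq_trans (size_polyD _ _)) // geq_max.
by rewrite !(leq_trans (size_scale_leq _ _)) ?size_polyXn.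
Qed.

Let size_pol5 : size pol5 = 6%N.
Proof. by rewrite size_polyDl size_polyXn // size_low. Qed.

Let ev_pol5 w : ev w pol5 = w ^+ 3 * (w ^+ 2 + 5%:R * w + 40%:R).
Proof.
have evD (p q : {poly C}) : ev w (p + q) = ev w p + ev w q by exact: rmorphD.
have evXn i : ev w 'X^i = w ^+ i by rewrite rmorphXn /= evX.
by rewrite /pol5 !evD !evZ !evXn !rmorph_nat; ring.
Qed.

Let quart (k4 k3 k2 k1 k0 : {poly C}) : {poly {poly C}} :=
  k4 *: 'X^4 + (k3 *: 'X^3 + (k2 *: 'X^2 + (k1 *: 'X + k0%:P))).

Let size_quart k4 k3 k2 k1 k0 : (size (quart k4 k3 k2 k1 k0) <= 5)%N.
Proof.
have sD (p q : {poly {poly C}}) : (size p <= 5)%N -> (size q <= 5)%N -> (size (p + q)%R <= 5)%N.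
  by move=> sp sq; rewrite (leq_trans (size_polyD _ _)) // geq_max sp.
have sZ a n' : (n' <= 4)%N -> (size (a *: 'X^n' : {poly {poly C}}) <= 5)%N.
  by move=> n4; rewrite (leq_trans (size_scale_leq _ _)) // size_polyXn ltnS.
do 4 (apply: (sD _ _); first by [exact: sZ | exact: (sZ _ 1%N)]).
by rewrite (leq_trans (size_polyC_leq1 _)).
Qed.

Let quart4 k4 k3 k2 k1 k0 : (quart k4 k3 k2 k1 k0)`_4 = k4.
Proof. by rewrite /quart !coefD !coefZ !coefXn coefX coefC /= !mulr0 mulr1 !addr0. Qed.

Let ev2_quart w k4 k3 k2 k1 k0 : ev2 x w (quart k4 k3 k2 k1 k0) =
  ev x k4 * w ^+ 4 + (ev x k3 * w ^+ 3 + (ev x k2 * w ^+ 2 + (ev x k1 * w + ev x k0))).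
Proof.
have evD (p q : {poly {poly C}}) : ev2 x w (p + q) = ev2 x w p + ev2 x w q by exact: rmorphD.
have evXn i : ev2 x w 'X^i = w ^+ i by rewrite rmorphXn /= ev2X.
by rewrite /quart !evD !ev2Z !evXn ev2X ev2C.
Qed.

Lemma no_icosahedral a b c : uniq [:: a; b; c] ->
  ~ icosahedral (fibm A1 B1 a) (fibm A2 B2 a) (fibm A1 B1 b) (fibm A2 B2 b)
      (fibm A1 B1 c) (fibm A2 B2 c).
Proof.
rewrite /= !inE negb_or => /and3P[/andP[ab ac] bc _] [da1 [da2 db1 db2 dc1 dc2]].
have cb0 : c - b != 0 by rewrite subr_eq0 eq_sym.
have ca0 : c - a != 0 by rewrite subr_eq0 eq_sym.
have ba0 : b - a != 0 by rewrite subr_eq0 eq_sym.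
have [s sE] := root_exists ((c - a) / (c - b)) (isT : 0 < 3)%N.
have [t tE'] := root_exists ((b - a) / (c - b) / 1728%:R) (isT : 0 < 5)%N.
have n0 : 1728%:R != 0 :> C by rewrite pnatr_eq0.
have tE : 1728%:R * t ^+ 5 = (b - a) / (c - b) by rewrite tE' mulrC divfK.
have s30 : s ^+ 3 != 0 by rewrite sE mulf_neq0 ?invr_eq0.
have t50 : t ^+ 5 != 0 by rewrite tE' !mulf_neq0 ?invr_eq0.
have [G1 [H1 [hx0 E1]]] := icosa_root tx c1 h1 ab ac bc sE tE da1 db1 dc1.
have da2' : (ndvd 2 (fibm A2 B2 a) <= 2)%N.
  by have := ndvd0 2 (fibm A2 B2 a); rewrite da2 => /eqP ->.
have [G2 [H2 [hy0 E2]]] := icosa_root ty c2 h2 ab ac bc sE tE da2' db2 dc2.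
set w1 := ev x G1 / ev x H1 in E1; set w2 := ev y G2 / ev y H2 in E2.
have tc0 := point_neq tx c1 h1 c.
have p12 : w2 ^+ 3 * (w2 ^+ 2 + 5%:R * w2 + 40%:R) = w1 ^+ 3 * (w1 ^+ 2 + 5%:R * w1 + 40%:R).
  have tt0 : iota (t ^+ 5) * (tau - iota c) != 0 by rewrite mulf_neq0 ?fmorph_eq0.
  by apply: (mulIf tt0); rewrite E1 E2.
have H10 : H1 != 0 by apply: contraNneq hx0 => ->; rewrite rmorph0.
(* tau has degree 5 in w2 *)
have final (H : {poly {poly C}}) : (size H <= 5)%N -> ev2 x w2 H = 0 -> H = 0.
  apply: (hdeg (d := 5) (P := (c * t ^+ 5) *: pol5 - (s ^+ 3 * b)%:P)
     (Q := t ^+ 5 *: pol5 - (s ^+ 3)%:P) (w := w2) _ _ hy0 erefl).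
  - apply: (@coprimep_comb _ _ _ 1 (- c%:P) (s ^+ 3 * (c - b))).
      by rewrite mulf_neq0.
    by rewrite -!mul_polyC !polyCM !polyCB; ring.
  - have -> : size (t ^+ 5 *: pol5 - (s ^+ 3)%:P) = 6%N.
      rewrite size_polyDl size_scale ?size_pol5 // size_polyN.
      by rewrite (leq_ltn_trans (size_polyC_leq1 _)).
    apply/maxn_idPr/size_subP; last by rewrite (leq_trans (size_polyC_leq1 _)).
    by apply: size_scaleP; rewrite size_pol5.
  - have evB (p q : {poly C}) : ev w2 (p - q) = ev w2 p - ev w2 q by exact: rmorphB.
    rewrite !evB !evZ !evC ev_pol5 (rmorphM iota c) (rmorphM iota (s ^+ 3) b).
    apply/eqP; rewrite -subr_eq0; set W := _ ^+ 3 * _ in E2 *.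
    have -> : iota c * iota (t ^+ 5) * W - iota (s ^+ 3) * iota b -
       tau * (iota (t ^+ 5) * W - iota (s ^+ 3)) =
       iota (s ^+ 3) * (tau - iota b) - W * (iota (t ^+ 5) * (tau - iota c)) by ring.
    by rewrite E2 subrr.
have [w12|w12] := eqVneq w2 w1.
  have /final : (size (H1 *: 'X - G1%:P)%R <= 5)%N.
    apply: size_subP; first by rewrite (leq_trans (size_scale_leq _ _)) ?size_polyX.
    by rewrite (leq_trans (size_polyC_leq1 _)).
  rewrite ev2B ev2Z ev2X ev2C w12 /w1 mulrC divfK // subrr => /(_ erefl).
  move=> /(congr1 (fun p : {poly {poly C}} => p`_1)); rewrite coefB coefZ coefX coefC coef0 /=.
  by rewrite mulr1 subr0 => /eqP; rewrite (negPf H10).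
(* the quartic (p(W) - p(w1))/(W - w1), with w1 = g/h, times h^4 *)
pose g := G1; pose h := H1.
have := final (quart (h ^+ 4) (h ^+ 3 * g + h ^+ 4 *+ 5)
  (h ^+ 2 * g ^+ 2 + (h ^+ 3 * g) *+ 5 + h ^+ 4 *+ 40)
  (h * g ^+ 3 + (h ^+ 2 * g ^+ 2) *+ 5 + (h ^+ 3 * g) *+ 40)
  (g ^+ 4 + (h * g ^+ 3) *+ 5 + (h ^+ 2 * g ^+ 2) *+ 40)) (size_quart _ _ _ _ _).
rewrite ev2_quart.
have evD (p q : {poly C}) : ev x (p + q) = ev x p + ev x q by exact: rmorphD.
have evX2 (p : {poly C}) i : ev x (p ^+ i) = ev x p ^+ i by exact: rmorphXn.
have evM (p q : {poly C}) i j : ev x (p ^+ i * q ^+ j) = ev x p ^+ i * ev x q ^+ j.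
  by rewrite rmorphM !rmorphXn.
have evMn (p : {poly C}) i : ev x (p *+ i) = ev x p *+ i by exact: rmorphMn.
rewrite !(evD, evMn).
rewrite (evX2 h) (evM h g 3 1%N) (evM h g 2 2) (evM h g 1%N 3) (evX2 g).
move=> Hq; have /(congr1 (fun p : {poly {poly C}} => p`_4)) : 
  quart (h ^+ 4) (h ^+ 3 * g + h ^+ 4 *+ 5)
  (h ^+ 2 * g ^+ 2 + (h ^+ 3 * g) *+ 5 + h ^+ 4 *+ 40)
  (h * g ^+ 3 + (h ^+ 2 * g ^+ 2) *+ 5 + (h ^+ 3 * g) *+ 40)
  (g ^+ 4 + (h * g ^+ 3) *+ 5 + (h ^+ 2 * g ^+ 2) *+ 40) = 0.
  apply: Hq.
  have gE : ev x g = w1 * ev x h by rewrite /w1 divfK.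
  have d0 : w2 - w1 != 0 by rewrite subr_eq0.
  apply: (mulfI d0); rewrite mulr0 gE.
  transitivity (ev x h ^+ 4 * (w2 ^+ 3 * (w2 ^+ 2 + 5%:R * w2 + 40%:R) -
     w1 ^+ 3 * (w1 ^+ 2 + 5%:R * w1 + 40%:R))); first by ring.
  by rewrite p12 subrr mulr0.
by rewrite quart4 coef0 => /eqP; rewrite expf_eq0 (negPf H10).
Qed.
End IcosaPair.

(** * At most four branch values *)

Lemma transc_cover (C : numClosedFieldType) (T : fieldType) (iota : {rmorphism C -> T})
  z x (U V : {poly C}) k : transc iota z -> cover U V k ->
  ev iota z U = x * ev iota z V -> transc iota x.
Proof.
move=> tz cUV h p px; apply/eqP; apply: contraT => p0.
have [c xE] := alg_const p0 px.
have := tz (U - c *: V); rewrite rmorphB /= evZ h xE subrr => /(_ erefl)/eqP.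
by rewrite (negPf (cover_neq0 cUV c)).
Qed.

Section KeyProposition.
Variables (C : numClosedFieldType) (T : fieldType) (iota : {rmorphism C -> T}).
Local Notation ev := (ev iota).
Local Notation ev2 := (ev2 iota).
Variables (z x y tau : T) (m n : nat) (A1 B1 A2 B2 Ux Vx Uy Vy : {poly C}).
Hypotheses (tz : transc iota z).
Hypotheses (c1 : cover A1 B1 m) (c2 : cover A2 B2 n).
Hypotheses (cx : cover Ux Vx n) (cy : cover Uy Vy m).
Hypotheses (hx : ev z Ux = x * ev z Vx) (hy : ev z Uy = y * ev z Vy).
Hypotheses (h1 : ev x A1 = tau * ev x B1) (h2 : ev y A2 = tau * ev y B2).
Hypothesis sepB : coprimep B1 B1^`().
Hypothesis hdeg : forall d (P Q : {poly C}) w (p q : {poly C}) (H : {poly {poly C}}),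
  coprimep P Q -> maxn (size P) (size Q) = d.+1 ->
  ev y q != 0 -> w = ev y p / ev y q -> ev w P = tau * ev w Q ->
  (size H <= d)%N -> ev2 x w H = 0 -> H = 0.

Theorem branch_values_le4 : (m <= n)%N -> (size (branch_values A1 B1) <= 4)%N.
Proof.
move=> mn; have tx := transc_cover tz cx hx; have ty := transc_cover tz cy hy.
have hD (H : {poly {poly C}}) : (size H <= n)%N -> ev2 x y H = 0 -> H = 0.
  have [_ sA sB n0 cop] := c2.
  apply: (hdeg (d := n) (p := 'X) (q := 1) cop _ _ _ h2).
  - by rewrite sA sB; apply/maxn_idPl.
  - by rewrite rmorph1 oner_neq0.
  - by rewrite rmorph1 evX divr1.
rewrite leqNgt; apply/negP => B5.
have uB : uniq (branch_values A1 B1) by exact: undup_uniq.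
have he : {in branch_values A1 B1, forall c,
    all (leq 1) (fibm A1 B1 c) /\ (\sum_(i <- fibm A1 B1 c) i = m)%N}.
  by move=> c _; split; [exact: fibm_gt0|exact: sum_fibm c1 c].
have hf : {in branch_values A1 B1, forall c,
    all (leq 1) (fibm A2 B2 c) /\ (\sum_(i <- fibm A2 B2 c) i = n)%N}.
  by move=> c _; split; [exact: fibm_gt0|exact: sum_fibm c2 c].
have hb c : c \in branch_values A1 B1 -> has (leq 2) (fibm A1 B1 c).
  by move=> cb; have := branch_mem c1 sepB cb.
have [a [b [c [_ u3 out]]]] := fibre_numerics uB B5 mn he hf hb (cover_RH c1 sepB)
  (cover_RH_le c2 uB) (fibcost_le tz c1 c2 cx cy hx hy h1 h2 hD uB).
case: out => [[l pl H]|oct|ico].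
- move: (u3); rewrite /= !inE negb_or => /and3P[/andP[ab ac] bc _].
  by case: H; apply: (no_kummer tx ty c1 c2 h1 h2 hdeg (prime_gt1 pl)).
- exact: (no_octahedral tx ty c1 c2 h1 h2 hdeg u3 oct).
- exact: (no_icosahedral tx ty c1 c2 h1 h2 hdeg u3 ico).
Qed.
End KeyProposition.

(** * Rational subfields and degrees *)

Section Rational.
Variables (C : numClosedFieldType) (T : fieldType) (iota : {rmorphism C -> T}).
Local Notation ev := (ev iota).
Local Notation ev2 := (ev2 iota).

(** The element e belongs to the subfield C(x) of T. *)
Definition ratl (x e : T) := exists p q, ev x q != 0 /\ e = ev x p / ev x q.

Lemma ratl_ev x p : ratl x (ev x p).
Proof. by exists p, 1; rewrite rmorph1 divr1 oner_neq0. Qed.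
Lemma ratl_const x c : ratl x (iota c).
Proof. by rewrite -(evC iota x); exact: ratl_ev. Qed.
Lemma ratl_id x : ratl x x.
Proof. by have := ratl_ev x 'X; rewrite evX. Qed.
Lemma ratlD x a b : ratl x a -> ratl x b -> ratl x (a + b).
Proof.
move=> [p [q [q0 ->]]] [p' [q' [q0' ->]]].
exists (p * q' + p' * q), (q * q'); rewrite rmorphD !rmorphM /=; split; last by field; rewrite q0 q0'.
by rewrite mulf_neq0.
Qed.
Lemma ratlM x a b : ratl x a -> ratl x b -> ratl x (a * b).
Proof.
move=> [p [q [q0 ->]]] [p' [q' [q0' ->]]].
exists (p * p'), (q * q'); rewrite !rmorphM /=; split; last by field; rewrite q0 q0'.
by rewrite mulf_neq0.
Qed.
Lemma ratlV x a : ratl x a -> ratl x a^-1.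
Proof.
move=> [p [q [q0 ->]]]; have [p0|p0] := eqVneq (ev x p) 0.
  by rewrite p0 mul0r invr0 -(rmorph0 (ev x)); exact: ratl_ev.
by exists q, p; rewrite invf_div.
Qed.
Lemma ratl_sub x y a : ratl x y -> ratl y a -> ratl x a.
Proof.
move=> xy [p [q [_ ->]]].
suff H r : ratl x (ev y r) by apply: ratlM => //; exact: ratlV.
elim/poly_ind: r => [|r c IH]; first by rewrite rmorph0 -(rmorph0 (ev x)); exact: ratl_ev.
rewrite rmorphD rmorphM /= evX evC; apply: ratlD; last exact: ratl_const.
exact: ratlM.
Qed.

Lemma ratl_coprime x e : transc iota x -> ratl x e ->
  exists p q, [/\ q != 0, coprimep p q & ev x p = e * ev x q].
Proof.
move=> tx [p [q [q0 ->]]]; have q0' : q != 0 by apply: contraNneq q0 => ->; rewrite rmorph0.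
have g0 : gcdp p q != 0 by rewrite gcdp_eq0 negb_and q0' orbT.
have pE := divpK (dvdp_gcdl p q); have qE := divpK (dvdp_gcdr p q).
exists (p %/ gcdp p q), (q %/ gcdp p q); split.
- by apply: contraNneq q0' => E; rewrite -qE E mul0r.
- by rewrite coprimep_div_gcd // q0' orbT.
- have evM a b : ev x (a * b) = ev x a * ev x b by exact: rmorphM.
  by apply: (mulIf (transc_neq0 tx g0)); rewrite -evM pE -[RHS]mulrA -[X in _ = _ * X]evM qE divfK.
Qed.

(** The element tau is the function P/Q of w, of degree d. *)
Section Degree.
Variables (tau w : T) (P Q : {poly C}) (d : nat).
Hypotheses (ttau : transc iota tau) (cop : coprimep P Q).
Hypotheses (sPQ : maxn (size P) (size Q) = d.+1) (hw : ev w P = tau * ev w Q).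

Let evD v (a b : {poly C}) : ev v (a + b) = ev v a + ev v b. Proof. exact: rmorphD. Qed.
Let evM v (a b : {poly C}) : ev v (a * b) = ev v a * ev v b. Proof. exact: rmorphM. Qed.
Let evXn v (a : {poly C}) k : ev v (a ^+ k) = ev v a ^+ k. Proof. exact: rmorphXn. Qed.

Lemma degree_transc : transc iota w.
Proof.
move=> p pw; apply/eqP; apply: contraT => p0; have [c wE] := alg_const p0 pw.
have evc q : ev w q = iota q.[c].
  by rewrite /ev /= wE /horner_eval horner_map.
have := hw; rewrite !evc => E; have [Qc|Qc] := eqVneq (Q.[c]) 0.
  move: E; rewrite Qc rmorph0 mulr0 => /eqP; rewrite fmorph_eq0 => Pc.
  by have := coprimep_root cop Pc; rewrite Qc eqxx.
have := ttau (p := Q.[c] *: 'X - P.[c]%:P); rewrite rmorphB /= evZ evX evC E mulrC subrr.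
move=> /(_ erefl)/(congr1 (fun p : {poly C} => p`_1)).
by rewrite coefB coefZ coefX coefC coef0 /= mulr1 subr0 => /eqP; rewrite (negPf Qc).
Qed.

(** The value of a polynomial in tau, of degree at most k, multiplied by Q(w)^k. *)
Lemma degree_clear k (G : {poly {poly C}}) : (size G <= k.+1)%N ->
  exists N, ev w N = ev w Q ^+ k * ev2 w tau G.
Proof.
elim: k G => [|k IH] G sG.
  by exists G`_0; rewrite expr0 mul1r [in RHS](size1_polyC sG) ev2C.
have [N' E'] : exists N, ev w N = ev w Q ^+ k * ev2 w tau (drop_poly 1 G).
  by apply: IH; rewrite size_drop_poly leq_subLR add1n.
exists (N' * P + G`_0 * Q ^+ k.+1).
rewrite rmorphD !rmorphM rmorphXn /= E' hw.
rewrite -[in RHS](poly_take_drop 1 G) rmorphD rmorphM /= ev2X.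
have -> : take_poly 1 G = (G`_0)%:P.
  by apply/polyP => -[|i]; rewrite coef_take_poly coefC.
by rewrite ev2C !exprS; ring.
Qed.

(** The element w has degree at least d over C(tau).  A relation, read as a
    polynomial in tau with coefficients in C[w], has its leading coefficient
    divisible by Q and its constant coefficient divisible by P. *)
Lemma degree_ge (H : {poly {poly C}}) : (size H <= d)%N -> ev2 tau w H = 0 -> H = 0.
Proof.
move=> sH hH; have tw := degree_transc.
have tau0 : tau != 0 by have := transc_neq0 ttau (monic_neq0 (monicX C)); rewrite evX.
have evsw G : ev2 w tau (swapXY G) = ev2 tau w G.
  elim/poly_ind: G => [|G c IH]; first by rewrite !rmorph0.
  rewrite rmorphD rmorphM /= swapXY_X swapXY_polyC.
  rewrite [LHS]rmorphD [RHS]rmorphD [X in X + _]rmorphM [X in _ = X + _]rmorphM /=.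
  by rewrite IH ev2C evX ev2X ev2P ev2C.
have sG j : (size ((swapXY H)`_j)%R <= d)%N.
  by rewrite (leq_trans (max_size_coefXY _ _)) // sizeYE swapXYK.
move: (evsw H); rewrite hH => hG.
apply/eqP; rewrite -swapXY_eq0; apply/eqP; move: (swapXY H) sG hG; clear H sH hH evsw.
have small (p q : {poly C}) : size q = d.+1 -> (size p <= d)%N -> q %| p -> p = 0.
  move=> sq sp qp; apply/eqP; apply: contraT => p0.
  by have := dvdp_leq p0 qp; rewrite sq leqNgt ltnS sp.
have [sQ|sP] : size Q = d.+1 \/ size P = d.+1.
- by move: sPQ; rewrite /maxn; case: ifP => _; [left|right].
- move=> G sG hG; apply/eqP; apply: contraT => G0.
  have sG1 : size G = (size G).-1.+1 by rewrite prednK // size_poly_gt0.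
  case: (posnP (size G).-1) => [k0|k0].
    have GE : G = (G`_0)%:P by apply: size1_polyC; rewrite sG1 k0.
    move: hG; rewrite GE ev2C => /tw; move/eqP; rewrite -polyC_eq0 -GE.
    by rewrite (negPf G0).
  pose k := (size G).-1; pose low := take_poly k G.
  have [N NE] : exists N, ev w N = ev w Q ^+ k.-1 * ev2 w tau low.
    by apply: degree_clear; rewrite prednK // size_take_poly.
  have GE : G = low + (lead_coef G)%:P * 'X^k.
    apply/polyP => i; rewrite coefD coef_take_poly coefMXn coefC.
    case: (ltngtP i k) => ik; first by rewrite addr0.
      rewrite add0r subn_eq0 leqNgt ik /=; apply/leq_sizeP: i ik.
      by rewrite sG1.
    by rewrite add0r ik subnn /= lead_coefE.
  have E : lead_coef G * P ^+ k + Q * N = 0.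
    apply: tw; rewrite evD (evM _ (lead_coef G)) evXn (evM _ Q).
    rewrite NE hw exprMn [ev w Q * (_ * _)]mulrA -exprS prednK //.
    transitivity (ev w Q ^+ k * (ev w (lead_coef G) * tau ^+ k + ev2 w tau low)); first by ring.
    suff -> : ev w (lead_coef G) * tau ^+ k + ev2 w tau low = 0 by rewrite mulr0.
    rewrite -[RHS]hG [in RHS]GE rmorphD rmorphM rmorphXn /= ev2C ev2X addrC.
    by rewrite mulrC.
  suff : lead_coef G = 0 by move/eqP; rewrite lead_coef_eq0 (negPf G0).
  apply: (small _ _ sQ); first by rewrite lead_coefE.
  rewrite -(Gauss_dvdpl _ (_ : coprimep Q (P ^+ k))); last first.
    by rewrite coprimep_expr // coprimep_sym.
  by move/eqP: E; rewrite addr_eq0 => /eqP ->; rewrite dvdpNr dvdp_mulr.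
- elim/poly_ind => [//|G c IH] sG hG.
  have hG' : tau * ev2 w tau G + ev w c = 0.
    by move: hG; rewrite rmorphD rmorphM /= ev2X ev2C mulrC.
  have [N NE] := @degree_clear (size G) G (leqnSn _).
  have E : c * Q ^+ (size G).+1 + P * N = 0.
    apply: tw; rewrite evD (evM _ c) evXn (evM _ P) NE hw.
    transitivity (ev w Q ^+ (size G).+1 * (tau * ev2 w tau G + ev w c)).
      by rewrite exprS; ring.
    by rewrite hG' mulr0.
  have cE : (G * 'X + c%:P)`_0 = c by rewrite coefD coefMX coefC add0r.
  have c0 : c = 0.
    apply: (small _ _ sP); first by rewrite -cE.
    rewrite -(Gauss_dvdpl _ (_ : coprimep P (Q ^+ (size G).+1))); last by rewrite coprimep_expr.
    by move/eqP: E; rewrite addr_eq0 => /eqP ->; rewrite dvdpNr dvdp_mulr.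
  rewrite IH ?mul0r ?add0r ?c0 // => [j|].
    by have := sG j.+1; rewrite coefD coefMX coefC addr0.
  move: hG'; rewrite c0 rmorph0 addr0 => /eqP.
  by rewrite mulf_eq0 (negPf tau0) => /eqP.
Qed.
End Degree.
End Rational.

(** * Clearing denominators and the theorem of Lueroth *)

Section Primitive.
Variable C : numClosedFieldType.
Implicit Types (Psi q F : {poly {poly C}}).

(** The coefficients have no common root. *)
Definition primitive Psi := forall a : C, map_poly (horner_eval a) Psi != 0.

Lemma eval_dvd a Psi : map_poly (horner_eval a) Psi = 0 ->
  exists Psi', Psi = ('X - a%:P)%:P * Psi'.
Proof. by case/eval_eq0_scale=> Psi' ->; exists Psi'; rewrite mul_polyC. Qed.

(** Lemma of Gauss for a primitive factor. *)
Lemma gauss_prim Psi q F (D : {poly C}) : primitive Psi -> D != 0 ->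
  Psi * q = D%:P * F -> exists q', q = D%:P * q' /\ Psi * q' = F.
Proof.
move=> pr; move: {2}(size D) (leqnn (size D)) => n.
elim: n D q F => [|n IH] D q F sD D0; first by rewrite size_poly_leq0 (negPf D0) in sD.
have [sD1|sD1] := eqVneq (size D) 1%N.
  have /size_poly1P[c c0 DE] := introT eqP sD1 => E.
  have cE : c^-1%:P * c%:P = 1 :> {poly C} by rewrite -polyCM mulVf.
  exists ((c^-1%:P)%:P * q); rewrite DE in E *; split.
    by rewrite mulrA -polyCM [c%:P * _]mulrC cE mul1r.
  by rewrite mulrCA E mulrA -polyCM cE mul1r.
have /closed_rootP[a ra] := sD1; have /factor_theorem[D' DE] := ra => E.
have D'0 : D' != 0 by apply: contraNneq D0 => D'0; rewrite DE D'0 mul0r.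
have /eval_dvd[q1 q1E] : map_poly (horner_eval a) q = 0.
  have := congr1 (map_poly (horner_eval a)) E.
  have mM (G H : {poly {poly C}}) : map_poly (horner_eval a) (G * H) =
    map_poly (horner_eval a) G * map_poly (horner_eval a) H by exact: rmorphM.
  rewrite !mM [X in _ = X * _]map_polyC /= /horner_eval (eqP ra) mul0r => /eqP.
  by rewrite mulf_eq0 => /orP[|/eqP //]; rewrite (negPf (pr a)).
have X0 : ('X - a%:P)%:P != 0 :> {poly {poly C}} by rewrite polyC_eq0 polyXsubC_eq0.
have [||q' [q1' E']] := IH D' q1 F _ D'0.
- rewrite -ltnS (leq_trans _ sD) // DE size_Mmonic ?monicXsubC // size_XsubC addn2.
  by [].
- apply: (mulfI X0); rewrite mulrCA -q1E E DE polyCM; ring.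
by exists q'; rewrite q1E q1' DE polyCM; split=> //; ring.
Qed.
End Primitive.

Section Clear.
Variables (C : numClosedFieldType) (T : fieldType) (iota : {rmorphism C -> T}).
Local Notation ev := (ev iota).
Variable z : T.
Hypotheses (tz : transc iota z) (gz : forall e, ratl iota z e).

Lemma map_ev_inj (G : {poly {poly C}}) : map_poly (ev z) G = 0 -> G = 0.
Proof.
move=> E; apply/polyP => i; rewrite coef0; apply: tz.
by have := congr1 (fun p : {poly T} => p`_i) E; rewrite coef_map coef0.
Qed.

Lemma size_map_ev (G : {poly {poly C}}) : size (map_poly (ev z) G) = size G.
Proof.
have [->|G0] := eqVneq G 0; first by rewrite rmorph0 !size_poly0.
by rewrite size_map_poly_id0 //; apply: transc_neq0 tz _; rewrite lead_coef_eq0.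
Qed.

Lemma clear_denom_ratl u (p : {poly T}) : (forall i, ratl iota u p`_i) ->
  exists (D : {poly C}) (Psi : {poly {poly C}}),
  ev u D != 0 /\ map_poly (ev u) Psi = ev u D *: p.
Proof.
elim/poly_ind: p => [|p c IH] pc.
  by exists 1, 0; rewrite !rmorph0 scaler0 rmorph1 oner_neq0.
have [|D [Psi [D0 E]]] := IH.
  by move=> i; have := pc i.+1; rewrite coefD coefMX coefC addr0.
have [n [d [d0 cE]]] := pc 0; rewrite coefD coefMX coefC add0r in cE.
exists (D * d), (d *: Psi * 'X + (D * n)%:P); split; first by rewrite rmorphM mulf_neq0.
have evM a b : ev u (a * b) = ev u a * ev u b by exact: rmorphM.
have cE' : (ev u n)%:P = (ev u d)%:P * c%:P by rewrite -polyCM cE mulrC divfK.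
rewrite rmorphD rmorphM /= map_polyX map_polyC map_polyZ E /=.
by rewrite !evM -!mul_polyC !polyCM cE'; ring.
Qed.

Lemma clear_denom (p : {poly T}) : exists (D : {poly C}) (Psi : {poly {poly C}}),
  D != 0 /\ map_poly (ev z) Psi = ev z D *: p.
Proof.
have [D [Psi [D0 E]]] := clear_denom_ratl (fun i => gz p`_i).
by exists D, Psi; split=> //; apply: contraNneq D0 => ->; rewrite rmorph0.
Qed.

(** A monic polynomial over C(z) has a primitive multiple over C[z]. *)
Lemma clear_prim (p : {poly T}) : p \is monic ->
  exists (D : {poly C}) (Psi : {poly {poly C}}),
  [/\ D != 0, primitive Psi & map_poly (ev z) Psi = ev z D *: p].
Proof.
move=> mp; have [D [Psi [D0 E]]] := clear_denom p.
move: {2}(size D) (leqnn (size D)) => n.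
elim: n D Psi D0 E => [|n IH] D Psi D0 E sD; first by rewrite size_poly_leq0 (negPf D0) in sD.
have [pr|npr] := pselect (primitive Psi); first by exists D, Psi.
have [a /eqP/eval_dvd[Psi' PE]] : exists a, map_poly (horner_eval a) Psi == 0.
  apply: contrapT => H; apply: npr => a; apply/negP => H'; apply: H.
  by exists a.
have evX0 : ev z ('X - a%:P) != 0 by apply: transc_neq0 tz _; rewrite polyXsubC_eq0.
have DE : D = ('X - a%:P) * Psi'`_(size p).-1.
  apply/eqP; rewrite -subr_eq0; apply/eqP/tz.
  have := congr1 (fun q : {poly T} => q`_(size p).-1) E.
  rewrite coef_map PE coefCM coefZ -lead_coefE (monicP mp) mulr1 /=.
  by rewrite [ev z (D - _)]rmorphB /= => ->; rewrite subrr.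
set D' := Psi'`_(size p).-1 in DE.
have D'0 : D' != 0 by apply: contraNneq D0 => D'0; rewrite DE D'0 mulr0.
apply: (IH D' Psi' D'0); last first.
  by rewrite -ltnS (leq_trans _ sD) // DE size_monicM ?monicXsubC // size_XsubC.
apply: (scalerI evX0); rewrite scalerA -rmorphM -DE -E PE rmorphM /= map_polyC /=.
by rewrite mul_polyC.
Qed.
End Clear.

(** [degree_ge] for polynomials with coefficients in C(tau). *)
Lemma degree_ratl (C : numClosedFieldType) (T : fieldType) (iota : {rmorphism C -> T})
    (tau w : T) (P Q : {poly C}) d (p : {poly T}) :
  transc iota tau -> coprimep P Q -> maxn (size P) (size Q) = d.+1 ->
  ev iota w P = tau * ev iota w Q -> (forall i, ratl iota tau p`_i) ->
  (size p <= d)%N -> root p w -> p = 0.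
Proof.
move=> tt cop sPQ hw pc sp pw; have [D [Psi [D0 E]]] := clear_denom_ratl pc.
have sPsi : size Psi = size p by rewrite -(size_map_ev tt) E size_scale.
have P0 : Psi = 0.
  apply: (degree_ge tt cop sPQ hw); first by rewrite sPsi.
  by rewrite ev2E E hornerZ (eqP pw) mulr0.
by apply/eqP; rewrite -size_poly_eq0 -sPsi P0 size_poly0.
Qed.

Section Luroth.
Variables (C : numClosedFieldType) (K : fieldType) (T : fieldExtType K).
Variables (iota : {rmorphism C -> T}) (E : {subfield T}) (z : T).
Local Notation ev := (ev iota).
Hypothesis iE : forall c, iota c \in E.
Hypotheses (tz : transc iota z) (gz : forall e, ratl iota z e).

Let evM v (a b : {poly C}) : ev v (a * b) = ev v a * ev v b. Proof. exact: rmorphM. Qed.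
Let evB v (a b : {poly C}) : ev v (a - b) = ev v a - ev v b. Proof. exact: rmorphB. Qed.

Lemma map_iota_over (p : {poly C}) : map_poly iota p \is a polyOver E.
Proof. by apply/polyOverP => i; rewrite coef_map /= iE. Qed.

(** The minimal polynomial of z has a nonconstant coefficient, as z is
    transcendental. *)
Lemma nonconstant_coef : exists i, forall c, (minPoly E z)`_i <> iota c.
Proof.
apply: contrapT => H; have /choice[c cE] i : exists c, (minPoly E z)`_i = iota c.
  by apply: contrapT => H'; apply: H; exists i => c ce; apply: H'; exists c.
pose p := \poly_(i < size (minPoly E z)) c i.
have pE : map_poly iota p = minPoly E z.
  apply/polyP => i; rewrite coef_map coef_poly /= cE; case: ltnP => // si.
  by rewrite -cE nth_default ?rmorph0.
have /tz p0 : ev z p = 0 by rewrite evE pE; apply/eqP; exact: root_minPoly.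
by have := monic_neq0 (monic_minPoly E z); rewrite -pE p0 rmorph0 eqxx.
Qed.

(** A Moebius change of coordinate turns s into x = U/V with a pole at infinity,
    without changing its degree. *)
Lemma moebius_pole (s : T) : s \in E -> (forall c, s <> iota c) ->
  exists (x : T) (p q U V : {poly C}) n,
  [/\ x \in E, [/\ q != 0, coprimep p q, ev z p = s * ev z q & maxn (size p) (size q) = n.+1],
     [/\ U \is monic, size U = n.+1, (size V <= n)%N & V != 0], coprimep U V &
     ev z U = x * ev z V].
Proof.
move=> sE sc; have [p [q [q0 cop pq]]] := ratl_coprime tz (gz s).
have mon (u v : {poly C}) x : x \in E -> u != 0 -> v != 0 -> coprimep u v -> ev z u = x * ev z v ->
    (size v < size u)%N -> maxn (size p) (size q) = size u ->
    exists (x : T) (p q U V : {poly C}) n,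
  [/\ x \in E, [/\ q != 0, coprimep p q, ev z p = s * ev z q & maxn (size p) (size q) = n.+1],
     [/\ U \is monic, size U = n.+1, (size V <= n)%N & V != 0], coprimep U V &
     ev z U = x * ev z V].
  move=> xE u0 v0 cuv uv sz mx; have l0 : (lead_coef u)^-1 != 0 by rewrite invr_eq0 lead_coef_eq0.
  exists x, p, q, ((lead_coef u)^-1 *: u), ((lead_coef u)^-1 *: v), (size u).-1.
  have su : (size u).-1.+1 = size u by rewrite prednK // size_poly_gt0.
  split=> //; first by rewrite su.
  - split; rewrite ?size_scale ?su ?scaler_eq0 ?negb_or ?l0 //.
      by rewrite monicE lead_coefZ mulVf // lead_coef_eq0.
    by rewrite -ltnS su.
  - by rewrite coprimepZl // coprimepZr.
  - by rewrite !evZ uv mulrCA.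
have evq0 := transc_neq0 tz q0.
have [sqp|spq] := ltnP (size q) (size p).
  apply: (mon p q s) => //; last by apply/maxn_idPl/ltnW.
  by rewrite -size_poly_gt0 (leq_ltn_trans _ sqp).
have c0 : lead_coef q != 0 by rewrite lead_coef_eq0.
pose c := p`_(size q).-1 / lead_coef q; pose p' := p - c *: q.
have evp' : ev z p' = (s - iota c) * ev z q by rewrite evB evZ pq mulrBl.
have sc0 : s - iota c != 0 by rewrite subr_eq0; apply/eqP.
have p'0 : p' != 0.
  by apply/eqP => p'0; move/eqP: evp'; rewrite p'0 rmorph0 eq_sym mulf_eq0 (negPf sc0) (negPf evq0).
apply: (mon q p' (s - iota c)^-1) => //.
- by rewrite rpredV rpredB.
- rewrite coprimep_sym /p' -mul_polyC -mulNr -polyCN addrC coprimep_sym coprimep_addl_mul.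
  by rewrite coprimep_sym.
- by rewrite evp' mulKf.
- have sq : (size q).-1.+1 = size q by rewrite prednK // size_poly_gt0.
  rewrite -sq ltnS; apply/leq_sizeP => j; rewrite leq_eqVlt => /orP[/eqP <-|].
    by rewrite /p' coefB coefZ -lead_coefE /c divfK // subrr.
  rewrite -ltnS sq ltnS => sj; rewrite /p' coefB coefZ !nth_default ?mulr0 ?subrr //.
  exact: leq_trans spq sj.
- exact/maxn_idPr.
Qed.

(** Theorem of Lueroth.  With x obtained from a nonconstant coefficient of the
    minimal polynomial mu of z, the polynomial U - x V is a multiple of mu; the
    lemma of Gauss and the degree in the coefficients show that it is mu. *)
Theorem luroth : exists (x : T) (U V : {poly C}) n,
  [/\ x \in E, [/\ U \is monic, size U = n.+1, (size V <= n)%N & V != 0], coprimep U V,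
     ev z U = x * ev z V &
     size (minPoly E z) = n.+1 /\ forall g, g \in E -> ratl iota x g].
Proof.
set mu := minPoly E z; have [i si] := nonconstant_coef.
have mmu : mu \is monic by exact: monic_minPoly.
have muE : mu \is a polyOver E by exact: minPolyOver.
have [x [p [q [U [V [n [xE [q0 copq pq mx] [mU sU sV V0] copUV UV]]]]]]] :=
  moebius_pole (polyOverP muE i) si.
exists x, U, V, n; split=> //.
(* the candidate for the minimal polynomial of z *)
pose F := map_poly iota U - x *: map_poly iota V.
have sF : size F = n.+1.
  rewrite size_polyDl size_map_poly ?sU // size_polyN.
  by rewrite (leq_ltn_trans (size_scale_leq _ _)) // size_map_poly ltnS.
have FE : F \is a polyOver E.
  by rewrite rpredB ?map_iota_over // polyOverZ ?map_iota_over.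
have Fz : root F z.
  have := UV; rewrite !evE rootE /F hornerD hornerN hornerZ => ->.
  by rewrite subrr.
have mF : F \is monic.
  rewrite monicE lead_coefDl ?size_map_poly ?lead_coef_map ?(monicP mU) ?rmorph1 //.
  by rewrite size_polyN (leq_ltn_trans (size_scale_leq _ _)) // size_map_poly sU ltnS.
have smu : size mu = n.+1.
  have /dvdpP[nu Fnu] := minPoly_dvdp FE Fz; rewrite -/mu in Fnu.
  have [D [Psi [D0 prim PsiE]]] := clear_prim tz gz mmu.
  have [D' [Psi' [D'0 Psi'E]]] := clear_denom gz nu.
  pose F2 : {poly {poly C}} := V *: map_poly polyC U - U *: map_poly polyC V.
  have F2E : map_poly (ev z) F2 = ev z V *: F.
    have mB (G H : {poly {poly C}}) : map_poly (ev z) (G - H) = map_poly (ev z) G - map_poly (ev z) H.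
      exact: rmorphB.
    rewrite /F2 mB !map_polyZ !map_ev_polyC /F scalerBr scalerA.
    by have := UV; rewrite /= => ->; rewrite [x * _]mulrC.
  have DD0 : D * D' != 0 by rewrite mulf_neq0.
  have E1 : Psi * (V *: Psi') = (D * D')%:P * F2.
    apply/eqP; rewrite -subr_eq0; apply/eqP/(map_ev_inj tz).
    have mB (G H : {poly {poly C}}) : map_poly (ev z) (G - H) = map_poly (ev z) G - map_poly (ev z) H.
      exact: rmorphB.
    have mM (G H : {poly {poly C}}) : map_poly (ev z) (G * H) = map_poly (ev z) G * map_poly (ev z) H.
      exact: rmorphM.
    rewrite mB !mM map_polyZ PsiE Psi'E F2E map_polyC /= Fnu evM -!mul_polyC polyCM.
    by ring.
  have [q' [_ q'E]] := gauss_prim prim DD0 E1.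
  have V0' := transc_neq0 tz V0.
  have F20 : F2 != 0.
    apply/eqP => F20; move/eqP: F2E; rewrite F20 rmorph0 eq_sym scaler_eq0 (negPf V0').
    by rewrite (negPf (monic_neq0 mF)).
  have Psi0 : Psi != 0 by apply: contraNneq F20 => P0; rewrite -q'E P0 mul0r.
  have q'0 : q' != 0 by apply: contraNneq F20 => P0; rewrite -q'E P0 mulr0.
  have sPsi : size Psi = size mu.
    by rewrite -(size_map_ev tz) PsiE size_scale // transc_neq0.
  have sF2 : size F2 = n.+1 by rewrite -(size_map_ev tz) F2E size_scale.
  (* two coefficients of Psi have quotient p/q, a function of degree n of z; hence the degree in the coefficients *)
  have big : (n < size (swapXY Psi))%N.
    have DE : D = Psi`_(size mu).-1.
      apply/eqP; rewrite -subr_eq0; apply/eqP/tz.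
      have := congr1 (fun q : {poly T} => q`_(size mu).-1) PsiE.
      by rewrite coef_map coefZ -lead_coefE (monicP mmu) mulr1 evB /= => ->; rewrite subrr.
    have PE : Psi`_i * q = D * p.
      apply/eqP; rewrite -subr_eq0; apply/eqP/tz; rewrite evB !evM pq.
      have := congr1 (fun q : {poly T} => q`_i) PsiE; rewrite coef_map coefZ /= => ->.
      by rewrite -/mu; ring.
    have qD : (size q <= size D)%N.
      apply: dvdp_leq => //; rewrite -(Gauss_dvdpl _ (_ : coprimep q p)) 1?coprimep_sym //.
      by rewrite -PE dvdp_mull.
    have pP : (size p <= size (Psi`_i)%R)%N.
      have p0 : p != 0.
        apply/eqP => p0; have := si 0; rewrite rmorph0; apply.
        by move/eqP: pq; rewrite p0 rmorph0 eq_sym mulf_eq0 (negPf (transc_neq0 tz q0)) orbF => /eqP.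
      apply: dvdp_leq; last by rewrite -(Gauss_dvdpl _ copq) PE dvdp_mull.
      by apply/eqP => P0; move/eqP: PE; rewrite P0 mul0r eq_sym mulf_eq0 (negPf D0) (negPf p0).
    rewrite -sizeYE -mx geq_max (leq_trans qD) ?(leq_trans pP) ?max_size_coefXY //.
    by rewrite DE max_size_coefXY.
  have sw : size (swapXY q') = 1%N.
    apply/eqP; rewrite eqn_leq size_poly_gt0 swapXY_eq0 q'0 andbT.
    have : (size (swapXY F2) <= n.+1)%N.
      rewrite /F2 -!mul_polyC rmorphB !rmorphM /= !swapXY_polyC !swapXY_map_polyC.
      have sp (a b : {poly C}) : (size a <= n.+1)%N -> (size (map_poly polyC a * b%:P)%R <= n.+1)%N.
        by move=> sa; rewrite mulrC mul_polyC (leq_trans (size_scale_leq _ _)) // size_map_polyC.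
      by apply: size_subP; apply: sp; rewrite ?sU // (leq_trans sV).
    rewrite -q'E rmorphM /= size_mul ?swapXY_eq0 //.
    move: big (swapXY_eq0 q') q'0; rewrite -!size_poly_gt0.
    by move: (size (swapXY _)) (size (swapXY _)) => a b; clear=> *; lia.
  have [q0' q0E] : exists q0, q' = map_poly polyC q0.
    exists (swapXY q')`_0; rewrite -swapXY_polyC -size1_polyC ?sw // swapXYK //.
  (* the cofactor depends on the outer variable only; a root r of it would be a common root of U and V *)
  have sq0 : size q0' = 1%N.
    apply/eqP; apply: contraT => /closed_rootP[r rr].
    have hE (G : {poly {poly C}}) : (map_poly polyC q0' * G).[r%:P] = 0.
      by rewrite hornerM horner_map /= (eqP rr) mul0r.
    have := hE Psi; rewrite -q0E mulrC q'E /F2 hornerD hornerN !hornerZ !horner_map /= => /eqP.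
    rewrite subr_eq0 => /eqP Er.
    have Vr : V.[r] = 0.
      apply/eqP; apply: contraT => Vr; have := congr1 (size : {poly C} -> nat) Er.
      rewrite [V * _]mulrC [U * _]mulrC !mul_polyC => Es; have := size_scale U Vr; rewrite -Es sU.
      by move=> E'; have := size_scale_leq U.[r] V; rewrite E' leqNgt ltnS sV.
    move/eqP: Er; rewrite Vr mulr0 mulf_eq0 (negPf V0) polyC_eq0 /= => Ur.
    by have := coprimep_root copUV Ur; rewrite Vr eqxx.
  have sq' : size q' = 1%N by rewrite q0E size_map_polyC.
  by move: sF2; rewrite -q'E size_mul // sq' addn1 /= sPsi.
split=> // g gE; have [a [b [b0 gab]]] := gz g.
pose Fx : {poly {poly C}} := map_poly polyC U - 'X *: map_poly polyC V.
have mFx : Fx \is monic.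
  rewrite monicE lead_coefDl; last first.
    by rewrite size_polyN (leq_ltn_trans (size_scale_leq _ _)) // !size_map_polyC sU ltnS.
  by rewrite lead_coef_map_inj ?(monicP mU) //; exact: polyC_inj.
have sFx : size Fx = n.+1.
  rewrite size_polyDl size_map_polyC ?sU // size_polyN.
  by rewrite (leq_ltn_trans (size_scale_leq _ _)) // size_map_polyC ltnS.
(* division with remainder by U - x V replaces values at z by combinations of 1, ..., z^(n-1) with coefficients in C[x] *)
pose rem (w : {poly C}) := Pdiv.Ring.rmodp (map_poly polyC w) Fx.
have remS w : (size (rem w) <= n)%N.
  by rewrite -ltnS -sFx Pdiv.Ring.ltn_rmodp monic_neq0.
have remE w : (map_poly (ev x) (rem w)).[z] = ev z w.
  have := Pdiv.RingMonic.rdivp_eq mFx (map_poly polyC w).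
  move=> /(congr1 (ev2 iota x z)); rewrite ev2P => ->.
  have FxE : ev2 iota x z Fx = 0 by rewrite /Fx ev2B ev2Z !ev2P evX UV subrr.
  by rewrite rmorphD rmorphM /= FxE mulr0 add0r.
have remO w : map_poly (ev x) (rem w) \is a polyOver E.
  apply/polyOverP => j; rewrite coef_map /=.
  suff H (r : {poly C}) : ev x r \in E by exact: H.
  elim/poly_ind: r => [|r c IH]; first by rewrite rmorph0 mem0v.
  by rewrite rmorphD /= evM evX evC memvD ?memvM.
pose G := g *: map_poly (ev x) (rem b) - map_poly (ev x) (rem a).
have G0 : G = 0.
  apply/eqP; apply: contraT => G0.
  have GE : G \is a polyOver E by rewrite rpredB // polyOverZ.
  have Gz : root G z by rewrite rootE hornerD hornerN hornerZ !remE gab divfK ?subrr.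
  have := dvdp_leq G0 (minPoly_dvdp GE Gz); rewrite -/mu smu leqNgt ltnS => /negP[].
  apply: size_subP; rewrite ?(leq_trans (size_scale_leq _ _)) //;
    by rewrite (leq_trans (size_poly _ _)) ?remS.
have [j bj] : exists j, (map_poly (ev x) (rem b))`_j != 0.
  apply: contrapT => H; move/eqP: b0; apply; rewrite -remE.
  suff -> : map_poly (ev x) (rem b) = 0 by rewrite horner0.
  apply/polyP => j; rewrite coef0; apply/eqP; apply: contraT => bj.
  by case: H; exists j.
exists (rem a)`_j, (rem b)`_j; move: bj; rewrite coef_map /= => bj; split=> //.
have := congr1 (fun p : {poly T} => p`_j) G0; rewrite coefB coefZ !coef_map coef0 /= => /eqP.
by rewrite subr_eq0 => /eqP <-; rewrite mulfK.
Qed.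
End Luroth.

(** * Normal form of a subfield *)

Section Compose.
Variable C : numClosedFieldType.
Variables (U V : {poly C}) (n : nat).
Hypotheses (mU : U \is monic) (sU : size U = n.+1) (sV : (size V <= n)%N).

Lemma size_pull r : size (U - r *: V) = n.+1.
Proof.
by rewrite size_polyDl sU // size_polyN (leq_ltn_trans (size_scale_leq _ _)).
Qed.

Lemma monic_pull r : U - r *: V \is monic.
Proof.
rewrite monicE lead_coefDl ?(monicP mU) // size_polyN.
by rewrite (leq_ltn_trans (size_scale_leq _ _)) // sU.
Qed.

Lemma size_prod_pull s : size (\prod_(r <- s) (U - r *: V)) = (n * size s).+1.
Proof.
elim: s => [|r s IH]; first by rewrite big_nil size_poly1 muln0.
rewrite big_cons size_monicM ?monic_pull ?size_pull ?IH ?mulnS ?addnS //.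
by apply: monic_neq0; apply: monic_prod => i _; exact: monic_pull.
Qed.
End Compose.

(** A polynomial without double roots is separable. *)
Lemma coprimep_derivP (C : numClosedFieldType) (B : {poly C}) : B != 0 ->
  (forall a, ~~ (('X - a%:P) ^+ 2 %| B)) -> coprimep B B^`().
Proof.
move=> B0 H; apply: coprimep_closed => // a ra; apply: contra (H a) => rb.
have /factor_theorem[q E] := ra; rewrite E expr2 dvdp_mul2r ?polyXsubC_eq0 //.
rewrite dvdp_XsubCl; move: rb; rewrite E derivM derivXsubC mulr1 rootE hornerD hornerM.
by rewrite hornerXsubC subrr mulr0 add0r.
Qed.

Lemma coprimep_derivN (C : numClosedFieldType) (B : {poly C}) a :
  coprimep B B^`() -> ~~ (('X - a%:P) ^+ 2 %| B).
Proof.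
move=> cop; apply/negP => /dvdpP[q E].
have EE : B = (q * ('X - a%:P)) * ('X - a%:P) by rewrite E expr2 mulrA.
have ra : root B a by rewrite EE rootM root_XsubC eqxx orbT.
have := coprimep_root cop ra; rewrite EE derivM derivXsubC mulr1 hornerD !hornerM.
by rewrite hornerXsubC subrr !mulr0 addr0 eqxx.
Qed.

(** The pole of tau at z = infinity is simple, as are all its other poles. *)
Section NormalForm.
Variables (C : numClosedFieldType) (K : fieldType) (T : fieldExtType K).
Variables (iota : {rmorphism C -> T}) (E : {subfield T}) (z tau : T) (A B : {poly C}) (d : nat).
Local Notation ev := (ev iota).
Hypothesis i1 : forall c, iota c \in 1%VS.
Hypotheses (tz : transc iota z) (gz : forall e, ratl iota z e).
Hypotheses (cAB : cover A B d) (sepB : coprimep B B^`()) (hA : ev z A = tau * ev z B).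
Hypotheses (tau1 : tau \in 1%VS) (gK : forall k : T, k \in 1%VS -> ratl iota tau k).

Let evM v (a b : {poly C}) : ev v (a * b) = ev v a * ev v b. Proof. exact: rmorphM. Qed.
Let evB v (a b : {poly C}) : ev v (a - b) = ev v a - ev v b. Proof. exact: rmorphB. Qed.
Let evXn v (a : {poly C}) k : ev v (a ^+ k) = ev v a ^+ k. Proof. exact: rmorphXn. Qed.

Lemma sub1E : (1 <= E)%VS. Proof. exact: sub1v. Qed.

Lemma adjoin1_full (x : T) : x \in E -> (forall g, g \in E -> ratl iota x g) ->
  <<1; x>>%VS = E :> {vspace T}.
Proof.
move=> xE gx; apply/eqP; rewrite eqEsubv; apply/andP; split.
  by apply/FadjoinP; split; [exact: sub1v|].
apply/subvP => g gE; have [p [q [_ ->]]] := gx g gE.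
suff H (r : {poly C}) : ev x r \in <<1; x>>%VS by rewrite rpredM ?rpredV.
elim/poly_ind: r => [|r c IH]; first by rewrite rmorph0 mem0v.
rewrite rmorphD /= evM evX evC memvD ?memvM ?memv_adjoin //.
by apply: (subvP (subv_adjoin _ _)).
Qed.

(** The degree of C(x) over C(tau). *)
Lemma dim_cover (x : T) (P Q : {poly C}) m : x \in E ->
  (forall g, g \in E -> ratl iota x g) -> transc iota tau ->
  cover P Q m -> ev x P = tau * ev x Q -> \dim E = m.
Proof.
move=> xE gx tt [mP sP sQ m0 cop] PQ.
have <- : adjoin_degree 1%AS x = m; last first.
  by have := dim_Fadjoin 1%AS x; rewrite dimv1 muln1 (adjoin1_full xE gx).
apply/eqP; rewrite eqn_leq; apply/andP; split.
  pose F := map_poly iota P - tau *: map_poly iota Q.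
  have sF : size F = m.+1.
    rewrite size_polyDl size_map_poly ?sP // size_polyN.
    by rewrite (leq_ltn_trans (size_scale_leq _ _)) // size_map_poly sQ.
  have oF (p : {poly C}) : map_poly iota p \is a polyOver 1%VS.
    by apply/polyOverP => i; rewrite coef_map /= i1.
  have FE : F \is a polyOver 1%VS by rewrite rpredB ?oF // polyOverZ ?oF.
  have Fx : root F x.
    have := PQ; rewrite !evE rootE /F hornerD hornerN hornerZ => ->.
    by rewrite subrr.
  have F0 : F != 0 by rewrite -size_poly_gt0 sF.
  by have := dvdp_leq F0 (minPoly_dvdp FE Fx); rewrite size_minPoly sF ltnS.
rewrite leqNgt; apply/negP => lt.
have mPQ : maxn (size P) (size Q) = m.+1 by rewrite sP sQ; apply/maxn_idPl.
have := degree_ratl tt cop mPQ PQ (p := minPoly 1%AS x).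
rewrite size_minPoly root_minPoly => /(_ _ lt isT) H.
have /eqP : minPoly 1%AS x = 0.
  by apply: H => i; apply: gK; exact: (polyOverP (minPolyOver _ _)).
by rewrite (negPf (monic_neq0 (monic_minPoly _ _))).
Qed.

(** Every intermediate field is C(x), with covers z -> x -> tau.  The pole of tau
    at z = infinity being simple, so are the poles at infinity of the two
    covers; all poles of the second are simple, since those of tau are. *)
Theorem normal_form : exists (x : T) (U V A1 B1 : {poly C}) n m,
  [/\ x \in E, forall g, g \in E -> ratl iota x g,
      [/\ cover U V n, ev z U = x * ev z V & adjoin_degree E z = n],
      [/\ cover A1 B1 m, ev x A1 = tau * ev x B1 & coprimep B1 B1^`()] &
      \dim E = m].
Proof.
have iE c : iota c \in E by exact: (subvP sub1E).
have [x [U [V [n [xE [mU sU sV V0] copUV UV [smu gx]]]]]] := luroth iE tz gz.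
have tauE : tau \in E by exact: (subvP sub1E).
have tx : transc iota x.
  move=> p px; apply/eqP; apply: contraT => p0; have [c xc] := alg_const p0 px.
  have := tz (p := U - c *: V); rewrite evB evZ UV xc subrr => /(_ erefl)/eqP.
  by rewrite -size_poly_eq0 (size_pull sU sV).
have ttau : transc iota tau.
  move=> p px; apply/eqP; apply: contraT => p0; have [c xc] := alg_const p0 px.
  by have := point_neq tz cAB hA c; rewrite xc subrr eqxx.
have [P [Q [Q0 copPQ PQ]]] := ratl_coprime tx (gx _ tauE).
have tau0 : tau != 0 by have := transc_neq0 ttau (monic_neq0 (monicX C)); rewrite evX.
have P0 : P != 0.
  apply/eqP => P0; move/eqP: PQ; rewrite P0 rmorph0 eq_sym mulf_eq0 (negPf tau0).
  by rewrite (negPf (transc_neq0 tx Q0)).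
pose l := (lead_coef P)^-1; have l0 : l != 0 by rewrite invr_eq0 lead_coef_eq0.
pose A1 := l *: P; pose B1 := l *: Q.
have mA1 : A1 \is monic by rewrite monicE lead_coefZ mulVf // lead_coef_eq0.
have cop1 : coprimep A1 B1 by rewrite coprimepZl // coprimepZr.
have B10 : B1 != 0 by rewrite scaler_eq0 negb_or l0.
have hAB1 : ev x A1 = tau * ev x B1 by rewrite !evZ PQ mulrCA.
have evV0 := transc_neq0 tz V0; have [mA sA sB d0 copAB] := cAB.
have B0 := cover_B0 cAB.
pose hom (p : {poly C}) := lead_coef p *: \prod_(r <- rts p) (U - r *: V).
have ev_hom p : ev z (hom p) = ev z V ^+ size (rts p) * ev x p.
  have pE : ev x p = iota (lead_coef p) * ev x (\prod_(r <- rts p) ('X - r%:P)).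
    by rewrite {1}(rtsE p) evZ.
  by rewrite evZ (ev_prod_pull _ UV) mulrCA pE.
have s_hom p : p != 0 -> size (hom p) = (n * size (rts p)).+1.
  by move=> p0; rewrite size_scale ?lead_coef_eq0 // (size_prod_pull mU sU sV).
have hom0 p : p != 0 -> hom p != 0.
  by move=> p0; rewrite -size_poly_gt0 s_hom.
have A10 := monic_neq0 mA1.
set a := size (rts A1); set b := size (rts B1).
have homE : A * hom B1 * V ^+ a = B * hom A1 * V ^+ b.
  apply/eqP; rewrite -subr_eq0; apply/eqP/tz; rewrite evB !evM !evXn !ev_hom hA hAB1.
  by rewrite -/a -/b; ring.
(* the orders of the poles at infinity multiply to 1 *)
have [sVn ab] : size V = n /\ a = b.+1.
  have := congr1 (fun p : {poly C} => size p) homE.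
  have A0 := monic_neq0 mA.
  have sVX k : size (V ^+ k) = ((size V).-1 * k).+1.
    by rewrite -(prednK (_ : 0 < size (V ^+ k))%N) ?size_exp // size_poly_gt0 expf_neq0.
  rewrite !size_mul ?mulf_neq0 ?expf_neq0 ?hom0 // !s_hom // !sVX sA sB -/a -/b.
  move: sV (V0); rewrite -size_poly_gt0; move: (size V) d0; clear.
  move=> v d0 vn v0; have [k kE] : exists k, n = (v.-1 + k.+1)%N by exists (n - v)%N; lia.
  rewrite kE => H; have H' : (k.+1 * a = k.+1 * b + 1)%N by nia.
  have k0 : k = 0%N.
    have : (k.+1 %| 1)%N by rewrite -(dvdn_addr _ (dvdn_mulr b (dvdnn k.+1))) -H' dvdn_mulr.
    by rewrite dvdn1 => /eqP[].
  by rewrite k0 in kE H' *; split; lia.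
have cUV : cover U V n.
  by split=> //; rewrite -sVn size_poly_gt0.
have sA1 : size A1 = a.+1 by rewrite size_rts.
have sB1 : size B1 = a by rewrite size_rts // ab.
have c1 : cover A1 B1 a by split=> //; rewrite ab.
exists x, U, V, A1, B1, n, a; split=> //.
- by split=> //; have := smu; rewrite size_minPoly => -[].
- split=> //; apply: coprimep_derivP => // r; apply/negP => rr.
  have rB : root B1 r by rewrite -dvdp_XsubCl (dvdp_trans _ rr) // dvdp_exp.
  have [z0 z0r] : exists z0, root (U - r *: V) z0.
    by apply/closed_rootP; rewrite (size_pull sU sV) -sVn eqSS -lt0n size_poly_gt0.
  have z0E : U.[z0] = r * V.[z0].
    by move: z0r; rewrite rootE hornerD hornerN hornerZ subr_eq0 => /eqP.
  have V00 : V.[z0] != 0.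
    apply/negP => /eqP V00; have := coprimep_root copUV (_ : root U z0).
    by rewrite V00 eqxx rootE z0E V00 mulr0 eqxx => /(_ isT).
  have dvd : ('X - z0%:P) ^+ 2 %| hom B1.
    have cnt : (2 <= count_mem r (rts B1))%N by rewrite count_rts // mup_geq.
    rewrite dvdpZr ?lead_coef_eq0 // prod_count.
    have ru : r \in undup (rts B1) by rewrite mem_undup mem_rts.
    rewrite (bigD1_seq r) ?undup_uniq //= dvdp_mulr //.
    by rewrite (dvdp_trans _ (dvdp_exp2l _ cnt)) // dvdp_exp2r // dvdp_XsubCl.
  have A1r : A1.[r] != 0 by have := coprimep_root (_ : coprimep B1 A1) rB; rewrite coprimep_sym => /(_ cop1).
  (* a double root of B1 would give a double root of B above it *)
  have homA : ~~ root (hom A1 * V ^+ b) z0.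
    rewrite rootM negb_or; apply/andP; split; last first.
      by rewrite rootE horner_exp expf_neq0.
    rewrite /hom (monicP mA1) scale1r rootE horner_prod prodf_seq_neq0.
    apply/allP => s sr /=; rewrite hornerD hornerN hornerZ z0E -mulrBl mulf_neq0 //.
    rewrite subr_eq0; apply: contraNneq A1r => ->.
    by move: sr; rewrite mem_rts // => /eqP ->.
  have : ('X - z0%:P) ^+ 2 %| B * (hom A1 * V ^+ b).
    by rewrite mulrA -homE dvdp_mulr // dvdp_mull.
  rewrite Gauss_dvdpl; last by rewrite coprimep_expl // coprimep_sym coprimep_XsubC.
  by apply/negP; exact: coprimep_derivN.
- exact: (dim_cover xE gx ttau c1 hAB1).
Qed.
End NormalForm.

(** * Choice of the coordinates *)

Lemma exists_notin (C : numClosedFieldType) (s : seq C) : exists c, c \notin s.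
Proof.
pose p := \prod_(c <- 0 :: s) ('X - c%:P).
have sp : size p = (size s).+2 by rewrite size_prod_XsubC.
have : size (p - 1) != 1%N.
  by rewrite size_polyDl ?sp // size_polyN size_poly1.
case/closed_rootP=> c rc; exists c; apply/negP => cs.
have pc : p.[c] = 0.
  apply/eqP; rewrite horner_prod prodf_seq_eq0; apply/hasP; exists c; first by rewrite inE cs orbT.
  by rewrite /= hornerXsubC subrr.
by move: rc; rewrite rootE hornerD hornerN pc hornerC sub0r oppr_eq0 oner_eq0.
Qed.

Lemma deriv_eq0 (C : numDomainType) (p : {poly C}) : p^`() = 0 -> (size p <= 1)%N.
Proof.
move=> dp; apply/leq_sizeP => -[//|j] _.
have := congr1 (fun q : {poly C} => q`_j) dp; rewrite coef_deriv coef0 => /eqP.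
by rewrite mulrn_eq0 /= => /eqP.
Qed.

Lemma wron_coprime_neq0 (C : numClosedFieldType) (P Q : {poly C}) :
  coprimep P Q -> (1 < maxn (size P) (size Q))%N -> wron P Q != 0.
Proof.
move=> cop; apply: contraTneq; rewrite /wron => /eqP; rewrite subr_eq0 => /eqP E.
have H (p q : {poly C}) : coprimep p q -> p^`() * q = p * q^`() -> (size q <= 1)%N.
  move=> cpq Eq; apply: deriv_eq0; apply/eqP; apply: contraT => dq.
  have q0 : q != 0 by apply: contraNneq dq => ->; rewrite deriv0.
  have : q %| q^`() by rewrite -(Gauss_dvdpr _ (_ : coprimep q p)) 1?coprimep_sym // -Eq dvdp_mull.
  by move/(dvdp_leq dq); rewrite leqNgt lt_size_deriv.
rewrite -leqNgt geq_max (H P Q) // andbT (H Q P) 1?coprimep_sym //.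
by rewrite mulrC -E mulrC.
Qed.

(** All but finitely many fibres of a rational function are reduced. *)
Lemma reduced_fibre (C : numClosedFieldType) (P Q : {poly C}) d :
  coprimep P Q -> maxn (size P) (size Q) = d.+2 ->
  exists c, size (P - c *: Q) = d.+2 /\ uniq (rts (P - c *: Q)).
Proof.
move=> cop mx; have [c] := exists_notin (P`_d.+1 / Q`_d.+1 ::
  [seq P.[x] / Q.[x] | x <- rts (wron P Q)]).
move=> cn; exists c; move: cn; rewrite inE negb_or => /andP[cl cr].
have sP : (size P <= d.+2)%N by rewrite -mx leq_maxl.
have sQ : (size Q <= d.+2)%N by rewrite -mx leq_maxr.
have top : P`_d.+1 - c * Q`_d.+1 != 0.
  have [Q0|Q0] := eqVneq (Q`_d.+1) 0.
    rewrite Q0 mulr0 subr0; apply/eqP => P0.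
    have H (p : {poly C}) : (size p <= d.+2)%N -> p`_d.+1 = 0 -> (size p <= d.+1)%N.
      move=> sp p0; apply/leq_sizeP => j; rewrite leq_eqVlt => /orP[/eqP <- //|dj].
      by rewrite nth_default // (leq_trans sp).
    have : (maxn (size P) (size Q) <= d.+1)%N by rewrite geq_max !H.
    by rewrite mx ltnn.
  by rewrite subr_eq0; apply: contraNneq cl => ->; rewrite mulfK.
have s0 : size (P - c *: Q) = d.+2.
  apply/eqP; rewrite eqn_leq size_subP ?size_scaleP //= ltnNge.
  by apply/negP => /leq_sizeP/(_ d.+1 (leqnn _)); rewrite coefB coefZ => /eqP; rewrite (negPf top).
split=> //; have P0 : P - c *: Q != 0 by rewrite -size_poly_gt0 s0.
have W0 : wron P Q != 0 by apply: wron_coprime_neq0; rewrite ?mx.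
apply: count_mem_uniq => x; rewrite count_rts // mem_rts //.
have [rx|nrx] := boolP (root (P - c *: Q) x); last by rewrite mupNroot.
apply/eqP; rewrite eqn_leq -XsubC_dvd // dvdp_XsubCl rx andbT leqNgt.
apply/negP; rewrite mup_geq // => /dvdpP[g E].
have Px : P.[x] = c * Q.[x].
  by move: rx; rewrite rootE hornerD hornerN hornerZ subr_eq0 => /eqP.
have Qx : Q.[x] != 0.
  apply/negP => /eqP Qx; have := coprimep_root cop (_ : root P x).
  by rewrite Qx eqxx rootE Px Qx mulr0 eqxx => /(_ isT).
have rW : root (wron P Q) x.
  rewrite (_ : wron P Q = wron (P - c *: Q) Q); last first.
    by rewrite /wron derivB derivZ -!mul_polyC; ring.
  rewrite /wron E expr2 mulrA derivM derivXsubC rootE.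
  rewrite !(hornerXsubC, hornerD, hornerN, hornerM) subrr.
  by rewrite !(mulr0, mul0r, addr0, subr0, mul1r, mulr1).
by case/negP: cr; apply/mapP; exists x; rewrite ?mem_rts // Px mulfK.
Qed.

Section Coordinate.
Variables (C : numClosedFieldType) (T : fieldType) (iota : {rmorphism C -> T}).
Local Notation ev := (ev iota).
Variables (z0 t : T).
Hypotheses (tz0 : transc iota z0) (gz0 : forall e, ratl iota z0 e) (tt : transc iota t).

Let evM v (a b : {poly C}) : ev v (a * b) = ev v a * ev v b. Proof. exact: rmorphM. Qed.
Let evB v (a b : {poly C}) : ev v (a - b) = ev v a - ev v b. Proof. exact: rmorphB. Qed.

(** A coordinate z with a simple pole of 1/(t - c) at infinity, for some c
    above which t is unramified. *)
Lemma coordinate : exists (z : T) c (A B : {poly C}) d,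
  [/\ transc iota z, forall e, ratl iota z e, cover A B d, coprimep B B^`() &
      ev z A = (t - iota c)^-1 * ev z B].
Proof.
have [P [Q [Q0 cop PQ]]] := ratl_coprime tz0 (gz0 t).
have [d mx] : exists d, maxn (size P) (size Q) = d.+2.
  case mE: (maxn (size P) (size Q)) => [|[|d]]; last by exists d.
    by move: mE => /eqP; rewrite -leqn0 geq_max !size_poly_leq0 (negPf Q0) andbF.
  have : (maxn (size P) (size Q) <= 1)%N by rewrite mE.
  rewrite geq_max => /andP[sP sQ]; move: PQ Q0; rewrite (size1_polyC sP) (size1_polyC sQ).
  rewrite !evC polyC_eq0 => E q0; have := tt (p := Q`_0 *: 'X - (P`_0)%:P).
  rewrite evB evZ evX evC E mulrC subrr => /(_ erefl)/(congr1 (fun p : {poly C} => p`_1)).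
  by rewrite coefB coefZ coefX coefC coef0 /= mulr1 subr0 => /eqP; rewrite (negPf q0).
have [c [sP0 uP0]] := reduced_fibre cop mx.
set P0 := P - c *: Q in sP0 uP0.
have P00 : P0 != 0 by rewrite -size_poly_gt0 sP0.
have srP : size (rts P0) = d.+1 by have := size_rts P00; rewrite sP0 => -[].
case E : (rts P0) => [|a s]; first by rewrite E in srP.
have ra : root P0 a by rewrite -mem_rts // E mem_head.
rewrite E /= in srP uP0; case/andP: uP0 => aS uS; case: srP => sS.
have tc0 : t - iota c != 0.
  have := transc_neq0 tt (monic_neq0 (monicXsubC c)); by rewrite evB evX evC.
have evQ0 := transc_neq0 tz0 Q0.
have cop0 r : root P0 r -> Q.[r] != 0.
  move=> rr; apply/negP => /eqP Qr; have := coprimep_root cop (_ : root P r).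
  rewrite Qr eqxx rootE; move: rr; rewrite rootE /P0 hornerD hornerN hornerZ Qr mulr0 subr0.
  by move=> -> /(_ isT).
have za0 : z0 - iota a != 0.
  by have := transc_neq0 tz0 (monic_neq0 (monicXsubC a)); rewrite evB evX evC.
pose z := (z0 - iota a)^-1; have z_0 : z != 0 by rewrite invr_eq0.
have z0E : z0 = iota a + z^-1 by rewrite /z invrK addrC subrK.
(* the value of z at the point z0 = r *)
pose g r := (r - a)^-1.
have ginj : injective g by move=> r r' /invr_inj/addIr.
have gE r : r != a -> z0 - iota r = iota (a - r) * (z - iota (g r)) / z.
  move=> ra'; have h : iota r - iota a != 0 by rewrite -rmorphB fmorph_eq0 subr_eq0.
  by rewrite z0E /g fmorphV !rmorphB; field; rewrite z_0 h.
have prodE (w : seq C) : a \notin w -> \prod_(r <- w) (z0 - iota r) =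
    \prod_(r <- w) iota (a - r) * \prod_(r <- w) (z - iota (g r)) / z ^+ size w.
  elim: w => [|r w IH]; first by rewrite !big_nil expr0 mulr1 divr1.
  rewrite inE negb_or => /andP[ar /IH]; rewrite !big_cons exprS => ->.
  by rewrite gE 1?eq_sym //; field; rewrite z_0 expf_neq0.
have ev_prod v (w : seq C) : ev v (\prod_(r <- w) ('X - r%:P)) = \prod_(r <- w) (v - iota r).
  by rewrite rmorph_prod; apply: eq_bigr => r _; rewrite /= evB evX evC.
have aQ : a \notin rts Q by rewrite mem_rts //; exact: cop0.
have sQ : (size (rts Q) <= d.+1)%N.
  by rewrite -ltnS -size_rts // -mx leq_maxr.
pose A : {poly C} := 'X^(d.+1 - size (rts Q)) * \prod_(r <- [seq g r | r <- rts Q]) ('X - r%:P).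
pose B0 : {poly C} := \prod_(r <- [seq g r | r <- s]) ('X - r%:P).
pose k := (lead_coef Q * \prod_(r <- rts Q) (a - r)) / (lead_coef P0 * \prod_(r <- s) (a - r)).
have prod0 (w : seq C) : a \notin w -> \prod_(r <- w) (a - r) != 0.
  move=> aw; rewrite prodf_seq_neq0; apply/allP => r rw /=.
  by rewrite subr_eq0; apply: contraNneq aw => ->.
have k0 : k != 0 by rewrite !mulf_neq0 ?invr_eq0 ?mulf_neq0 ?lead_coef_eq0 ?prod0.
have A0 : A \is monic by rewrite monicMl ?monicXn ?monic_prod_XsubC.
have B00 : B0 \is monic by rewrite monic_prod_XsubC.
have ki0 : k^-1 != 0 by rewrite invr_eq0.
exists z, c, A, (k^-1 *: B0), d.+1.
have tz : transc iota z.
  move=> p pz; apply/eqP; apply: contraT => p0; have [b zb] := alg_const p0 pz.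
  have := tz0 (p := 'X - (a + b^-1)%:P); rewrite evB evX evC rmorphD fmorphV -zb -z0E subrr.
  by move=> /(_ erefl)/eqP; rewrite polyXsubC_eq0.
split=> //.
- move=> e; apply: (ratl_sub (y := z0)); last exact: gz0.
  by rewrite z0E; apply: ratlD; [apply: ratl_const|apply: ratlV; apply: ratl_id].
- split=> //.
  + by rewrite /A size_monicM ?monicXn ?monic_neq0 ?monic_prod_XsubC // size_polyXn size_prod_XsubC size_map addSn /= addnS subnK.
  + by rewrite size_scale // size_prod_XsubC size_map sS.
  rewrite coprimepZr //; rewrite coprimep_sym; apply: coprimep_closed => [|b].
    exact: monic_neq0.
  rewrite root_prod_XsubC => /mapP[r rs ->].
  have rr : r != a by apply: contraNneq aS => <-.
  have gr0 : g r != 0 by rewrite invr_eq0 subr_eq0.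
  rewrite rootM negb_or rootE hornerXn expf_neq0 //= root_prod_XsubC mem_map //.
  rewrite mem_rts //; apply: cop0; by rewrite -mem_rts // E inE rs orbT.
- apply: coprimep_derivP => [|b]; first by rewrite scaler_eq0 negb_or ki0 monic_neq0.
  rewrite dvdpZr // -mup_geq ?monic_neq0 // mu_prod_XsubC count_uniq_mem ?map_inj_uniq //.
  by case: (_ \in _).
have evP0 : ev z0 P0 = (t - iota c) * ev z0 Q by rewrite evB evZ PQ mulrBl.
have PE : ev z0 P0 = iota (lead_coef P0) * ((z0 - iota a) * \prod_(r <- s) (z0 - iota r)).
  by rewrite [in LHS](rtsE P0) evZ ev_prod E big_cons.
have QE : ev z0 Q = iota (lead_coef Q) * \prod_(r <- rts Q) (z0 - iota r).
  by rewrite [in LHS](rtsE Q) evZ ev_prod.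
rewrite evM evZ rmorphXn /= evX !ev_prod !big_map fmorphV.
have zE1 : z ^+ d.+1 = z ^+ (d.+1 - size (rts Q)) * z ^+ size (rts Q).
  by rewrite -exprD subnK.
have kE : iota k = iota (lead_coef Q) * \prod_(r <- rts Q) iota (a - r) /
   (iota (lead_coef P0) * \prod_(r <- s) iota (a - r)).
  by rewrite /k fmorph_div !rmorphM !rmorph_prod.
move: evP0; rewrite PE QE !prodE // sS -[z0 - iota a]invrK -/z kE.
have LQ0 : iota (lead_coef Q) * \prod_(r <- rts Q) iota (a - r) != 0.
  by rewrite -rmorph_prod -rmorphM fmorph_eq0 mulf_neq0 ?lead_coef_eq0 ?prod0.
have LP0 : iota (lead_coef P0) * \prod_(r <- s) iota (a - r) != 0.
  by rewrite -rmorph_prod -rmorphM fmorph_eq0 mulf_neq0 ?lead_coef_eq0 ?prod0.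
move: LQ0 LP0; set lQ := iota _; set pQ := \prod_(r <- rts Q) iota _.
set lP := iota _; set pP := \prod_(r <- s) iota _.
set mP := \prod_(r <- s) _; set mQ := \prod_(r <- rts Q) _ => LQ0 LP0 H.
have H2 : (lP * pP) * mP = (t - iota c) * (lQ * pQ * mQ) * z ^+ (d.+1 - size (rts Q)).
  have zn : z ^+ size (rts Q) != 0 by rewrite expf_neq0.
  have zd : z ^+ d != 0 by rewrite expf_neq0.
  have -> : lP * pP * mP = lP * (z^-1 * (pP * mP / z ^+ d)) * z ^+ d.+1.
    by rewrite exprS; field; rewrite z_0 zd.
  by rewrite H zE1; field.
apply: (mulfI tc0); rewrite mulrA mulVKf // invf_div.
by apply: (mulfI LQ0); rewrite [RHS]mulrA [_ * (_ / _)]mulrC divfK // H2; ring.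
Qed.
End Coordinate.

(** * Tensor products and linear disjointness *)

Section Tensor.
Variables (K : fieldType) (L M T : fieldExtType K).
Variables (iL : {lrmorphism L -> T}) (iM : {lrmorphism M -> T}).
Hypothesis hT : is_tensor_product iL iM.

(** Elements of M independent over K remain independent over L.  Extracting a
    coordinate of the second factor is a bilinear map to L. *)
Lemma tensor_free_right d (X : d.-tuple M) (l : 'I_d -> L) : free X ->
  \sum_i iL (l i) * iM X`_i = 0 -> forall i, l i = 0.
Proof.
move=> fX s0 j; pose f (x : L) (y : M) : L := coord X j y *: x.
have lf : bilinear_for *:%R *:%R f.
  split=> [y a u v | x a u v]; rewrite /f /=.
    by rewrite scalerDr !scalerA mulrC.
  by rewrite linearP scalerDl scalerA.
pose b : {bilinear L -> M -> L} := HB.pack f (bilinear_isBilinear.Build _ _ _ _ _ _ f lf).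
have [[h hE] _] := hT b.
have := congr1 h s0; rewrite linear_sum linear0 => <-.
rewrite (bigD1 j) //= big1 ?addr0 => [|i ij]; rewrite hE /b /= /f coord_free //.
  by rewrite eqxx scale1r.
by rewrite ?(eq_sym j) (negPf ij) scale0r.
Qed.

Lemma tensor_free_left d (X : d.-tuple L) (l : 'I_d -> M) : free X ->
  \sum_i iM (l i) * iL X`_i = 0 -> forall i, l i = 0.
Proof.
move=> fX s0 j; pose f (x : L) (y : M) : M := coord X j x *: y.
have lf : bilinear_for *:%R *:%R f.
  split=> [y a u v | x a u v]; rewrite /f /=.
    by rewrite linearP scalerDl scalerA.
  by rewrite scalerDr !scalerA mulrC.
pose b : {bilinear L -> M -> M} := HB.pack f (bilinear_isBilinear.Build _ _ _ _ _ _ f lf).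
have [[h hE] _] := hT b.
have := congr1 h s0; rewrite linear_sum linear0 => <-.
rewrite (bigD1 j) //= big1 ?addr0 => [|i ij]; rewrite mulrC hE /b /= /f coord_free //.
  by rewrite eqxx scale1r.
by rewrite ?(eq_sym j) (negPf ij) scale0r.
Qed.

(** The pure tensors span: the identity and the projection to W agree on them. *)
Lemma tensor_span (W : {vspace T}) : (forall x y, iL x * iM y \in W) -> W = fullv.
Proof.
move=> hW; pose f (x : L) (y : M) : T := iL x * iM y.
have lf : bilinear_for *:%R *:%R f.
  split=> [y a u v | x a u v]; rewrite /f /= linearP.
    by rewrite mulrDl scalerAl.
  by rewrite mulrDr scalerAr.
pose b : {bilinear L -> M -> T} := HB.pack f (bilinear_isBilinear.Build _ _ _ _ _ _ f lf).
have [_ un] := hT b.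
apply/eqP; rewrite eqEsubv subvf; apply/subvP => v _.
have -> : v = projv W v.
  apply: (un (idfun : {linear T -> T}) (projv W : {linear T -> T})) => x y //=.
  by rewrite projv_id.
exact: memv_proj.
Qed.
End Tensor.

Section Disjoint.
Variables (K : fieldType) (T : fieldExtType K).

(** Linear disjointness of two subfields, stated for the powers of one element:
    if 1, w, ..., w^(d-1) are independent over the base field, for w in E2, then
    they are independent over E1. *)
Definition linearly_disjoint (E1 E2 : {vspace T}) := forall d w (l : 'I_d -> T),
  w \in E2 -> (forall i, l i \in E1) ->
  (forall p : {poly T}, p \is a polyOver 1%VS -> (size p <= d)%N -> root p w -> p = 0) ->
  \sum_(i < d) l i * w ^+ i = 0 -> forall i, l i = 0.

(** The products of elements of E1 and E2 span T. *)
Definition spans (E1 E2 : {vspace T}) := forall W : {vspace T},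
  (forall a b, a \in E1 -> b \in E2 -> a * b \in W) -> W = fullv.
End Disjoint.

Section PairedForms.
Variables (C : numClosedFieldType) (K : fieldType) (T : fieldExtType K).
Variables (iota : {rmorphism C -> T}) (E1 E2 : {subfield T}) (z tau : T).
Local Notation ev := (ev iota).
Hypothesis i1 : forall c, iota c \in 1%VS.
Hypotheses (tz : transc iota z) (gz : forall e, ratl iota z e).
Hypotheses (tau1 : tau \in 1%VS) (gK : forall k : T, k \in 1%VS -> ratl iota tau k).
Variables (x y : T) (Ux Vx A1 B1 Uy Vy A2 B2 : {poly C}) (n1 m1 n2 m2 : nat).
Hypothesis (xE : x \in E1).
Hypotheses (yE : y \in E2) (gy : forall g, g \in E2 -> ratl iota y g).
Hypotheses (cx : cover Ux Vx n1) (hx : ev z Ux = x * ev z Vx) (dx : adjoin_degree E1 z = n1).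
Hypotheses (cy : cover Uy Vy n2) (hy : ev z Uy = y * ev z Vy) (dy : adjoin_degree E2 z = n2).
Hypotheses (c1 : cover A1 B1 m1) (h1 : ev x A1 = tau * ev x B1) (s1 : coprimep B1 B1^`()).
Hypotheses (c2 : cover A2 B2 m2) (h2 : ev y A2 = tau * ev y B2).
Hypotheses (dim1 : \dim E1 = m1) (dim2 : \dim E2 = m2).
Hypotheses (dis : linearly_disjoint E1 E2) (spn : spans E1 E2).

Lemma iotaE (E : {subfield T}) c : iota c \in E.
Proof. by apply: (subvP (sub1v _)). Qed.

Lemma ev_in (E : {subfield T}) u (p : {poly C}) : u \in E -> ev u p \in E.
Proof.
move=> uE; elim/poly_ind: p => [|p c IH]; first by rewrite rmorph0 mem0v.
by rewrite rmorphD rmorphM /= evX evC memvD ?memvM ?iotaE.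
Qed.

Lemma ratl_in (E : {subfield T}) u e : u \in E -> ratl iota u e -> e \in E.
Proof. by move=> uE [p [q [_ ->]]]; rewrite memvM ?memvV ?ev_in. Qed.

Lemma adjoin_z_full (E : {subfield T}) : <<E; z>>%VS = fullv.
Proof.
apply/eqP; rewrite eqEsubv subvf; apply/subvP => v _.
by apply: (@ratl_in <<E; z>>%AS z) => //; exact: memv_adjoin.
Qed.

Lemma dimT (E : {subfield T}) : \dim {:T} = (adjoin_degree E z * \dim E)%N.
Proof. by rewrite -(adjoin_z_full E) dim_Fadjoin. Qed.

Lemma transc_tau : transc iota tau.
Proof.
have tx := transc_cover tz cx hx.
move=> p px; apply/eqP; apply: contraT => p0; have [c xc] := alg_const p0 px.
by have := point_neq tx c1 h1 c; rewrite xc subrr eqxx.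
Qed.

Lemma small_over1 d (P Q : {poly C}) w : coprimep P Q -> maxn (size P) (size Q) = d.+1 ->
  ev w P = tau * ev w Q ->
  forall p : {poly T}, p \is a polyOver 1%VS -> (size p <= d)%N -> root p w -> p = 0.
Proof.
move=> cop mx PQ p p1; apply: (degree_ratl transc_tau cop mx PQ) => i.
exact/gK/(polyOverP p1).
Qed.

Lemma max_cover (A B : {poly C}) m : cover A B m -> maxn (size A) (size B) = m.+1.
Proof. by case=> _ -> -> _ _; apply/maxn_idPl. Qed.

(** The degree of z over C(x) is that of y over C(tau). *)
Lemma degree_y : n1 = m2.
Proof.
have [_ _ _ m20 cop2] := c2; have [_ _ _ m10 _] := c1.
have full : <<E1; y>>%VS = fullv.
  apply: spn => a b aE bE; rewrite (@memvM _ _ <<E1; y>>%AS) //.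
    by rewrite (subvP (subv_adjoin _ _)).
  by apply: (@ratl_in <<E1; y>>%AS y); [exact: memv_adjoin|exact: gy].
have dyE : adjoin_degree E1 y = n1.
  have := dim_Fadjoin E1 y; rewrite full (dimT E1) dx dim1 => /eqP.
  by rewrite eqn_pmul2r // => /eqP ->.
rewrite -dyE; apply/eqP; rewrite eqn_leq; apply/andP; split.
  pose F := map_poly iota A2 - tau *: map_poly iota B2.
  have [_ sA sB _ _] := c2.
  have sF : size F = m2.+1.
    rewrite size_polyDl size_map_poly ?sA // size_polyN.
    by rewrite (leq_ltn_trans (size_scale_leq _ _)) // size_map_poly sB.
  have oF (p : {poly C}) : map_poly iota p \is a polyOver E1.
    by apply/polyOverP => i; rewrite coef_map /= iotaE.
  have tE : tau \in E1 by apply: (subvP (sub1v _)).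
  have FE : F \is a polyOver E1 by rewrite rpredB ?oF // polyOverZ ?oF.
  have Fx : root F y.
    have := h2; rewrite !evE rootE /F hornerD hornerN hornerZ => ->.
    by rewrite subrr.
  have F0 : F != 0 by rewrite -size_poly_gt0 sF.
  by have := dvdp_leq F0 (minPoly_dvdp FE Fx); rewrite size_minPoly sF ltnS.
rewrite leqNgt; apply/negP => lt; pose mu := minPoly E1 y.
have smu : size mu = (adjoin_degree E1 y).+1 by exact: size_minPoly.
have mu_over : mu \is a polyOver E1 by exact: minPolyOver.
have mu0 : \sum_(i < (adjoin_degree E1 y).+1) mu`_i * y ^+ i = 0.
  by rewrite -smu -horner_coef; apply/eqP; exact: root_minPoly.
have H := dis yE (fun i => polyOverP mu_over i) _ mu0.
have /H/(_ ord_max) /= : forall p : {poly T}, p \is a polyOver 1%VS ->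
    (size p <= (adjoin_degree E1 y).+1)%N -> root p y -> p = 0.
  move=> p p1 sp; apply: (small_over1 cop2 (max_cover c2) h2) p1 _.
  exact: leq_trans sp lt.
move=> top; have := monicP (monic_minPoly E1 y); rewrite -/mu lead_coefE smu /= top.
by move/eqP; rewrite eq_sym oner_eq0.
Qed.

Lemma degree_x : n2 = m1.
Proof.
have [_ _ _ m20 _] := c2.
have := dimT E1; rewrite (dimT E2) dx dy dim1 dim2 degree_y mulnC => /eqP.
by rewrite eqn_pmul2l // => /eqP.
Qed.

Theorem paired_le4 : (m1 <= m2)%N -> (size (branch_values A1 B1) <= 4)%N.
Proof.
have tx := transc_cover tz cx hx.
move: cx cy; rewrite degree_y degree_x => cx' cy'.
apply: (branch_values_le4 tz c1 c2 cx' cy' hx hy h1 h2 s1).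
move=> d P Q w p q H cop mx q0 wE PQ sH HE.
have wE2 : w \in E2 by rewrite wE memvM ?memvV ?ev_in.
have H0 := dis (l := fun i : 'I_d => ev x H`_i) wE2 (fun i => ev_in _ xE) (small_over1 cop mx PQ).
have {}H0 : forall i : 'I_d, ev x H`_i = 0.
  apply: H0; rewrite -[RHS]HE ev2E (horner_coef_wide _ (_ : _ <= d)%N).
    by apply: eq_bigr => i _; rewrite coef_map.
  by rewrite (size_map_ev tx).
apply/polyP => i; rewrite coef0; have [id|di] := ltnP i d.
  exact: tx (H0 (Ordinal id)).
by rewrite nth_default // (leq_trans sH).
Qed.
End PairedForms.

Section Constants.
Variable C : numClosedFieldType.
Local Notation K := {fraction {poly C}}.

(** The constants of an extension of C(t). *)
Definition cstA (E : fieldExtType K) : C -> E := in_alg E \o @cst C.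
HB.instance Definition _ (E : fieldExtType K) := GRing.RMorphism.on (cstA E).

(** E = C(x), where tau is the function A/B of x. *)
Definition normal_cover (E : fieldExtType K) (tau : K) (A B : {poly C}) :=
  exists x m, [/\ forall e, ratl (cstA E) x e, cover A B m,
    ev (cstA E) x A = tau%:A * ev (cstA E) x B & coprimep B B^`()].

Variables (L T : fieldExtType K) (i : {lrmorphism L -> T}).

Lemma cstA_morph c : i (cstA L c) = cstA T c.
Proof. by rewrite /cstA /= rmorph_alg. Qed.

Lemma ev_morph x p : i (ev (cstA L) x p) = ev (cstA T) (i x) p.
Proof.
elim/poly_ind: p => [|p c IH]; first by rewrite !rmorph0.
by rewrite !rmorphD !rmorphM /= IH !evX !evC cstA_morph.
Qed.

(** The image of an embedding of fields, as a subfield. *)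
Definition image_field : {subfield T} := (linfun_ahom i @: {:L})%AS.

Lemma image_in x : i x \in image_field.
Proof. by have := memv_img (linfun i) (memvf x); rewrite lfunE. Qed.

Lemma image_inP e : e \in image_field -> exists x, e = i x.
Proof. by move=> /memv_imgP[x _ ->]; exists x; rewrite lfunE. Qed.

Lemma cstA_in1 c : cstA T c \in 1%VS.
Proof. exact: rpredZ (mem1v _). Qed.

Lemma normal_cover_image (x : T) (tau : K) A B m : x \in image_field ->
  (forall g, g \in image_field -> ratl (cstA T) x g) -> cover A B m ->
  ev (cstA T) x A = tau%:A * ev (cstA T) x B -> coprimep B B^`() ->
  normal_cover L tau A B.
Proof.
move=> /image_inP[u ->] gx cAB hA sB; exists u, m; split=> //.
  move=> e; have [p [q [q0 E]]] := gx _ (image_in e).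
  exists p, q; rewrite -!ev_morph in q0 E; split.
    by apply: contraNneq q0 => ->; rewrite rmorph0.
  by apply: (fmorph_inj i); exact: (etrans E (esym (fmorph_div i _ _))).
apply: (fmorph_inj i); rewrite /= ev_morph rmorphM /= ev_morph rmorph_alg.
by [].
Qed.

(** Independence of powers over K, from the absence of a polynomial relation. *)
Lemma free_powers d (w : L) :
  (forall p : {poly T}, p \is a polyOver 1%VS -> (size p <= d)%N -> root p (i w) -> p = 0) ->
  free [tuple w ^+ j | j < d].
Proof.
move=> H; apply/freeP => k k0 j; pose p : {poly T} := \poly_(a < d) (nth 0 [seq k a | a <- enum 'I_d] a)%:A.
have pE (a : 'I_d) : p`_a = (k a)%:A.
  by rewrite coef_poly ltn_ord (nth_map a) ?size_enum_ord // nth_ord_enum.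
have p0 : p = 0.
  apply: H; first by apply/polyOverP => a; rewrite coef_poly; case: ifP => _; rewrite ?mem0v ?rpredZ ?mem1v.
    exact: size_poly.
  rewrite rootE (horner_coef_wide _ (size_poly _ _)); apply/eqP.
  have := congr1 i k0; rewrite linear_sum rmorph0 => E; rewrite -[RHS]E.
  apply: eq_bigr => a _; rewrite pE linearZ /= (nth_map a) ?size_enum_ord // nth_ord_enum.
  by rewrite rmorphXn mulr_algl.
have := pE j; rewrite p0 coef0 => /esym/eqP; rewrite scaler_eq0 oner_eq0 orbF.
by move/eqP.
Qed.
End Constants.

Section Geometric.
Variable C : numClosedFieldType.
Local Notation K := {fraction {poly C}}.
Variables (L M T : fieldExtType K).
Variables (iL : {lrmorphism L -> T}) (iM : {lrmorphism M -> T}).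
Hypothesis hT : is_tensor_product iL iM.

Let EL := image_field iL. Let EM := image_field iM.

Lemma disjoint_LM : linearly_disjoint EL EM.
Proof.
move=> d w l /image_inP[w' ->] lE /free_powers fr s0.
have /choice[l' l'E] j : exists x, l j = iL x by exact: image_inP.
have H := tensor_free_right hT (l := l') fr.
move=> j; rewrite l'E H ?rmorph0 // -[RHS]s0; apply: eq_bigr => k _.
by rewrite l'E (nth_map k) ?size_enum_ord // nth_ord_enum rmorphXn.
Qed.

Lemma disjoint_ML : linearly_disjoint EM EL.
Proof.
move=> d w l /image_inP[w' ->] lE /free_powers fr s0.
have /choice[l' l'E] j : exists x, l j = iM x by exact: image_inP.
have H := tensor_free_left hT (l := l') fr.
move=> j; rewrite l'E H ?rmorph0 // -[RHS]s0; apply: eq_bigr => k _.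
by rewrite l'E (nth_map k) ?size_enum_ord // nth_ord_enum rmorphXn.
Qed.

Lemma spans_LM : spans EL EM.
Proof. by move=> W H; apply: (tensor_span hT) => x y; apply: H; exact: image_in. Qed.

Lemma spans_ML : spans EM EL.
Proof. by move=> W H; apply: spans_LM => a b aE bE; rewrite mulrC H. Qed.

Variable f : {rmorphism K -> T}.
Hypotheses (bf : bijective f) (fC : forall c, f (cst c) = cstA T c).

Lemma tofrac_ev (g : {rmorphism K -> T}) : (forall c, g (cst c) = cstA T c) ->
  forall p : {poly C}, g (tofrac p) = ev (cstA T) (g (tofrac 'X)) p.
Proof.
move=> gC; elim/poly_ind => [|p c IH]; first by rewrite !rmorph0.
rewrite tofracD tofracM [LHS]rmorphD [X in X + _]rmorphM /= IH.
by rewrite rmorphD rmorphM /= evX evC; congr (_ + _); exact: gC.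
Qed.

Lemma frac_ratl (g : {rmorphism K -> T}) : (forall c, g (cst c) = cstA T c) ->
  forall k, ratl (cstA T) (g (tofrac 'X)) (g k).
Proof.
move=> gC k; have [p [q [q0 ->]]] := tofrac_fracP k.
exists p, q; rewrite -!(tofrac_ev gC) fmorph_eq0 tofrac_eq0 q0; split=> //.
exact: fmorph_div.
Qed.

Lemma frac_transc (g : {rmorphism K -> T}) : (forall c, g (cst c) = cstA T c) ->
  transc (cstA T) (g (tofrac 'X)).
Proof.
move=> gC p; rewrite -(tofrac_ev gC) => /eqP.
by rewrite fmorph_eq0 tofrac_eq0 => /eqP.
Qed.

(** The geometric form of the theorem, where tau = 1/(t - c). *)
Theorem geometric : exists c (A1 B1 A2 B2 : {poly C}),
  let tau : K := (tofrac 'X - cst c)^-1 in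
  [/\ normal_cover L tau A1 B1, normal_cover M tau A2 B2 &
      (size (branch_values A1 B1) <= 4)%N \/ (size (branch_values A2 B2) <= 4)%N].
Proof.
have tz0 := frac_transc fC.
have gz0 e : ratl (cstA T) (f (tofrac 'X)) e.
  by have [f' _ fK] := bf; rewrite -(fK e); exact: frac_ratl.
have algC c : in_alg T (cst c) = cstA T c by [].
have tt := frac_transc algC.
have [z [c [A [B [d [tz gz cAB sB hA]]]]]] := coordinate tz0 gz0 tt.
pose tau : K := (tofrac 'X - cst c)^-1.
have tauE : in_alg T tau = (in_alg T (tofrac 'X) - cstA T c)^-1.
  by rewrite /tau fmorphV; congr (_^-1); exact: rmorphB.
have i1 := @cstA_in1 C T.
have tau1 : in_alg T tau \in 1%VS by exact: rpredZ (mem1v _).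
rewrite -tauE in hA.
have gK k : k \in 1%VS -> ratl (cstA T) (in_alg T tau) k.
  move=> /vlineP[a ->]; apply: (ratl_sub (y := in_alg T (tofrac 'X))); last exact: (frac_ratl algC).
  have -> : in_alg T (tofrac 'X) = (in_alg T tau)^-1 + cstA T c by rewrite tauE invrK subrK.
  by apply: ratlD; [apply/ratlV/ratl_id|apply: ratl_const].
have [x [U1 [V1 [A1 [B1 [n1 [m1 [xE gx [cx hx dx] [c1 h1 s1] dim1]]]]]]]] :=
  normal_form EL i1 tz gz cAB sB hA tau1 gK.
have [y [U2 [V2 [A2 [B2 [n2 [m2 [yE gy [cy hy dy] [c2 h2 s2] dim2]]]]]]]] :=
  normal_form EM i1 tz gz cAB sB hA tau1 gK.
exists c, A1, B1, A2, B2; split.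
- exact: (normal_cover_image xE gx c1 h1 s1).
- exact: (normal_cover_image yE gy c2 h2 s2).
have [m12|/ltnW m21] := leqP m1 m2.
  left; exact: (paired_le4 i1 tz gz tau1 gK xE yE gy cx hx dx cy hy dy c1 h1 s1 c2 h2 dim1 dim2 disjoint_LM spans_LM m12).
right; exact: (paired_le4 i1 tz gz tau1 gK yE xE gx cy hy dy cx hx dx c2 h2 s2 c1 h1 dim2 dim1 disjoint_ML spans_ML m21).
Qed.
End Geometric.

(** * Discrete valuations of a rational function field *)

Lemma int_unit (j k : int) : 1 = j * k -> (k == 1) || (k == -1).
Proof.
move=> E; have : (k %| j * k)%Z by rewrite dvdz_mull.
by rewrite -E dvdz1; move: k {E} => k; lia.
Qed.

Section Valuation.
Variables (F : fieldType) (w : F -> int).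
Hypothesis hw : discrete_valuation w.

Lemma valM a b : a != 0 -> b != 0 -> w (a * b) = w a + w b.
Proof. by case: hw => _ h _ _; apply: h. Qed.

Lemma val1 : w 1 = 0.
Proof. by have := valM (oner_neq0 F) (oner_neq0 F); rewrite mulr1; move: (w 1) => k; clear; lia. Qed.

Lemma valN1 : w (-1) = 0.
Proof.
have n0 : -1 != 0 :> F by rewrite oppr_eq0 oner_neq0.
by have := valM n0 n0; rewrite mulrNN mulr1 val1; move: (w (-1)) => k; clear; lia.
Qed.

Lemma valN a : w (- a) = w a.
Proof.
have [->|a0] := eqVneq a 0; first by rewrite oppr0.
by rewrite -mulN1r valM ?valN1 ?add0r // oppr_eq0 oner_neq0.
Qed.

Lemma valV a : a != 0 -> w a^-1 = - w a.
Proof.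
move=> a0; have ai0 : a^-1 != 0 by rewrite invr_eq0.
by have := valM a0 ai0; rewrite mulfV // val1; move: (w a) (w _) => k l; clear; lia.
Qed.

Lemma valD a b : a != 0 -> b != 0 -> a + b != 0 -> Num.min (w a) (w b) <= w (a + b).
Proof. by case: hw => _ _ h _; apply: h. Qed.

(** Two elements of different valuations. *)
Lemma valD_lt a b : a != 0 -> b != 0 -> w a < w b -> w (a + b) = w a.
Proof.
move=> a0 b0 ab; have ab0 : a + b != 0.
  by apply/eqP => /eqP; rewrite addr_eq0 => /eqP E; move: ab; rewrite E valN ltxx.
have h1 := valD a0 b0 ab0; have nb : - b != 0 by rewrite oppr_eq0.
have h2 := @valD (a + b) (- b) ab0 nb; rewrite addrK valN in h2; have {}h2 := h2 a0.
by move: h1 h2 ab; clear; lia.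
Qed.

Variables (C : numClosedFieldType) (iota : {rmorphism C -> F}) (x : F).
Local Notation ev := (ev iota).
Hypotheses (wC : forall c, c != 0 -> w (iota c) = 0) (tx : transc iota x).
Hypothesis gx : forall e, ratl iota x e.

Lemma val_XsubC_neq0 c : x - iota c != 0.
Proof.
by have := transc_neq0 tx (monic_neq0 (monicXsubC c)); rewrite rmorphB /= evX evC.
Qed.

Lemma val_ev (p : {poly C}) : p != 0 -> w (ev x p) = \sum_(r <- rts p) w (x - iota r).
Proof.
move=> p0; rewrite {1}(rtsE p) evZ.
have pr (s : seq C) : ev x (\prod_(r <- s) ('X - r%:P)) != 0 /\
    w (ev x (\prod_(r <- s) ('X - r%:P))) = \sum_(r <- s) w (x - iota r).
  elim: s => [|r s [n0 IH]]; first by rewrite !big_nil rmorph1 val1 oner_neq0.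
  have E : ev x (\prod_(a <- r :: s) ('X - a%:P)) = (x - iota r) * ev x (\prod_(a <- s) ('X - a%:P)).
    by rewrite big_cons rmorphM /= rmorphB /= evX evC.
  by rewrite E big_cons mulf_neq0 ?val_XsubC_neq0 // valM ?val_XsubC_neq0 // IH.
have [n0 E] := pr (rts p).
by rewrite valM ?E ?wC ?add0r ?fmorph_eq0 ?lead_coef_eq0.
Qed.

Lemma x_neq0 : x != 0.
Proof. by have := val_XsubC_neq0 0; rewrite rmorph0 subr0. Qed.

Lemma val_pole (p : {poly C}) : w x < 0 -> p != 0 -> w (ev x p) = (size (rts p))%:Z * w x.
Proof.
move=> x0 p0; rewrite val_ev //; elim: (rts p) => [|r s IH]; first by rewrite big_nil mul0r.
rewrite big_cons IH /=; suff -> : w (x - iota r) = w x by rewrite -add1n PoszD mulrDl mul1r.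
have [->|r0] := eqVneq r 0; first by rewrite rmorph0 subr0.
by rewrite valD_lt ?x_neq0 ?oppr_eq0 ?fmorph_eq0 // valN wC.
Qed.

Lemma val_zero a (p : {poly C}) : 0 < w (x - iota a) -> p != 0 ->
  w (ev x p) = (count_mem a (rts p))%:Z * w (x - iota a).
Proof.
move=> xa0 p0; rewrite val_ev //; elim: (rts p) => [|r s IH]; first by rewrite big_nil mul0r.
rewrite big_cons IH /=; have [->|ra] := eqVneq r a.
  by rewrite ?eqxx PoszD mulrDl mul1r.
rewrite add0n; suff -> : w (x - iota r) = 0 by rewrite add0r.
have ar : iota (a - r) != 0 by rewrite fmorph_eq0 subr_eq0 eq_sym.
have -> : x - iota r = iota (a - r) + (x - iota a) by rewrite rmorphB; ring.
by rewrite valD_lt ?val_XsubC_neq0 // wC // subr_eq0 eq_sym.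
Qed.

Lemma val_frac e : e != 0 -> exists p q : {poly C}, [/\ p != 0, q != 0 & w e = w (ev x p) - w (ev x q)].
Proof.
move=> e0; have [p [q [q0 eE]]] := gx e; exists p, q.
have p0 : ev x p != 0 by apply: contraNneq e0 => p0; rewrite eE p0 mul0r.
split; first by apply: contraNneq p0 => ->; rewrite rmorph0.
  by apply: contraNneq q0 => ->; rewrite rmorph0.
by rewrite eE valM ?invr_eq0 // valV.
Qed.

(** The centre of a valuation of C(x) is infinity or a point a, and there the
    coordinate has valuation -1 or 1. *)
Lemma val_cases : w x = -1 \/ exists a, w (x - iota a) = 1.
Proof.
have [_ _ _ [e [e0 we]]] := hw; have [p [q [p0 q0 E]]] := val_frac e0.
rewrite we in E; have [x0|x0] := ltP (w x) 0.
  left; move: E; rewrite !val_pole // -mulrBl.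
  by move: (w x) x0 => k k0 /int_unit; move: k0; clear; lia.
right; have [[a xa]|na] := pselect (exists a, 0 < w (x - iota a)).
  exists a; move: E; rewrite !(val_zero xa) // -mulrBl.
  by move: (w (x - _)) xa => k k0 /int_unit; move: k0; clear; lia.
have z r : w (x - iota r) = 0.
  apply/eqP; rewrite eq_le; apply/andP; split.
    by rewrite leNgt; apply/negP => h; apply: na; exists r.
  have [->|r0] := eqVneq r 0; first by rewrite rmorph0 subr0.
  have nr : - iota r != 0 by rewrite oppr_eq0 fmorph_eq0.
  have := valD x_neq0 nr (val_XsubC_neq0 r); rewrite valN wC //.
  by rewrite (min_r x0).
move: E; rewrite !val_ev // !big1 //.
Qed.

(** A valuation of C(x) is determined by its centre. *)
Lemma val_unique_formula a e : w (x - iota a) = 1 -> e != 0 ->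
  forall p q, ev x q != 0 -> e = ev x p / ev x q ->
  w e = (count_mem a (rts p))%:Z - (count_mem a (rts q))%:Z.
Proof.
move=> xa e0 p q q0 eE.
have p0 : ev x p != 0 by apply: contraNneq e0 => p0; rewrite eE p0 mul0r.
have xa0 : 0 < w (x - iota a) by rewrite xa.
rewrite eE valM ?invr_eq0 // valV // !(val_zero xa0) ?xa ?mulr1 //.
  by apply: contraNneq q0 => ->; rewrite rmorph0.
by apply: contraNneq p0 => ->; rewrite rmorph0.
Qed.
End Valuation.

(** * The ramification locus *)

Section RamificationPoint.
Variables (C : numClosedFieldType).
Local Notation K := {fraction {poly C}}.
Variables (L : fieldExtType K) (c0 : C) (A B : {poly C}).
Let tau : K := (tofrac 'X - cst c0)^-1.
Hypothesis nc : normal_cover L tau A B.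

Lemma base_transc : transc (@cst C) tau /\ forall k, ratl (@cst C) tau k.
Proof.
have tX : transc (@cst C) (tofrac 'X).
  by move=> p; rewrite -tofracE => /eqP; rewrite tofrac_eq0 => /eqP.
have X0 : tofrac 'X - cst c0 != 0.
  have := transc_neq0 tX (monic_neq0 (monicXsubC c0)).
  by rewrite rmorphB /= evX evC.
have XE : tofrac 'X = tau^-1 + cst c0 by rewrite /tau invrK subrK.
split.
  move=> p px; apply/eqP; apply: contraT => p0; have [c tc] := alg_const p0 px.
  have /tX/eqP : ev (@cst C) (tofrac 'X) ('X - (c^-1 + c0)%:P) = 0.
    rewrite rmorphB /= evX evC XE tc; apply/eqP; rewrite subr_eq0; apply/eqP.
    by rewrite -fmorphV; exact: (esym (rmorphD (@cst C) _ _)).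
  by rewrite polyXsubC_eq0.
move=> k; apply: (ratl_sub (y := tofrac 'X)).
  by rewrite XE; apply: ratlD; [apply/ratlV/ratl_id|apply: ratl_const].
have [p [q [q0 ->]]] := tofrac_fracP k; exists p, q; rewrite -!tofracE tofrac_eq0.
by split.
Qed.

Lemma ev_alg u p : ev (cstA L) u%:A p = (ev (@cst C) u p)%:A.
Proof.
elim/poly_ind: p => [|p c IH]; first by rewrite !rmorph0 scale0r.
by rewrite !rmorphD !rmorphM /= IH !evX !evC scalerDl mulr_algl scalerA.
Qed.

(** The centre on the tau-line of a valuation ramified in L is a branch value:
    the index e is the multiplicity of a point in its fibre, and all poles of tau
    are simple. *)
Lemma ramified_branch (v : K -> int) : discrete_valuation v ->
  (forall c, c != 0 -> v (cst c) = 0) -> ramified_over L v ->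
  exists2 c, c \in branch_values A B & v (tau - cst c) = 1.
Proof.
move=> hv vC [w [e [hw [e0 wv] e1]]].
have [x [m [gx cAB hA sB]]] := nc.
have [tt gt] := base_transc.
have wC c : c != 0 -> w (cstA L c) = 0.
  by move=> c0'; have := wv (cst c); rewrite vC // mulr0.
have tA : transc (cstA L) tau%:A.
  move=> p; rewrite ev_alg => /eqP; rewrite scaler_eq0 oner_eq0 orbF => /eqP; exact: tt.
have [_ sA sB' m0 cop] := cAB.
have tx := degree_transc tA cop hA.
have B0 := cover_B0 cAB; have evB0 := transc_neq0 tx B0.
have A0 : A != 0 by rewrite -size_poly_gt0 sA.
have srA : size (rts A) = m by have := size_rts A0; rewrite sA => -[].
have srB : m = (size (rts B)).+1 by have := size_rts B0; rewrite sB'.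
have wtau c : w (tau%:A - cstA L c) = e%:Z * v (tau - cst c).
  by rewrite -wv scalerBl.
have nz c : tau%:A - cstA L c != 0 by exact: (val_XsubC_neq0 tA).
have t0 : tau%:A != 0 :> L by have := nz 0; rewrite rmorph0 subr0.
have wA c : w (ev (cstA L) x (A - c *: B)) = e%:Z * v (tau - cst c) + w (ev (cstA L) x B).
  by rewrite (point_fibre hA) (valM hw) ?nz // wtau.
have [vt|[c vt]] := val_cases hv vC tt gt.
  have EA : w (ev (cstA L) x A) = - e%:Z + w (ev (cstA L) x B).
    by rewrite hA (valM hw) // wv vt; ring.
  have [wx|[a wx]] := val_cases hw wC tx gx.
    have lt0 : w x < 0 by rewrite wx.
    move: EA; rewrite !(val_pole hw wC tx lt0) // wx srA srB.
    by move: (size _) e1; clear=> *; lia.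
  have gt0 : 0 < w (x - cstA L a) by rewrite wx.
  move: EA; rewrite !(val_zero hw wC tx gt0) // wx !mulr1.
  (* the poles of tau are simple *)
  have cB : (count_mem a (rts B) <= 1)%N.
    rewrite leqNgt count_rts // mup_geq //; exact: coprimep_derivN.
  by move: (count_mem _ _) (count_mem _ _) e1 cB; clear=> *; lia.
exists c => //; have cA0 := cover_neq0 cAB c.
have scA : size (rts (A - c *: B)) = m by have := size_rts cA0; rewrite (cover_size cAB) => -[].
move: (wA c); rewrite vt mulr1.
have [wx|[a wx]] := val_cases hw wC tx gx.
  have lt0 : w x < 0 by rewrite wx.
  rewrite !(val_pole hw wC tx lt0) // wx scA srB.
  by move: (size _) e1; clear=> *; lia.
have gt0 : 0 < w (x - cstA L a) by rewrite wx.
rewrite !(val_zero hw wC tx gt0) // wx !mulr1 => E.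
have big : (2 <= count_mem a (rts (A - c *: B)))%N.
  by move: E e1; move: (count_mem _ _) (count_mem _ _); clear=> *; lia.
apply: (mem_branch cAB); apply/hasP; exists (count_mem a (fib A B c)) => //.
apply: map_f; rewrite mem_undup -has_pred1 has_count.
exact: leq_trans big.
Qed.

Lemma valuation_eq (v v' : K -> int) c : discrete_valuation v -> discrete_valuation v' ->
  (forall a, a != 0 -> v (cst a) = 0) -> (forall a, a != 0 -> v' (cst a) = 0) ->
  v (tau - cst c) = 1 -> v' (tau - cst c) = 1 -> v = v'.
Proof.
move=> hv hv' vC vC' vc vc'; apply/funext => k; have [tt gt] := base_transc.
have [->|k0] := eqVneq k 0; first by case: hv => ->; case: hv' => ->.
have [p [q [q0 kE]]] := gt k.
rewrite (val_unique_formula hv vC tt vc k0 q0 kE).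
by rewrite (val_unique_formula hv' vC' tt vc' k0 q0 kE).
Qed.

Local Open Scope classical_set_scope.
Local Open Scope card_scope.

Lemma card_locus (V : set (K -> int)) : (size (branch_values A B) <= 4)%N ->
  (forall v, V v -> [/\ discrete_valuation v, forall c, c != 0 -> v (cst c) = 0 &
     ramified_over L v]) ->
  V #<= `I_4.
Proof.
move=> s4 hV; set s := branch_values A B in s4.
have [h hE] : exists h : nat -> K -> int, V `<=` h @` `I_4.
  have /choice[h hE] i : exists f : K -> int, forall v, V v -> v (tau - cst s`_i) = 1 -> v = f.
    have [[v [Vv vi]]|no] := pselect (exists v, V v /\ v (tau - cst s`_i) = 1).
      exists v => v' Vv' vi'; have [a1 b1 _] := hV _ Vv; have [a2 b2 _] := hV _ Vv'.
      exact: valuation_eq a2 a1 b2 b1 vi' vi.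
    by exists (fun _ => 0) => v Vv vi; case: no; exists v.
  exists h => v Vv; have [a b r] := hV _ Vv.
  have [c cs vc] := ramified_branch a b r.
  have is4 : (index c s < 4)%N by rewrite (leq_trans _ s4) // index_mem.
  exists (index c s) => //; apply/esym/hE => //.
  by rewrite nth_index.
exact: card_le_trans (subset_card_le hE) (card_image_le _ _).
Qed.
End RamificationPoint.

Theorem theorem1p1 (R : realType) (L M T : fieldExtType (ratfun R))
    (iL : {lrmorphism L -> T}) (iM : {lrmorphism M -> T})
    (hT : is_tensor_product iL iM) (hgenus : genus_zero T) :
  (ramification_locus L #<= `I_4)%card \/ (ramification_locus M #<= `I_4)%card.
Proof.
have [f [bf fC]] := hgenus.
have [c [A1 [B1 [A2 [B2 [n1 n2 b4]]]]]] := @geometric R[i] L M T iL iM hT f bf fC.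
have loc (E : fieldExtType (ratfun R)) v : ramification_locus E v ->
  [/\ discrete_valuation v, forall c, c != 0 -> v (@cst R[i] c) = 0 & ramified_over E v].
  by case=> [[dv vC] r]; split.
by case: b4 => b4; [left; apply: (card_locus n1 b4)|right; apply: (card_locus n2 b4)];
  exact: loc.
Qed.
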